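(* Let $x^0\in\mathbb{C}^n$ be such that at most one coincidence block of $x^0$ is of null type and that this block, if it exists, is a singleton $\{i_0\}$. Then the tangent space to $\mathbb{C}^n/G(r,n)$ at the point $\pi(x^0)$ is spanned by the derivations $\phi\mapsto\Delta_{H_\alpha}^d\phi(x^0)$, $1\le d\le|H_\alpha|$, for each coincidence block $H_\alpha$ of nonzero type, together with the single derivation $\phi\mapsto\Delta_{i_0}\phi(x^0)$ if a null singleton block $\{i_0\}$ is present. Each of these derivations satisfies the Leibniz rule at $x^0$.
   Context: Let $n,r\ge1$ be integers, $\mu_r$ the group of $r$-th roots of unity in $\mathbb{C}$, and $G(r,n)=\mu_r^n\rtimes S_n$ acting on $\mathbb{C}^n$ by $(\zeta;\sigma)\cdot x=(\zeta_1x_{\sigma^{-1}(1)},\dots,\zeta_nx_{\sigma^{-1}(n)})$. Write $x^r=(x_1^r,\dots,x_n^r)$ and let $\pi:\mathbb{C}^n\to\mathbb{C}^n/G(r,n)$ be the quotient map; the quotient (GIT quotient, $\mathrm{Spec}\,\mathbb{C}[x]^{G(r,n)}$) is a smooth $n$-dimensional variety isomorphic to $\mathbb{C}^n$, and to $\mathbb{C}^n_y/S_n$ via $y=x^r$. Tangent vectors at $\pi(x^0)$ are identified with point-derivations on germs at $\pi(x^0)$ of holomorphic functions on the quotient, i.e. on $G(r,n)$-invariant holomorphic functions $\phi$ near the orbit of $x^0$; such a $\phi$ is $\phi(x)=\eta(x^r)$ with $\eta$ an $S_n$-invariant holomorphic function near the orbit of $y^0:=(x^0)^r$. Coincidence blocks: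 $\{1,\dots,n\}=H_1\sqcup\cdots\sqcup H_M$ is the partition in which $i,j$ lie in the same block iff $(x_i^0)^r=(x_j^0)^r$; $b_\alpha$ is the common value of $(x_i^0)^r$, $i\in H_\alpha$. The block is of nonzero type if $b_\alpha\ne0$, of null type if $b_\alpha=0$. Block coordinates: for a block $H_\alpha$ with $m=|H_\alpha|$ and $1\le d\le m$, let $$\hat u_d^{(m)}(y_{H_\alpha})=\sum_{\lambda\vdash d}(-1)^{l(\lambda)-1}\frac{(l(\lambda)-1)!}{\prod_hm_h!}\prod_h\Big(\tfrac{(m-h)!}{m!}\,e_h(y_{H_\alpha})\Big)^{m_h},$$ where $y_{H_\alpha}=(y_i)_{i\in H_\alpha}$, $e_h$ is the elementary symmetric function and $\lambda$ runs over partitions of $d$ with $l(\lambda)$ parts and multiplicities $m_h$. By a result of Zemel, near $y^0$ every $S_n$-invariant holomorphic $\eta$ can be written as a holomorphic function $\Psi$ of the combined coordinates $\big(\hat u_d^{(|H_\alpha|)}(y_{H_\alpha})\big)_{\alpha,\,1\le d\le|H_\alpha|}$. For a block $H_\alpha$ of nonzero type, $\Delta_{H_\alpha}^d\phi(x^0)$ denotes the value at the point corresponding to $y^0$ of the partial derivative of $\Psi$ with respect to the coordinate $\hat u_d^{(|H_\alpha|)}(y_{H_\alpha})$ (this is the regularized value at $y^0$ of $d!\sum_{I\subseteq H_\alpha,|I|=d}\sum_{i\in I}\partial_{y_i}\eta/\prod_{j\in I,j\ne i}(y_j-y_i)$, whose individual terms are singular on the coincidence locus). For the null singleton block, $\Delta_{i_0}\phi(x^0)$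 is the value at $x^0$ of the holomorphic extension across $x_{i_0}=0$ of $\frac{1}{r\,x_{i_0}^{r-1}}\partial_{x_{i_0}}\phi$ (equal to $\frac1{r!}\partial_{x_{i_0}}^r\phi(x^0)$). A derivation $D$ satisfies the Leibniz rule at $x^0$ if $D(\phi\psi)(x^0)=D\phi(x^0)\psi(x^0)+\phi(x^0)D\psi(x^0)$ for all such invariant $\phi,\psi$. *)

(* Defs.v *)
From HB Require Import structures.
From mathcomp Require Import all_boot all_order all_algebra all_fingroup.
From mathcomp Require Import complex.
From mathcomp Require Import boolp classical_sets functions reals topology.
From mathcomp Require Import normedtype derive.

Set Implicit Arguments.
Unset Strict Implicit.
Unset Printing Implicit Defensive.

Import Order.TTheory GRing.Theory Num.Theory.
Import numFieldNormedType.Exports.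

Local Open Scope classical_set_scope.
Local Open Scope ring_scope.

(* The definitions are over an arbitrary [K : numClosedFieldType], so that the
   normed-module structures of [K] and ['rV[K]_n] are the library's; the complex
   numbers are the instance [K := R[i]] with [R : realType].  Differentiability
   and directional derivatives are with respect to the field [K], so for
   [K = R[i]] "differentiable in a neighbourhood" means holomorphic. *)

Section Groups.
Variables (K : numClosedFieldType) (n : nat).

Definition act_grn (z : 'rV[K]_n) (s : 'S_n) (x : 'rV[K]_n) : 'rV[K]_n :=
  \row_i (z 0 i * x 0 ((s^-1)%g i)).

(* Groups are given by the transformations of K^n through which they act. *)
Definition grn (r : nat) : set ('rV[K]_n -> 'rV[K]_n) :=
  [set g | exists (z : 'rV[K]_n) (s : 'S_n),
     (forall i, z 0 i ^+ r = 1) /\ g = act_grn z s].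

Definition symn : set ('rV[K]_n -> 'rV[K]_n) :=
  [set g | exists s : 'S_n, g = fun y : 'rV[K]_n => \row_i y 0 ((s^-1)%g i)].

Definition near_orbit (A : set ('rV[K]_n -> 'rV[K]_n)) (x0 : 'rV[K]_n)
    (P : 'rV[K]_n -> Prop) : Prop :=
  forall g, A g -> \forall x \near g x0, P x.

(* For a finite group [A], the points where the condition below holds for all
   points of the orbit contain an [A]-stable open neighbourhood of the orbit
   of [x0], so this says that [phi] is holomorphic and invariant on such a
   neighbourhood.  The values of [phi] elsewhere are irrelevant. *)
Definition inv_holo (A : set ('rV[K]_n -> 'rV[K]_n)) (x0 : 'rV[K]_n)
    (phi : 'rV[K]_n -> K) : Prop :=
  near_orbit A x0
    (fun x => differentiable phi x /\ forall g, A g -> phi (g x) = phi x).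

End Groups.

Section BlockCoordinates.
Variables (K : numClosedFieldType) (n : nat).

Definition elem_sym (H : {set 'I_n}) (h : nat) (y : 'rV[K]_n) : K :=
  \sum_(I : {set 'I_n} | (I \subset H) && (#|I| == h)) \prod_(i in I) y 0 i.

(* A partition lambda of d is encoded by its multiplicities: [mu h] is the
   multiplicity in lambda of the part [h.+1]. *)
Definition partition_mult (d : nat) (mu : {ffun 'I_d -> 'I_d.+1}) : bool :=
  (\sum_(h < d) h.+1 * mu h == d)%N.

Definition partition_length (d : nat) (mu : {ffun 'I_d -> 'I_d.+1}) : nat :=
  (\sum_(h < d) mu h)%N.

Definition uhat (H : {set 'I_n}) (d : nat) (y : 'rV[K]_n) : K :=
  \sum_(mu : {ffun 'I_d -> 'I_d.+1} | partition_mult mu)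
    (-1) ^+ (partition_length mu).-1
    * (((partition_length mu).-1)`!%:R / (\prod_(h < d) (mu h)`!)%:R)
    * \prod_(h < d)
        ((#|H| - h.+1)`!%:R / (#|H|)`!%:R * elem_sym H h.+1 y) ^+ mu h.

Definition pow_pt (r : nat) (x : 'rV[K]_n) : 'rV[K]_n :=
  map_mx (fun t => t ^+ r) x.

Definition blocks (r : nat) (x0 : 'rV[K]_n) : {set {set 'I_n}} :=
  finset.preim_partition (fun i => x0 0 i ^+ r) [set: 'I_n]%SET.

Definition null_type (r : nat) (x0 : 'rV[K]_n) (H : {set 'I_n}) : bool :=
  [forall i in H, x0 0 i ^+ r == 0].

Definition null_blocks (r : nat) (x0 : 'rV[K]_n) : {set {set 'I_n}} :=
  [set H in blocks r x0 | null_type r x0 H]%SET.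

Definition nonzero_blocks (r : nat) (x0 : 'rV[K]_n) : {set {set 'I_n}} :=
  [set H in blocks r x0 | ~~ null_type r x0 H]%SET.

(* The combined coordinates are indexed by pairs (H, d) with H a block and
   1 <= d <= #|H|.  Such pairs are in bijection with ['I_n]: the pair (H, d)
   corresponds to the d-th smallest element of H. *)
Definition block_rank (H : {set 'I_n}) (i : 'I_n) : nat :=
  #|[set j in H | (j <= i)%N]%SET|.

Definition uhat_map (r : nat) (x0 y : 'rV[K]_n) : 'rV[K]_n :=
  \row_(i < n) let H := finset.pblock (blocks r x0) i in uhat H (block_rank H i) y.

Definition coord_dir (H : {set 'I_n}) (d : nat) : 'rV[K]_n :=
  \row_i ((i \in H) && (block_rank H i == d))%:R.

End BlockCoordinates.

Section Tangent.
Variables (K : numClosedFieldType) (n r : nat) (x0 : 'rV[K]_n).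
Implicit Types (phi psi eta Psi : 'rV[K]_n -> K).
Let y0 := pow_pt r x0.

Definition block_expression phi Psi : Prop :=
  exists eta,
    [/\ inv_holo (symn (n:=n)) y0 eta,
        near_orbit (grn r) x0 (fun x => phi x = eta (pow_pt r x)),
        \forall u \near uhat_map r x0 y0, differentiable Psi u &
        \forall y \near y0, eta y = Psi (uhat_map r x0 y)].

(* [xget] picks a [Psi] as above; two choices agree near [uhat_map r x0 y0]. *)
Definition Delta (H : {set 'I_n}) (d : nat) phi : K :=
  'D_(coord_dir K H d)
    (xget (fun _ : 'rV[K]_n => 0 : K) [set Psi | block_expression phi Psi])
    (uhat_map r x0 y0).

Definition null_extension (i0 : 'I_n) phi (h : 'rV[K]_n -> K) : Prop :=
  (\forall x \near x0, differentiable h x) /\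
  (\forall x \near x0, (x : 'rV[K]_n) 0 i0 != 0 ->
     h x = (r%:R * x 0 i0 ^+ r.-1)^-1 * 'D_(delta_mx 0 i0) phi x).

Definition Delta0 (i0 : 'I_n) phi : K :=
  xget (fun _ : 'rV[K]_n => 0 : K) [set h | null_extension i0 phi h] x0.

Definition leibniz (D : ('rV[K]_n -> K) -> K) : Prop :=
  forall phi psi,
    inv_holo (grn r) x0 phi -> inv_holo (grn r) x0 psi ->
    D (fun x => phi x * psi x) = D phi * psi x0 + phi x0 * D psi.

(* Tangent vectors to the quotient at the image of [x0]: point-derivations on
   germs along the orbit of [x0] of invariant holomorphic functions.  Only the
   values of [D] on such functions are meaningful. *)
Definition tangent_vector (D : ('rV[K]_n -> K) -> K) : Prop :=
  [/\ forall phi psi,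
        inv_holo (grn r) x0 phi -> inv_holo (grn r) x0 psi ->
        near_orbit (grn r) x0 (fun x => phi x = psi x) -> D phi = D psi,
      forall (a : K) phi psi,
        inv_holo (grn r) x0 phi -> inv_holo (grn r) x0 psi ->
        D (fun x => a * phi x + psi x) = a * D phi + D psi &
      leibniz D].

End Tangent.

(* Main.v *)
(** Near [x0] an invariant holomorphic [phi] is [Psi (u (x ^ r))], with [Psi] holomorphic
    in the block coordinates [u].  The map [x |-> u (x ^ r)] is open, so [Psi] is unique
    as a germ, and every germ [Psi] arises from some invariant [phi].  Tangent vectors at
    the image of [x0] are thus the point-derivations of holomorphic germs in [n]
    variables; by Hadamard's lemma [Psi u = Psi u0 + \sum_i (u_i - u0_i) * q_i u] they
    are the combinations of the coordinate derivatives.  Each [Delta H d] is one of these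
    derivatives by definition; so is [Delta0 i0], since [x ^ r] contributes the factor
    [r * x_i0 ^ (r - 1)] to the derivative along [x_i0].

    The existence of [Psi] is a descent along two maps with finite fibres, [x |-> x ^ r]
    and [y |->] elementary symmetric functions of the blocks.  Both descents integrate
    one variable at a time against [p' / p], where the polynomial [p] has the fibre as
    its roots.  The Cauchy formula behind this is Goursat's theorem on squares, over an
    algebraically closed numeric field whose unit interval is compact. *)

Require Import Defs.
From mathcomp Require Import ring lra.
From HB Require Import structures.
From mathcomp Require Import all_boot all_order all_algebra all_fingroup.
From mathcomp Require Import complex.
From mathcomp Require Import boolp classical_sets functions reals topology.
From mathcomp Require Import normedtype landau derive.
Import Order.TTheory GRing.Theory Num.Theory.
Import numFieldNormedType.Exports.
Local Open Scope ring_scope.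
Local Open Scope classical_set_scope.

Set Implicit Arguments.
Unset Strict Implicit.
Unset Printing Implicit Defensive.

(** The obstacle is branching: [x0] may lie on the branch loci of both maps, where no local inverse
    exists, so holomorphy of [Psi] cannot be read off from that of [phi]. A contour enclosing all
    the roots that merge at [x0] can stay fixed while the coefficients of [p] vary, and integrals
    against [p' / p] see the roots only through these coefficients; they are therefore holomorphic
    across the branch locus. Differentiability is pointwise, with no continuity of the derivative,
    whence Goursat. Besides its algebraic structure the field brings only compactness of its unit
    interval: limits of Riemann sums and the archimedean property are extracted from it, and
    [2 * pi * 'i] is replaced by the integral of [1 / (z - b)], of which only a lower bound in norm
    is needed. Squares serve as contours because they subdivide into squares and have straight
    sides. The descent reaches the elementary symmetric functions; the coordinates [uhat] differ
    from them by a triangular polynomial change of variables whose diagonal factors [(m - d)! / m!]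
    are nonzero. *)

(** Stands in for a minimum: the order is only partial, but positive elements are real, hence
    comparable. *)
Lemma pos_lower_bound (K : numDomainType) (a b : K) : 0 < a -> 0 < b ->
  exists c, [/\ 0 < c, c <= a & c <= b].
Proof.
move=> a0 b0; have [ab|ba] := real_leP (gtr0_real a0) (gtr0_real b0).
  by exists a.
by exists b; split => //; exact: ltW.
Qed.

(** * Differentiability with explicit tolerances *)

Section Differentiability.
Variables (K : numFieldType) (V W : normedModType K).
Implicit Types (f : V -> W) (x : V).

Lemma near_normP x (P : V -> Prop) :
  (\forall y \near x, P y) <->
  exists2 e : K, 0 < e & forall y, `|y - x| < e -> P y.
Proof.
split=> [/nbhs_normP[e e0 eP]|[e e0 eP]].
  by exists e => // y yx; apply: eP; rewrite /ball_ /= distrC.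
by apply/nbhs_normP; exists e => // y; rewrite /ball_ /= distrC => /eP.
Qed.

Lemma differentiable_remainder f x (e : K) : differentiable f x -> 0 < e ->
  exists2 d : K, 0 < d &
    forall y, `|y - x| < d -> `|f y - f x - 'd f x (y - x)| <= e * `|y - x|.
Proof.
move=> /diff_locallyP[_ /eqaddoP df] e0.
have /near_normP[d d0 dP] := df _ e0; exists d => // y yd.
by have := dP (y - x); rewrite subr0 !fctE /= subrK opprD addrA; apply.
Qed.

Lemma differentiable_epsP f x (A : {linear V -> W}) : continuous A ->
  (forall e : K, 0 < e -> exists2 d : K, 0 < d &
    forall y, `|y - x| < d -> `|f y - f x - A (y - x)| <= e * `|y - x|) ->
  differentiable f x /\ 'd f x = A :> (V -> W).
Proof.
move=> Ac fA; have fo : f \o shift x = cst (f x) + A +o_ 0 id.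
  apply/eqaddoP => e e0; apply/near_normP; have [d d0 dP] := fA e e0.
  exists d => // h; rewrite subr0 => hd; have := dP (h + x).
  by rewrite addrK => /(_ hd); rewrite !fctE /= opprD addrA.
have dA := diff_unique Ac fo; split => //.
by apply/diff_locallyP; rewrite dA.
Qed.

(** Reduces directional derivatives to one variable, where Cauchy's formula applies. *)
Lemma derive_line f x v : 'D_v f x = 'D_1 (fun t : K => f (x + t *: v)) 0.
Proof.
have E : (fun t : K => t^-1 *: ((f \o shift x) (t *: v) - f x)) = (fun t : K =>
    t^-1 *: (((fun t : K => f (x + t *: v)) \o shift 0) (t *: (1 : K)) - f (x + 0 *: v))).
  apply/funext => t /=.
  by rewrite scale0r !addr0 [t *: v + x]addrC -[t *: (1 : K)]/(t * 1) mulr1.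
by rewrite /derive E.
Qed.

Lemma near_eq_differentiable f g x : (\forall y \near x, f y = g y) ->
  differentiable f x -> differentiable g x.
Proof.
move=> /[dup] /nbhs_singleton fgx /near_normP[r r0 rP] df.
suff H e : 0 < e -> exists2 d : K, 0 < d &
    forall y, `|y - x| < d -> `|g y - g x - 'd f x (y - x)| <= e * `|y - x|.
  by have [] := differentiable_epsP (diff_continuous df) H.
move=> e0; have [d d0 dP] := differentiable_remainder df e0.
have [c [c0 cr cd]] := pos_lower_bound r0 d0; exists c => // y yc.
by rewrite -fgx -rP ?(lt_le_trans yc) // dP // (lt_le_trans yc).
Qed.

(** Cauchy estimates yield second-order remainders with an explicit constant. The same constant [C]
    bounds [A], which makes [A] continuous. *)
Lemma differentiable_quadratic f x (A : {linear V -> W}) (C e : K) :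
  0 <= C -> (forall h, `|A h| <= C * `|h|) -> 0 < e ->
  (forall y, `|y - x| < e -> `|f y - f x - A (y - x)| <= C * `|y - x| ^+ 2) ->
  differentiable f x /\ 'd f x = A :> (V -> W).
Proof.
move=> C0 AC e0 fC; apply: (@differentiable_epsP _ _ A).
  apply/linear_bounded_continuous/linear_boundedP.
  exists C; split; first by rewrite realE C0.
  by move=> r Cr h; apply: (le_trans (AC h)); rewrite ler_wpM2r // ltW.
move=> d d0; have C1 : 0 < C + 1 by rewrite ltr_wpDl.
have m0 : 0 < d / (C + 1) by rewrite divr_gt0.
have [c [c0 ce cd]] := pos_lower_bound e0 m0.
exists c => // y yc; apply: (le_trans (fC _ (lt_le_trans yc ce))).
rewrite expr2 mulrA ler_wpM2r //.
apply: (@le_trans _ _ (C * (d / (C + 1)))).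
  by rewrite ler_wpM2l // ltW // (lt_le_trans yc cd).
by rewrite mulrCA ler_piMr ?(ltW d0)// ler_pdivrMr // mul1r lerDl.
Qed.

Lemma continuous_normP f x : {for x, continuous f} <->
  forall e : K, 0 < e ->
  exists2 d : K, 0 < d & forall y, `|y - x| < d -> `|f y - f x| < e.
Proof.
split=> [/cvgrPdist_lt fc e e0|fc].
  have /near_normP[d d0 dP] := fc e e0; exists d => // y /dP.
  by rewrite distrC.
apply/cvgrPdist_lt => e e0; apply/near_normP.
by have [d d0 dP] := fc e e0; exists d => // y /dP; rewrite distrC.
Qed.

End Differentiability.

Lemma near_normKP (K : numFieldType) (x : K) (P : K -> Prop) :
  (\forall y \near x, P y) <->
  exists2 e : K, 0 < e & forall y, `|y - x| < e -> P y.
Proof. exact: (@near_normP K K). Qed.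

Lemma continuous_normKP (K : numFieldType) (f : K -> K) (x : K) :
  {for x, continuous f} <->
  forall e : K, 0 < e ->
  exists2 d : K, 0 < d & forall y, `|y - x| < d -> `|f y - f x| < e.
Proof. exact: (@continuous_normP K K K). Qed.

(* The library states these for pointwise operations on functions, a form that
   does not unify with an explicit abstraction. *)
Section DifferentiableFun.
Variables (K : numFieldType) (V : normedModType K).
Implicit Types (f g : V -> K) (x : V).

Lemma differentiable_cstE (c : K) x : differentiable (fun=> c) x.
Proof. exact: differentiable_cst. Qed.

Lemma differentiable_addE f g x : differentiable f x -> differentiable g x ->
  differentiable (fun y => f y + g y) x.
Proof. exact: differentiableD. Qed.

Lemma differentiable_subE f g x : differentiable f x -> differentiable g x ->
  differentiable (fun y => f y - g y) x.
Proof. exact: differentiableB. Qed.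

Lemma differentiable_mulE f g x : differentiable f x -> differentiable g x ->
  differentiable (fun y => f y * g y) x.
Proof. exact: differentiableM. Qed.

Lemma differentiable_divE f g x : differentiable f x -> differentiable g x ->
  g x != 0 -> differentiable (fun y => f y / g y) x.
Proof.
move=> df dg g0; apply: differentiable_mulE => //; exact: differentiableV.
Qed.

Lemma differentiable_expE f n x : differentiable f x ->
  differentiable (fun y => f y ^+ n) x.
Proof.
move=> df; elim: n => [|n IH]; first exact: differentiable_cst.
rewrite (_ : (fun y => f y ^+ n.+1) = (fun y => f y * f y ^+ n)).
  exact: differentiable_mulE.
by apply/funext => y; rewrite exprS.
Qed.

Lemma differentiable_sumE (I : Type) (s : seq I) (P : pred I) (F : I -> V -> K) x :
  (forall i, P i -> differentiable (F i) x) ->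
  differentiable (fun y => \sum_(i <- s | P i) F i y) x.
Proof.
move=> dF; elim: s => [|i s IH].
  rewrite (_ : (fun y => _) = (fun=> 0)); first exact: differentiable_cst.
  by apply/funext => y; rewrite big_nil.
rewrite (_ : (fun y => _) = if P i then fun y => F i y + \sum_(j <- s | P j) F j y
  else fun y => \sum_(j <- s | P j) F j y).
  by case: ifP => // Pi; apply: differentiable_addE => //; exact: dF.
by apply/funext => y; rewrite big_cons; case: ifP.
Qed.

Lemma differentiable_prodE (I : Type) (s : seq I) (P : pred I) (F : I -> V -> K) x :
  (forall i, P i -> differentiable (F i) x) ->
  differentiable (fun y => \prod_(i <- s | P i) F i y) x.
Proof.
move=> dF; elim: s => [|i s IH].
  rewrite (_ : (fun y => _) = (fun=> 1)); first exact: differentiable_cst.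
  by apply/funext => y; rewrite big_nil.
rewrite (_ : (fun y => _) = if P i then fun y => F i y * \prod_(j <- s | P j) F j y
  else fun y => \prod_(j <- s | P j) F j y).
  by case: ifP => // Pi; apply: differentiable_mulE => //; exact: dF.
by apply/funext => y; rewrite big_cons; case: ifP.
Qed.

Lemma differentiable_line (v h : V) (z : K) :
  differentiable (fun z : K => v + z *: h) z.
Proof.
have := @differentiableD _ K V (cst v) (fun z : K => z *: h) z.
apply; first exact: differentiable_cst.
exact: (@differentiableZl _ _ _ id).
Qed.

End DifferentiableFun.

Lemma differentiable_fst (K : numFieldType) (V W : normedModType K)
    (x : (V * W)%type) : differentiable (fun p : (V * W)%type => p.1) x.
Proof.
apply: (@linear_differentiable K (V * W)%type V fst x) => y; exact: cvg_fst.
Qed.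

Lemma differentiable_snd (K : numFieldType) (V W : normedModType K)
    (x : (V * W)%type) : differentiable (fun p : (V * W)%type => p.2) x.
Proof.
apply: (@linear_differentiable K (V * W)%type W snd x) => y; exact: cvg_snd.
Qed.

(** * Integrals along segments and squares *)

(* Limits of bounded sequences along a fixed ultrafilter finer than [\oo]:
   Riemann sums then define an integral that is linear and monotone on all
   bounded functions, with no integrability side condition. *)
Section UltraLimit.
Variable K : numClosedFieldType.
Hypothesis unit_compact : compact [set t : K | 0 <= t <= 1].

Definition bounded_seq (u : nat -> K) := exists M, forall n, `|u n| <= M.

Definition null_seq (u : nat -> K) :=
  forall e : K, 0 < e -> exists N, forall n, (N <= n)%N -> `|u n| < e.

Lemma norm_Re_le (z : K) : `|'Re z| <= `|z|.
Proof. by rewrite leif_normC_Re_Creal. Qed.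

Lemma norm_Im_le (z : K) : `|'Im z| <= `|z|.
Proof.
by have := norm_Re_le ('i * z); rewrite ReMil normrN normrM normCi mul1r.
Qed.

(** Compactness gives a cluster point [l] of the image filter, and for an ultrafilter it is a limit:
    were the indices near [l] not in [U], their complement would be, and its image would meet every
    ball around [l]. *)
Lemma ultra_unit (U : set_system nat) (UU : UltraFilter U) (u : nat -> K) :
  (forall n, 0 <= u n <= 1) ->
  exists l : K, forall e : K, 0 < e -> U [set n | `|u n - l| < e].
Proof.
move=> uM; have UM : (u @ U) [set t : K | 0 <= t <= 1].
  by apply: (@filterS _ U _ setT) => [n _ /=|]; [exact: uM|exact: filterT].
have [l [_ lU]] := @unit_compact (u @ U) _ UM; exists l => e e0.
have [//|UnA] := in_ultra_setVsetC [set n | `|u n - l| < e] UU.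
have [x [ux lx]] := lU (u @` ~` [set n | `|u n - l| < e]) (ball l e)
  (filterS (fun n nA => ex_intro2 _ _ n nA erefl) UnA) (nbhsx_ballx _ _ e0).
by case: ux => n /= nA unx; case: nA; rewrite unx distrC.
Qed.

(** Real and imaginary parts are each rescaled from [[-M, M]] to the unit interval; [M] exceeds the
    given bound by 1 so that one may divide by it. *)
Lemma ultra_complex (U : set_system nat) (UU : UltraFilter U) (u : nat -> K) :
  bounded_seq u ->
  exists l : K, forall e : K, 0 < e -> U [set n | `|u n - l| < e].
Proof.
move=> [M0 uM0]; have M00 : 0 <= M0 := le_trans (normr_ge0 _) (uM0 0%N).
pose M := M0 + 1; have Mp : 0 < M by rewrite ltr_wpDl.
have unitE (x : K) : x \is Num.real -> `|x| <= M -> 0 <= (x + M) / (M *+ 2) <= 1.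
  move=> xr; rewrite real_ler_norml // => /andP[x1 x2].
  rewrite divr_ge0 ?mulrn_wge0 ?(ltW Mp) ?ler_pdivrMr ?mulrn_wgt0 //=.
    by rewrite mul1r mulr2n lerD2r.
  by rewrite -lerBlDr sub0r.
have uM n : `|u n| <= M by rewrite (le_trans (uM0 n)) // lerDl.
have [a aU] := ultra_unit UU (fun n => unitE _ (Creal_Re (u n))
  (le_trans (norm_Re_le _) (uM n))).
have [b bU] := ultra_unit UU (fun n => unitE _ (Creal_Im (u n))
  (le_trans (norm_Im_le _) (uM n))).
exists ((M *+ 2) * a - M + 'i * ((M *+ 2) * b - M)) => e e0.
have M2 : 0 < M *+ 2 by rewrite mulrn_wgt0.
have M2n : M *+ 2 != 0 by rewrite gt_eqF.
have d0 : 0 < e / 2 / (M *+ 2) by rewrite !divr_gt0.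
apply: filterS (filterI (aU _ d0) (bU _ d0)) => n [/= na nb].
have -> : u n - (M *+ 2 * a - M + 'i * (M *+ 2 * b - M)) =
    M *+ 2 * ((('Re (u n) + M) / (M *+ 2) - a)
    + 'i * (('Im (u n) + M) / (M *+ 2) - b)).
  by rewrite [u n in LHS]Crect; field; rewrite ?gt_eqF // ?pnatr_eq0.
rewrite normrM gtr0_norm // mulrC -ltr_pdivlMr //.
rewrite (le_lt_trans (ler_normD _ _)) // normrM normCi mul1r.
rewrite [ltRHS](_ : _ = e / 2 / (M *+ 2) + e / 2 / (M *+ 2)) ?ltrD //.
by rewrite -mulrDl -splitr.
Qed.

(** The second property provides just one index per tolerance, which is enough to carry bounds over
    to the limit. The third holds because the ultrafilter refines [\oo]. *)
Lemma ulim_exists : exists L : (nat -> K) -> K,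
  [/\ forall a u v, bounded_seq u -> bounded_seq v ->
        L (fun n => a * u n + v n) = a * L u + L v,
      forall u, bounded_seq u ->
        forall e : K, 0 < e -> exists n, `|u n - L u| < e &
      forall u, null_seq u -> L u = 0].
Proof.
have [U [UU ooU]] := @ultraFilterLemma _ \oo _.
have Uex (A : set nat) : U A -> exists n, A n by exact: filter_ex.
pose L u := xget (0 : K) [set l | forall e, 0 < e -> U [set n | `|u n - l| < e]].
have LP u : bounded_seq u -> forall e, 0 < e -> U [set n | `|u n - L u| < e].
  by move=> /(ultra_complex UU)/xgetPex; exact.
have Lu u l : bounded_seq u -> (forall e, 0 < e -> U [set n | `|u n - l| < e]) ->
    L u = l.
  move=> bu ul; apply/eqP; rewrite -subr_eq0 -normr_le0; apply/ler_addgt0Pl => e e0.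
  have e20 : 0 < e / 2 by rewrite divr_gt0.
  have [n [/= h1 h2]] := Uex _ (filterI (LP _ bu _ e20) (ul _ e20)).
  rewrite addr0; have -> : L u - l = (u n - l) - (u n - L u) by ring.
  by rewrite [leRHS]splitr (le_trans (ler_normB _ _)) // ltW // ltrD.
exists L; split=> [a u v [M uM] [N vN]|u bu e e0|u u0].
- have bu : bounded_seq u by exists M.
  have bv : bounded_seq v by exists N.
  apply: Lu.
    exists (`|a| * M + N) => n; rewrite (le_trans (ler_normD _ _))// lerD //.
    by rewrite normrM ler_wpM2l.
  move=> e e0; have a1 : 0 < `|a| + 1 by rewrite ltr_wpDl.
  have d0 : 0 < e / 2 / (`|a| + 1) by rewrite !divr_gt0.
  have e20 : 0 < e / 2 by rewrite divr_gt0.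
  apply: filterS (filterI (LP _ bu _ d0) (LP _ bv _ e20)) => n [/= h1 h2].
  have -> : a * u n + v n - (a * L u + L v) = a * (u n - L u) + (v n - L v) by ring.
  rewrite (le_lt_trans (ler_normD _ _)) // [ltRHS]splitr ler_ltD //.
  rewrite normrM (@le_trans _ _ (`|a| * (e / 2 / (`|a| + 1)))) //.
    by rewrite ler_wpM2l // ltW.
  by rewrite mulrCA ler_piMr ?(ltW e20)// ler_pdivrMr // mul1r lerDl.
- exact: Uex _ (LP _ bu _ e0).
have [N uN] := u0 _ ltr01.
have bu : bounded_seq u.
  exists (\sum_(k < N) `|u k| + 1) => n; have [Nn|nN] := leqP N n.
    by apply: ler_wpDl (ltW (uN _ Nn)); apply: sumr_ge0.
  rewrite (bigD1 (Ordinal nN)) //= -addrA lerDl addr_ge0 //; exact: sumr_ge0.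
apply: Lu => // e e0; have [N' uN'] := u0 _ e0.
by apply: ooU; exists N' => // n /= nN'; rewrite subr0 uN'.
Qed.

Definition ulim : (nat -> K) -> K := xget (fun=> 0) [set L | 
  [/\ forall a u v, bounded_seq u -> bounded_seq v ->
        L (fun n => a * u n + v n) = a * L u + L v,
      forall u, bounded_seq u ->
        forall e : K, 0 < e -> exists n, `|u n - L u| < e &
      forall u, null_seq u -> L u = 0]].

Lemma ulimP a u v : bounded_seq u -> bounded_seq v ->
  ulim (fun n => a * u n + v n) = a * ulim u + ulim v.
Proof. by have [+ _ _] := xgetPex (fun=> 0) ulim_exists; exact. Qed.

Lemma ulim_approx u (e : K) : bounded_seq u -> 0 < e ->
  exists n, `|u n - ulim u| < e.
Proof. by move=> bu; have [_ + _] := xgetPex (fun=> 0) ulim_exists; exact. Qed.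

Lemma ulim_norm u M : (forall n, `|u n| <= M) -> `|ulim u| <= M.
Proof.
move=> uM; have bu : bounded_seq u by exists M.
apply/ler_addgt0Pl => e e0; have [n h] := ulim_approx bu e0.
have -> : ulim u = u n - (u n - ulim u) by ring.
by rewrite (le_trans (ler_normB _ _)) // addrC lerD // ltW.
Qed.

Lemma ulim_null u : null_seq u -> ulim u = 0.
Proof. by have [_ _ +] := xgetPex (fun=> 0) ulim_exists; exact. Qed.

End UltraLimit.

Section Compactness.
Variable K : numFieldType.

(** A tube lemma. The bound and the radius are found together: the parameter of the near-covering
    ranges over the product of [+oo] and [nbhs w0]. *)
Lemma compact_bounded_near (A : set K) (V : normedModType K) (F : K -> V -> K)
    (w0 : V) : compact A ->
  (forall t, A t -> {for (t, w0), continuous (fun p : K * V => F p.1 p.2)}) ->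
  exists M e : K, [/\ 0 <= M, 0 < e &
    forall t w, A t -> `|w - w0| < e -> `|F t w| <= M].
Proof.
move=> /compact_near_coveringP cA Fc.
pose P (Mw : K * V) t := `|F t Mw.2| <= Mw.1.
have FF : Filter (filter_prod (+oo : set_system K) (nbhs w0)) by typeclasses eauto.
have : forall t, A t -> filter_prod (nbhs t)
    (filter_prod (+oo : set_system K) (nbhs w0)) (fun p => P p.2 p.1).
  move=> t At.
  have /cvgrPdist_lt/(_ 1 ltr01)/= [[Q1 Q2] /= [Q1t Q2w] QQ] := Fc t At.
  exists (Q1, [set M | `|F t w0| + 1 <= M] `*` Q2).
    split => //; exists ([set M | `|F t w0| + 1 <= M], Q2) => //.
    split => //=; exists (`|F t w0| + 1); split; first by rewrite realD ?normr_real ?real1.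
    by move=> x /ltW.
  case=> t' [M w] /= [Q1t' [FM Q2w']]; have /= := QQ (t', w) (conj Q1t' Q2w').
  move=> /ltW Fd; apply: le_trans FM.
  have -> : F t' w = F t w0 - (F t w0 - F t' w) by ring.
  by rewrite (le_trans (ler_normB _ _)) // lerD2l.
move=> /(cA _ _ P FF)[[P1 P2] /= [[M [Mr P1M]] /near_normP[e e0 P2e]] PP].
exists (`|M| + 1), e; split => [||t w At we]; rewrite ?addr_ge0 //.
apply: (PP (_, w)) At; split => /=; last exact: P2e.
by apply: P1M; rewrite (le_lt_trans (real_ler_norm Mr)) // ltrDl.
Qed.

End Compactness.

Section Segments.
Variable K : numClosedFieldType.
Hypothesis unit_compact : compact [set t : K | 0 <= t <= 1].
Implicit Types (p v s z w a b e : K) (g h : K -> K).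

Definition seg p v : set K := [set p + t * v | t in [set t : K | 0 <= t <= 1]].

Lemma seg_start p v : seg p v p.
Proof. by exists 0; rewrite /= ?lexx ?ler01 // mul0r addr0. Qed.

Lemma seg_left p v : seg p (v / 2) `<=` seg p v.
Proof.
move=> z [t /= /andP[t0 t1] <-]; exists (t / 2); last by rewrite mulrA mulrAC.
by rewrite /= divr_ge0 //= ler_pdivrMr // mul1r (le_trans t1) // ler1n.
Qed.

Lemma seg_right p v : seg (p + v / 2) (v / 2) `<=` seg p v.
Proof.
move=> z [t /= /andP[t0 t1] <-]; exists ((1 + t) / 2).
  by rewrite /= divr_ge0 ?addr_ge0 //= ler_pdivrMr // mul1r mulr2n lerD2l.
by field.
Qed.

Lemma seg_compact p v : compact (seg p v).
Proof.
apply: continuous_compact unit_compact; apply: continuous_subspaceT => t.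
apply: (@differentiable_continuous _ _ _ t (fun t : K => p + t * v)).
apply: differentiable_addE; first exact: differentiable_cst.
by apply: differentiable_mulE; last exact: differentiable_cst.
Qed.

(** Heine's theorem, with [w] ranging over the whole field and not only over [A]. *)
Lemma compact_uniform (A : set K) g : compact A ->
  (forall z, A z -> {for z, continuous g}) -> forall e : K, 0 < e ->
  exists2 d : K, 0 < d & forall z w, A z -> `|w - z| < d -> `|g w - g z| < e.
Proof.
move=> /compact_near_coveringP cA gc e e0.
pose P w z := `|g (w + z) - g z| < e.
have : forall z, A z -> filter_prod (nbhs z) (nbhs (0 : K)) (fun q => P q.2 q.1).
  move=> z Az; have e20 : 0 < e / 2 by rewrite divr_gt0.
  have /continuous_normKP/(_ _ e20)[d d0 dP] := gc z Az.
  have d20 : 0 < d / 2 by rewrite divr_gt0.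
  exists ([set w | `|w - z| < d / 2], [set w | `|w| < d / 2]).
    split; apply/near_normKP; exists (d / 2) => //= w.
    by rewrite subr0.
  move=> [z' w] /= [z'z w0]; rewrite /P /=.
  have h1 := dP z' (lt_le_trans z'z _).
  have h2 : `|g (w + z') - g z| < e / 2.
    apply: dP; rewrite -addrA (le_lt_trans (ler_normD _ _)) //.
    by rewrite [ltRHS]splitr ltrD.
  have -> : g (w + z') - g z' = (g (w + z') - g z) - (g z' - g z) by ring.
  rewrite (le_lt_trans (ler_normB _ _)) // [ltRHS]splitr ltrD // h1 //.
  by rewrite ler_pdivrMr // ler_peMr ?ler1n // ltW.
move=> /(cA _ _ P _) /near_normKP[d d0 dP]; exists d => // z w Az wz.
by have := dP (w - z); rewrite subr0 => /(_ wz _ Az); rewrite /P subrK.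
Qed.

Lemma compact_image_bounded (A : set K) g : compact A ->
  (forall z, A z -> {for z, continuous g}) ->
  exists M, 0 <= M /\ forall z, A z -> `|g z| <= M.
Proof.
move=> cA gc; have [|M [e [M0 e0 gM]]] :=
  @compact_bounded_near K A K (fun z _ => g z) 0 cA.
  move=> t At; apply: (@continuous_comp _ _ _ fst g); first exact: cvg_fst.
  exact: gc.
by exists M; split => // z Az; apply: (gM z 0); rewrite // subrr normr0.
Qed.

Definition bounded_on (A : set K) g := exists M, forall z, A z -> `|g z| <= M.

Lemma bounded_on_lin (A : set K) a g h : bounded_on A g -> bounded_on A h ->
  bounded_on A (fun z => a * g z + h z).
Proof.
move=> [M gM] [N hN]; exists (`|a| * M + N) => z Az.
rewrite (le_trans (ler_normD _ _))// lerD ?hN // normrM ler_wpM2l //.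
exact: gM.
Qed.

Lemma bounded_on_sub (A B : set K) g : A `<=` B -> bounded_on B g -> bounded_on A g.
Proof. by move=> AB [M gM]; exists M => z /AB/gM. Qed.

(** Left Riemann sum over [2 ^ N] equal pieces, written by bisection so that induction on [N] halves
    the segment. *)
Fixpoint riemann (N : nat) g p v : K :=
  if N is N'.+1 then riemann N' g p (v / 2) + riemann N' g (p + v / 2) (v / 2)
  else v * g p.

Lemma riemann_norm N g p v M : (forall z, seg p v z -> `|g z| <= M) ->
  `|riemann N g p v| <= `|v| * M.
Proof.
elim: N p v => [|N IH] p v gM /=.
  by rewrite normrM ler_wpM2l // gM //; exact: seg_start.
have v2 : `|v| * M = `|v / 2| * M + `|v / 2| * M.
  by rewrite normrM normfV normr_nat -mulrDl -splitr.
rewrite (le_trans (ler_normD _ _))// v2 lerD // IH // => z zs; apply: gM.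
  exact: seg_left.
exact: seg_right.
Qed.

Lemma riemann_lin N a g h p v :
  riemann N (fun z => a * g z + h z) p v = a * riemann N g p v + riemann N h p v.
Proof. by elim: N p v => [|N IH] p v /=; rewrite ?IH; ring. Qed.

(** Refining adds to each sample point the midpoint of its piece, at displacement [v / 2 ^+ N.+1],
    so only the variation of [g] over half a piece matters. *)
Lemma riemann_step N g p v e :
  (forall z, seg p v z -> `|g (z + v / 2 ^+ N.+1) - g z| <= e) ->
  `|riemann N.+1 g p v - riemann N g p v| <= `|v| * e.
Proof.
elim: N p v => [|N IH] p v ge.
  have -> : riemann 1 g p v - riemann 0 g p v = (v / 2) * (g (p + v / 2) - g p).
    by rewrite /=; field.
  rewrite normrM normrM normfV normr_nat.
  have := ge _ (seg_start p v); rewrite expr1 => gpe.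
  rewrite ler_pM ?mulr_ge0 ?invr_ge0 // ler_pdivrMr // ler_peMr //.
  by rewrite ler1n.
have E : v / 2 / 2 ^+ N.+1 = v / 2 ^+ N.+2 by rewrite -mulrA -invfM -exprS.
have v2 : `|v| * e = `|v / 2| * e + `|v / 2| * e.
  by rewrite normrM normfV normr_nat -mulrDl -splitr.
have -> : riemann N.+2 g p v - riemann N.+1 g p v =
   (riemann N.+1 g p (v / 2) - riemann N g p (v / 2)) +
   (riemann N.+1 g (p + v / 2) (v / 2) - riemann N g (p + v / 2) (v / 2)).
  by rewrite /=; ring.
rewrite (le_trans (ler_normD _ _))// v2 lerD // IH // => z zs; rewrite E ge //.
  exact: seg_left.
exact: seg_right.
Qed.

(** The archimedean property, from compactness. If all [2 ^- n] were at least [e], two terms of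
    indices [n < m] within [e / 4] of a cluster point would differ by less than [e / 2], while their
    difference is at least [2 ^- n / 2]. *)
Lemma inv_expr2_null e : 0 < e -> exists N, forall n, (N <= n)%N -> 2 ^- n < e.
Proof.
move=> e0; have p2 n : 0 < (2 : K) ^- n by rewrite invr_gt0 exprn_gt0.
have mono m n : (m <= n)%N -> (2 : K) ^- n <= 2 ^- m.
  by move=> mn; rewrite lef_pV2 ?posrE ?exprn_gt0 // ler_weXn2l // ler1n.
suff [N Ne] : exists N, (2 : K) ^- N < e.
  by exists N => n /mono nN; exact: le_lt_trans Ne.
apply: contrapT => /forallNP H.
have {}H n : e <= (2 : K) ^- n.
  by have := H n; rewrite real_ltNge ?gtr0_real // => /negP; rewrite negbK.
have oo01 : ((fun n => (2 : K) ^- n) @ \oo) [set t : K | 0 <= t <= 1].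
  exists 0%N => // n _ /=; rewrite ltW //= invf_le1 ?exprn_gt0 //.
  by rewrite exprn_ege1 // ler1n.
have [l [_ lcl]] := @unit_compact _ _ oo01.
have e4 : 0 < e / 4 by rewrite divr_gt0.
have cl N : exists n, (N <= n)%N /\ `|l - 2 ^- n| < e / 4.
  have [|x [[n Nn <-] lx]] := lcl
     [set 2 ^- n | n in [set n | (N <= n)%N]] _ _ (nbhsx_ballx l _ e4).
    by exists N => // n Nn; exists n.
  by exists n.
have [n [_ nl]] := cl 0%N; have [m [nm ml]] := cl n.+1.
have : (2 : K) ^- n - 2 ^- m < e / 4 + e / 4.
  apply: le_lt_trans (ltrD nl ml); rewrite (le_trans (real_ler_norm _)) //.
    by rewrite realB // gtr0_real.
  have -> : (2 : K) ^- n - 2 ^- m = (l - 2 ^- m) - (l - 2 ^- n) by ring.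
  by rewrite [leRHS]addrC ler_normB.
apply/negP; rewrite -real_leNgt; [|by rewrite realD ?gtr0_real|by rewrite realB ?gtr0_real].
have -> : e / 4 + e / 4 = e - e / 2 by field.
apply: (@le_trans _ _ (2 ^- n - 2 ^- n.+1)); last first.
  by rewrite lerD2l lerN2 mono.
have -> : (2 : K) ^- n - 2 ^- n.+1 = 2 ^- n / 2.
  by rewrite exprS invfM; field; rewrite expf_neq0 // pnatr_eq0.
have -> : e - e / 2 = e / 2 by field.
by rewrite ler_pM2r ?invr_gt0.
Qed.

Lemma div_expr2_null x e : 0 < e ->
  exists N, forall n, (N <= n)%N -> `|x / 2 ^+ n| < e.
Proof.
move=> e0; have x1 : 0 < `|x| + 1 by rewrite ltr_wpDl.
have [|N NP] := @inv_expr2_null (e / (`|x| + 1)); first by rewrite divr_gt0.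
exists N => n /NP; rewrite ltr_pdivlMr // => h.
rewrite normrM normfV normrX normr_nat mulrC; apply: le_lt_trans h.
by rewrite ler_wpM2l ?invr_ge0 ?exprn_ge0 // lerDl.
Qed.

Local Notation ulim := (@ulim K).

Definition Jint g p v := ulim (fun N => riemann N g p v).

Lemma riemann_bounded g p v : bounded_on (seg p v) g ->
  bounded_seq (fun N => riemann N g p v).
Proof. by move=> [M gM]; exists (`|v| * M) => N; exact: riemann_norm. Qed.

Lemma bounded_seq_lin a (u u' : nat -> K) : bounded_seq u -> bounded_seq u' ->
  bounded_seq (fun n => a * u n + u' n).
Proof.
move=> [M uM] [N uN]; exists (`|a| * M + N) => n.
by rewrite (le_trans (ler_normD _ _))// lerD ?uN // normrM ler_wpM2l.
Qed.

Lemma continuous_bounded_seg g p v :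
  (forall z, seg p v z -> {for z, continuous g}) -> bounded_on (seg p v) g.
Proof.
by move=> /(compact_image_bounded (@seg_compact p v))[M [_ gM]]; exists M.
Qed.

(** A limit along an ultrafilter need not be invariant under a shift of the index. Here it is,
    because uniform continuity makes [riemann N.+1] minus [riemann N] a null sequence. *)
Lemma Jint_bisect g p v : (forall z, seg p v z -> {for z, continuous g}) ->
  Jint g p v = Jint g p (v / 2) + Jint g (p + v / 2) (v / 2).
Proof.
move=> gc; have gb := continuous_bounded_seg gc.
have gb1 := bounded_on_sub (@seg_left p v) gb.
have gb2 := bounded_on_sub (@seg_right p v) gb.
have b0 := riemann_bounded gb; have b1 := riemann_bounded gb1.
have b2 := riemann_bounded gb2.
have b0' : bounded_seq (fun N => riemann N.+1 g p v).
  by case: b0 => M bM; exists M.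
transitivity (ulim (fun N => riemann N.+1 g p v)); last first.
  have -> : Jint g p (v / 2) + Jint g (p + v / 2) (v / 2) = ulim (fun N =>
      1 * riemann N g p (v / 2) + riemann N g (p + v / 2) (v / 2)).
    by rewrite ulimP // mul1r.
  by congr ulim; apply/funext => N /=; rewrite mul1r.
apply/eqP; rewrite eq_sym -subr_eq0; apply/eqP.
have -> : ulim (fun N => riemann N.+1 g p v) - Jint g p v =
    ulim (fun N => -1 * riemann N g p v + riemann N.+1 g p v).
  by rewrite ulimP // mulN1r addrC.
apply: ulim_null => // e e0.
have v1 : 0 < `|v| + 1 by rewrite ltr_wpDl.
have d0 : 0 < e / (`|v| + 1) by rewrite divr_gt0.
have [d dp dP] := compact_uniform (@seg_compact p v) gc d0.
have [N NP] := div_expr2_null v dp.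
exists N => n nN; rewrite mulN1r addrC.
apply: (@le_lt_trans _ _ (`|v| * (e / (`|v| + 1)))).
  apply: riemann_step => z zs; rewrite ltW // dP // addrAC subrr add0r NP //.
  by rewrite (leq_trans nN).
by rewrite mulrCA gtr_pMr // ltr_pdivrMr // mul1r ltrDl.
Qed.

Lemma Jint_norm g p v M : (forall z, seg p v z -> `|g z| <= M) ->
  `|Jint g p v| <= `|v| * M.
Proof. by move=> gM; apply: ulim_norm => // N; exact: riemann_norm. Qed.

Lemma Jint_lin a g h p v : bounded_on (seg p v) g -> bounded_on (seg p v) h ->
  Jint (fun z => a * g z + h z) p v = a * Jint g p v + Jint h p v.
Proof.
move=> /riemann_bounded gb /riemann_bounded hb; rewrite /Jint -ulimP //.
by congr ulim; apply/funext => N; rewrite riemann_lin.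
Qed.

End Segments.

Section Squares.
Variable K : numClosedFieldType.
Hypothesis unit_compact : compact [set t : K | 0 <= t <= 1].
Implicit Types (p s z w a b e : K) (g h : K -> K).

Definition square_bdry p s : set K :=
  seg p s `|` seg (p + s) (s * 'i) `|` seg (p + s * 'i) s `|` seg p (s * 'i).

(** The inequalities also say that [a] and [b] are real, since elements comparable with 0 are. *)
Definition square p s : set K :=
  [set z | exists a b, [/\ 0 <= a <= s, 0 <= b <= s & z = p + a + b * 'i]].

(** Counterclockwise: the top and left sides are parametrised rightwards and upwards, whence the
    minus signs. *)
Definition square_int g p s : K :=
  Jint g p s + Jint g (p + s) (s * 'i) - Jint g (p + s * 'i) s - Jint g p (s * 'i).

Definition square_sum N g p s : K := riemann N g p s + riemann N g (p + s) (s * 'i)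
  - riemann N g (p + s * 'i) s - riemann N g p (s * 'i).

Lemma bounded_square_bdry p s g : bounded_on (square_bdry p s) g ->
  [/\ bounded_on (seg p s) g, bounded_on (seg (p + s) (s * 'i)) g,
     bounded_on (seg (p + s * 'i) s) g & bounded_on (seg p (s * 'i)) g].
Proof.
by move=> gb; split; apply: bounded_on_sub gb => z zs; rewrite /square_bdry;
  [left;left;left|left;left;right|left;right|right].
Qed.

Lemma square_int_ulim g p s : bounded_on (square_bdry p s) g ->
  square_int g p s = ulim (fun N => square_sum N g p s) /\
  bounded_seq (fun N => square_sum N g p s).
Proof.
move=> /bounded_square_bdry[/riemann_bounded b1 /riemann_bounded b2
  /riemann_bounded b3 /riemann_bounded b4].
pose u1 N := riemann N g p s; pose u2 N := riemann N g (p + s) (s * 'i).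
pose u3 N := riemann N g (p + s * 'i) s; pose u4 N := riemann N g p (s * 'i).
have b12 := bounded_seq_lin 1 b1 b2.
have b123 := bounded_seq_lin (-1) b3 b12; have b := bounded_seq_lin (-1) b4 b123.
have E : (fun N => square_sum N g p s) =
    (fun N => -1 * u4 N + (-1 * u3 N + (1 * u1 N + u2 N))).
  by apply/funext => N; rewrite /square_sum /u1 /u2 /u3 /u4; ring.
rewrite E; split => //; rewrite !ulimP // /square_int /Jint /u1 /u2 /u3 /u4; ring.
Qed.

Lemma square_int_lin a g h p s :
  bounded_on (square_bdry p s) g -> bounded_on (square_bdry p s) h ->
  square_int (fun z => a * g z + h z) p s = a * square_int g p s + square_int h p s.
Proof.
move=> /bounded_square_bdry[g1 g2 g3 g4] /bounded_square_bdry[h1 h2 h3 h4].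
by rewrite /square_int !Jint_lin //; ring.
Qed.

Lemma square_int_norm g p s M : 0 <= s ->
  (forall z, square_bdry p s z -> `|g z| <= M) -> `|square_int g p s| <= 4 * s * M.
Proof.
move=> s0 gM; have h q v : `|v| = s -> (seg q v `<=` square_bdry p s) ->
    `|Jint g q v| <= s * M.
  move=> vE vs; rewrite -vE; apply: (Jint_norm unit_compact) => z zs.
  exact/gM/vs.
have si : `|s * 'i| = s by rewrite normrM normCi mulr1 ger0_norm.
have ss : `|s| = s by rewrite ger0_norm.
have -> : 4 * s * M = s * M + s * M + s * M + s * M by ring.
rewrite /square_int (le_trans (ler_normB _ _)) // lerD //; last first.
  by apply: h => // z; right.
rewrite (le_trans (ler_normB _ _)) // lerD //; last first.
  by apply: h => // z; left; right.
rewrite (le_trans (ler_normD _ _)) // lerD //; apply: h => // z.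
  by left; left; left.
by left; left; right.
Qed.

Lemma riemann_affine N a b p v w :
  riemann N (fun z => a * z + b) (p + w) v =
  riemann N (fun z => a * z + b) p v + v * (a * w).
Proof.
elim: N p v => [|N IH] p v /=; first by ring.
by rewrite [p + w + v / 2]addrAC !IH; field.
Qed.

(** The cancellation is exact at every level [N]: by [riemann_affine] the horizontal pair of sides
    contributes [- s * (a * (s * 'i))] and the vertical pair [s * 'i * (a * s)]. *)
Lemma square_int_affine a b p s :
  square_int (fun z => a * z + b) p s = 0.
Proof.
have c : forall z, {for z, continuous (fun z => a * z + b)}.
  move=> z; apply: (@differentiable_continuous _ _ _ z (fun z : K => a * z + b)).
  apply: differentiable_addE; last exact: differentiable_cst.
  by apply: differentiable_mulE; first exact: differentiable_cst.
have bd q v : bounded_on (seg q v) (fun z => a * z + b).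
  by apply: continuous_bounded_seg.
have [|-> _] := @square_int_ulim (fun z => a * z + b) p s.
  have [M1 P1] := bd p s; have [M2 P2] := bd (p + s) (s * 'i).
  have [M3 P3] := bd (p + s * 'i) s; have [M4 P4] := bd p (s * 'i).
  have nn q v M : (forall z, seg q v z -> `|a * z + b| <= M) -> 0 <= M.
    by move/(_ q (seg_start _ _)); apply: le_trans.
  have := nn _ _ _ P1; have := nn _ _ _ P2; have := nn _ _ _ P3; have := nn _ _ _ P4.
  move=> n4 n3 n2 n1.
  exists (M1 + M2 + M3 + M4) => z [[[/P1|/P2]|/P3]|/P4] /le_trans; apply.
  - by rewrite -!addrA lerDl !addr_ge0.
  - by rewrite -addrA addrAC lerDr !addr_ge0.
  - by rewrite -addrA addrCA lerDl !addr_ge0.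
  - by rewrite lerDr !addr_ge0.
rewrite (_ : (fun N => _) = fun=> 0).
  by apply/eqP; rewrite -normr_le0 ulim_norm // => _; rewrite normr0.
apply/funext => N; rewrite /square_sum !riemann_affine; ring.
Qed.

Lemma square_bdry_sub p s : 0 <= s -> square_bdry p s `<=` square p s.
Proof.
move=> s0; have m t : 0 <= t <= 1 -> 0 <= t * s <= s.
  by move=> /andP[t0 t1]; rewrite mulr_ge0 //= ler_piMl.
move=> z [[[]|]|] [t /= t01 <-].
- by exists (t * s), 0; rewrite m // lexx s0; split => //; ring.
- by exists s, (t * s); rewrite m // lexx s0; split => //; ring.
- by exists (t * s), s; rewrite m // lexx s0; split => //; ring.
- by exists 0, (t * s); rewrite m // lexx s0; split => //; ring.
Qed.

Lemma square_sub p s a b : 0 <= s -> 0 <= a <= s -> 0 <= b <= s ->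
  square (p + a + b * 'i) s `<=` square p (s + s).
Proof.
move=> s0 /andP[a0 a1] /andP[b0 b1] z [a' [b' [/andP[a'0 a'1] /andP[b'0 b'1] ->]]].
exists (a + a'), (b + b'); split; last by ring.
- by rewrite addr_ge0 // lerD.
- by rewrite addr_ge0 // lerD.
Qed.

Lemma square_compact p s : 0 <= s -> compact (square p s).
Proof.
move=> s0; pose f (x : K * K) := p + x.1 * s + (x.2 * s) * 'i.
have -> : square p s = f @` ([set t : K | 0 <= t <= 1] `*` [set t : K | 0 <= t <= 1]).
  apply/seteqP; split=> z.
    move=> [a [b [/andP[a0 a1] /andP[b0 b1] ->]]].
    have [s00|sn] := eqVneq s 0.
      exists (0, 0); first by rewrite /= lexx ler01.
      have -> : a = 0 by apply/le_anti; rewrite a0 -s00 a1.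
      have -> : b = 0 by apply/le_anti; rewrite b0 -s00 b1.
      by rewrite /f /= s00; ring.
    have sp : 0 < s by rewrite lt_neqAle eq_sym sn s0.
    exists (a / s, b / s).
      by rewrite /= !divr_ge0 //= !ler_pdivrMr // !mul1r.
    by rewrite /f /= !divfK.
  move=> [[a b] /= [/andP[a0 a1] /andP[b0 b1]] <-]; exists (a * s), (b * s).
  by split; rewrite ?mulr_ge0 //= ler_piMl.
apply: continuous_compact; last exact: compact_setX.
apply: continuous_subspaceT => x.
apply: (@differentiable_continuous _ _ _ x f).
have d1 := @differentiable_fst K K K x; have d2 := @differentiable_snd K K K x.
have dc (c : K) := @differentiable_cstE K (K * K)%type c x.
exact: differentiable_addE (differentiable_addE (dc p) (differentiable_mulE d1 (dc s)))
  (differentiable_mulE (differentiable_mulE d2 (dc s)) (dc 'i)).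
Qed.

(** The inner sides occur twice with opposite signs and cancel whatever [g] is; continuity serves to
    bisect the outer ones. *)
Lemma square_int_quad g p s :
  (forall z, square_bdry p (s + s) z -> {for z, continuous g}) ->
  square_int g p (s + s) = square_int g p s + square_int g (p + s) s
    + square_int g (p + s * 'i) s + square_int g (p + s + s * 'i) s.
Proof.
move=> gc.
have hs : (s + s) / 2 = s by field.
have his : (s + s) * 'i / 2 = s * 'i by field.
rewrite /square_int.
rewrite (Jint_bisect unit_compact (p := p) (v := s + s)); last first.
  by move=> z zs; apply: gc; left; left; left.
rewrite (Jint_bisect unit_compact (p := p + (s + s))); last first.
  by move=> z zs; apply: gc; left; left; right.
rewrite (Jint_bisect unit_compact (p := p + (s + s) * 'i)); last first.
  by move=> z zs; apply: gc; left; right.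
rewrite (Jint_bisect unit_compact (p := p) (v := (s + s) * 'i)); last first.
  by move=> z zs; apply: gc; right.
rewrite !hs !his.
have -> : p + (s + s) * 'i = p + s * 'i + s * 'i by ring.
have -> : p + s + s * 'i + s = p + (s + s) + s * 'i by ring.
have -> : p + s * 'i + s * 'i + s = p + s + s * 'i + s * 'i by ring.
have -> : p + s * 'i + s = p + s + s * 'i by ring.
have -> : p + s + s = p + (s + s) by ring.
ring.
Qed.

End Squares.

(** * Goursat's theorem and Cauchy's formula *)

Section Goursat.
Variable K : numClosedFieldType.
Hypothesis unit_compact : compact [set t : K | 0 <= t <= 1].
Implicit Types (p s z w a b e x y : K) (g h : K -> K).

Lemma rect_inj x y x' y' : x \is Num.real -> y \is Num.real ->
  x' \is Num.real -> y' \is Num.real ->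
  x + y * 'i = x' + y' * 'i -> x = x' /\ y = y'.
Proof.
move=> xr yr xr' yr'; rewrite ![_ * 'i]mulrC => E; split.
  by have := congr1 (@Re K) E; rewrite !Re_rect.
by have := congr1 (@Im K) E; rewrite !Im_rect.
Qed.

Lemma squareE p s x y : x \is Num.real -> y \is Num.real ->
  square p s (p + x + y * 'i) -> 0 <= x <= s /\ 0 <= y <= s.
Proof.
move=> xr yr [a [b [ab bb]]]; rewrite -!addrA => /addrI.
have /andP[a0 _] := ab; have /andP[b0 _] := bb.
by move=> /rect_inj[]//; rewrite ?ger0_real // => -> ->.
Qed.

Lemma norm_rect_le a b : `|a + b * 'i| <= `|a| + `|b|.
Proof. by rewrite (le_trans (ler_normD _ _)) // normrM normCi mulr1. Qed.

Lemma norm_rect_ge x y : x \is Num.real -> y \is Num.real ->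
  `|x| <= `|x + y * 'i| /\ `|y| <= `|x + y * 'i|.
Proof.
move=> xr yr; have := norm_Re_le (x + 'i * y); have := norm_Im_le (x + 'i * y).
by rewrite Re_rect // Im_rect // mulrC.
Qed.

Lemma dist_le_side s x y : 0 <= x <= s -> 0 <= y <= s -> `|x - y| <= s.
Proof.
move=> /andP[x0 xs] /andP[y0 ys]; rewrite real_ler_norml ?realB ?ger0_real //.
by rewrite -[- s]add0r lerB //= -[leRHS]subr0 lerB.
Qed.

Lemma square_diam p s z w : square p s z -> square p s w -> `|z - w| <= s + s.
Proof.
move=> [a [b [aP bP ->]]] [a' [b' [a'P b'P ->]]].
have -> : p + a + b * 'i - (p + a' + b' * 'i) = (a - a') + (b - b') * 'i by ring.
by rewrite (le_trans (norm_rect_le _ _)) // lerD // dist_le_side.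
Qed.

Lemma square_corner p s : 0 <= s -> square p s p.
Proof. by move=> s0; exists 0, 0; rewrite lexx s0; split => //; ring. Qed.

Lemma square_int_near_affine g a b p s M : 0 <= s ->
  bounded_on (square_bdry p s) g ->
  (forall z, square_bdry p s z -> `|g z - (a * z + b)| <= M) ->
  `|square_int g p s| <= 4 * s * M.
Proof.
move=> s0 gb gM.
have ab : bounded_on (square_bdry p s) (fun z => a * z + b).
  have [N gN] := gb; exists (M + N) => z zs.
  have -> : a * z + b = - (g z - (a * z + b)) + g z by ring.
  by rewrite (le_trans (ler_normD _ _)) // normrN lerD ?gM ?gN.
have := square_int_lin unit_compact (-1) ab gb.
rewrite (square_int_affine unit_compact) mulr0 add0r => <-.
apply: (square_int_norm unit_compact) => // z zs.
by rewrite mulN1r [X in `|X|]addrC; apply: gM.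
Qed.

(** If all four quarters stayed below [e * s ^+ 2], their sum would stay below
    [e * (s + s) ^+ 2]. *)
Lemma square_int_quarter g p s e : 0 <= e ->
  (forall z, square_bdry p (s + s) z -> {for z, continuous g}) -> 0 < s ->
  e * (s + s) ^+ 2 <= `|square_int g p (s + s)| ->
  exists q, square q s `<=` square p (s + s) /\ e * s ^+ 2 <= `|square_int g q s|.
Proof.
move=> e0 gc s0 big; have s0' := ltW s0.
have in01 : 0 <= (0 : K) <= s /\ 0 <= s <= s by split; rewrite lexx s0'.
have sub a b : 0 <= a <= s -> 0 <= b <= s ->
  square (p + a + b * 'i) s `<=` square p (s + s) by exact: square_sub.
apply: contrapT => /forallNP H.
have {}H a b : 0 <= a <= s -> 0 <= b <= s ->
    `|square_int g (p + a + b * 'i) s| < e * s ^+ 2.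
  move=> ha hb; rewrite real_ltNge ?normr_real ?ger0_real ?mulr_ge0 ?sqr_ge0 ?exprn_ge0 //.
  by apply/negP => h; apply: (H (p + a + b * 'i)); split => //; exact: sub.
have := H 0 0 in01.1 in01.1; have := H s 0 in01.2 in01.1.
have := H 0 s in01.1 in01.2; have := H s s in01.2 in01.2.
rewrite !mul0r !addr0 => h4 h3 h2 h1.
have : `|square_int g p (s + s)| < e * s ^+ 2 + e * s ^+ 2 + e * s ^+ 2 + e * s ^+ 2.
  rewrite square_int_quad //.
  do 3!rewrite (le_lt_trans (ler_normD _ _)) // ltrD //.
have -> : e * s ^+ 2 + e * s ^+ 2 + e * s ^+ 2 + e * s ^+ 2 = e * (s + s) ^+ 2 by ring.
by move=> /(le_lt_trans big); rewrite ltxx.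
Qed.

Lemma goursat g p s : 0 < s -> (forall z, square p s z -> differentiable g z) ->
  square_int g p s = 0.
Proof.
move=> s0 dg; apply/eqP/negPn/negP => B0.
have gc z : square p s z -> {for z, continuous g}.
  by move=> /dg; exact: differentiable_continuous.
(* Ratio of the integral to the area; the choice of quarters never lets it drop below [e]. *)
pose e := `|square_int g p s| / s ^+ 2.
have e0 : 0 < e by rewrite divr_gt0 ?normr_gt0 ?exprn_gt0.
pose sn n := s / 2 ^+ n.
have sn0 n : 0 < sn n by rewrite divr_gt0 ?exprn_gt0.
have snS n : sn n = sn n.+1 + sn n.+1.
  by rewrite /sn exprS; field; rewrite expf_neq0 // pnatr_eq0.
pose next q t := xget q [set q' | square q' t `<=` square q (t + t) /\
  e * t ^+ 2 <= `|square_int g q' t|].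
pose fix qn n := if n is n'.+1 then next (qn n') (sn n) else p.
have qnP n : [/\ square (qn n) (sn n) `<=` square p s,
    e * sn n ^+ 2 <= `|square_int g (qn n) (sn n)| &
    square (qn n.+1) (sn n.+1) `<=` square (qn n) (sn n)].
  have nextP k : square (qn k) (sn k) `<=` square p s ->
      e * sn k ^+ 2 <= `|square_int g (qn k) (sn k)| ->
      square (qn k.+1) (sn k.+1) `<=` square (qn k) (sn k) /\
      e * sn k.+1 ^+ 2 <= `|square_int g (qn k.+1) (sn k.+1)|.
    move=> qs qe; rewrite [in X in _ `<=` X]snS.
    apply: (@xgetPex _ (qn k) [set q' | square q' (sn k.+1) `<=`
       square (qn k) (sn k.+1 + sn k.+1) /\ e * sn k.+1 ^+ 2 <= `|square_int g q' (sn k.+1)|]).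
    apply: square_int_quarter => //; rewrite -?snS //; first exact: ltW.
    by move=> z /(square_bdry_sub (ltW (sn0 _))) /qs; exact: gc.
  elim: n => [|n [qs qe qS]].
    have h1 : square (qn 0%N) (sn 0%N) `<=` square p s.
      by rewrite /sn expr0 divr1.
    have h2 : e * sn 0%N ^+ 2 <= `|square_int g (qn 0%N) (sn 0%N)|.
      by rewrite /sn /e expr0 divr1 divfK // expf_neq0 // gt_eqF.
    by have [h3 _] := nextP _ h1 h2.
  have [_ h2] := nextP _ qs qe; have h1 := subset_trans qS qs.
  by have [h3 _] := nextP _ h1 h2.
have qmono m n : (n <= m)%N -> square (qn m) (sn m) `<=` square (qn n) (sn n).
  move=> /subnK <-; elim: (m - n)%N => //= k IH.
  by rewrite addSn; apply: subset_trans IH; have [_ _ +] := qnP (k + n)%N.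
have qin m n : (n <= m)%N -> square (qn n) (sn n) (qn m).
  by move=> /qmono; apply; exact/square_corner/ltW.
have oo : (qn @ \oo) (square p s).
  exists 0%N => // n _ /=; have [+ _ _] := qnP n; apply.
  exact/square_corner/ltW.
(* Compactness replaces completeness: [l] is a cluster point of the corners rather than a point of
   the nested intersection. *)
have [l [ls lcl]] := @square_compact K unit_compact p s (ltW s0) _ _ oo.
(* [l] is within [sn n] of some later corner, and that corner shares with [qn n] a square of
   diameter at most [sn n + sn n]. *)
have qnl n : `|qn n - l| <= 3 * sn n.
  have [|z [[m nm <-] lm]] := lcl (qn @` [set m | (n <= m)%N]) _ _
    (nbhsx_ballx l _ (sn0 n)).
    by exists n => // m nm; exists m.
  have -> : qn n - l = (qn n - qn m) - (l - qn m) by ring.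
  have -> : 3 * sn n = (sn n + sn n) + sn n by ring.
  rewrite (le_trans (ler_normB _ _)) // lerD ?(ltW lm) //.
  by apply: square_diam; apply: qin.
(* A square of side [t] in the sequence lies within [5 * t] of [l], so its integral is at most
   [4 * t * (e / 40 * (5 * t))], half of the lower bound [e * t ^+ 2]. *)
have e40 : 0 < e / 40 by rewrite divr_gt0.
have [d d0 dP] := @differentiable_remainder K K K g l _ (dg _ ls) e40.
have [N NP] := div_expr2_null unit_compact (5 * s) d0.
have {NP} : 5 * sn N < d.
  have := NP N (leqnn _); rewrite ger0_norm -?mulrA //.
  by rewrite mulr_ge0 // ltW // sn0.
move: N => n nd.
have [qs qe _] := qnP n.
have lin w : 'd g l (w - l) = 'd g l 1 * (w - l).
  by rewrite -[X in 'd g l X]mulr1 -[(w - l) * 1]/((w - l) *: (1 : K)) linearZ mulrC.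
have : `|square_int g (qn n) (sn n)| <= 4 * sn n * (e / 40 * (5 * sn n)).
  apply: (@square_int_near_affine g ('d g l 1) (g l - 'd g l 1 * l)) => //.
  - exact: ltW.
  - have [M [_ gM]] := compact_image_bounded (@square_compact K unit_compact p s (ltW s0)) gc.
    by exists M => z /(square_bdry_sub (ltW (sn0 _)))/qs; exact: gM.
  move=> z /(square_bdry_sub (ltW (sn0 _))) zs.
  have zl : `|z - l| <= 5 * sn n.
    have -> : z - l = (z - qn n) + (qn n - l) by ring.
    have -> : 5 * sn n = (sn n + sn n) + 3 * sn n by ring.
    rewrite (le_trans (ler_normD _ _)) // lerD //.
    by apply: square_diam zs _; exact/square_corner/ltW.
  have -> : g z - ('d g l 1 * z + (g l - 'd g l 1 * l)) = g z - g l - 'd g l (z - l).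
    by rewrite lin; ring.
  by rewrite (le_trans (dP _ (le_lt_trans zl nd))) // ler_wpM2l ?(ltW e40).
move=> /(le_trans qe).
have -> : 4 * sn n * (e / 40 * (5 * sn n)) = e * sn n ^+ 2 / 2 by field.
rewrite ler_pdivlMr // ger_pMr ?lern1 //.
by rewrite mulr_gt0 // exprn_gt0.
Qed.

End Goursat.

Section Cauchy.
Variable K : numClosedFieldType.
Hypothesis unit_compact : compact [set t : K | 0 <= t <= 1].
Implicit Types (p s z w a b e x y : K) (g h f : K -> K).

(** For real [x] and [0 < s], the indicator of [[0, s)] plus that of [(0, s]]. Each is additive when
    intervals are joined, and the sum is at least 1 on the closed interval. *)
Definition cover_count x s : K :=
  (0 <= x)%R%:R - (s <= x)%R%:R + (x <= s)%R%:R - (x <= 0)%R%:R.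

Lemma cover_countD x s t :
  cover_count x (s + t) = cover_count x s + cover_count (x - s) t.
Proof.
rewrite /cover_count subr_ge0 lerBrDr lerBlDr subr_le0 [t + s]addrC; ring.
Qed.

Lemma cover_count_ge0 x s : x \is Num.real -> 0 < s -> 0 <= cover_count x s.
Proof.
move=> xr s0; rewrite /cover_count.
have [x0|x0] := real_leP (real0 K) xr; have [xs|xs] := real_leP xr (gtr0_real s0).
- have [/(lt_le_trans s0) x0'|_] := real_leP (gtr0_real s0) xr.
    by rewrite (lt_geF x0') /= subr0 subrr add0r.
  by rewrite subr0 -addrA addr_ge0 //= subr_ge0 lern1 leq_b1.
- rewrite (ltW xs) /= addr0 subrr sub0r.
  by rewrite (lt_geF (lt_trans s0 xs)) /= oppr0.
- have -> : (s <= x) = false by rewrite lt_geF // (lt_trans x0).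
  by rewrite (ltW x0) /= subr0 add0r subrr.
- by have := lt_trans (lt_trans xs x0) s0; rewrite ltxx.
Qed.

Lemma cover_count_ge1 x s : x \is Num.real -> 0 < s -> 0 <= x <= s ->
  1 <= cover_count x s.
Proof.
move=> xr s0 /andP[x0 xs]; rewrite /cover_count x0 xs /=.
have [sx|_] := real_leP (gtr0_real s0) xr.
  by rewrite (lt_geF (lt_le_trans s0 sx)) /= subrr add0r subr0.
by rewrite subr0 -addrA lerDl subr_ge0 lern1 leq_b1.
Qed.

(* At each level of the dyadic subdivision, [a] lies in at most four squares;
   [cover_count] is an additive majorant of the number of these squares. *)
Lemma square_int_exceptional_bound g x y p s M n : x \is Num.real -> y \is Num.real ->
  0 <= M -> 0 < s ->
  (forall z, square p s z -> {for z, continuous g} /\ `|g z| <= M) ->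
  (forall z, square p s z -> z != p + x + y * 'i -> differentiable g z) ->
  `|square_int g p s| <= 4 * M * (s / 2 ^+ n) * (cover_count x s * cover_count y s).
Proof.
move=> + + M0; elim: n p s x y => [|n IH] p s x y xr yr s0 gc dg.
  have [/squareE[]// xs ys|na] := pselect (square p s (p + x + y * 'i)).
    rewrite expr0 divr1; apply: (@le_trans _ _ (4 * s * M)).
      apply: (square_int_norm unit_compact) (ltW s0) _ => z.
      by move=> /(square_bdry_sub (ltW s0))/gc[].
    rewrite mulrAC ler_peMr ?mulr_ge0 ?(ltW s0) //.
    by rewrite -[1]mulr1 ler_pM ?ler01 ?cover_count_ge1.
  rewrite (goursat unit_compact) ?normr0 //.
    by rewrite !mulr_ge0 ?cover_count_ge0 ?invr_ge0 ?exprn_ge0 ?(ltW s0).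
  by move=> z zs; apply: dg => //; apply/eqP => za; apply: na; rewrite -za.
have [h [h0 sh]] : exists h : K, 0 < h /\ s = h + h.
  by exists (s / 2); rewrite -splitr divr_gt0.
rewrite {s}sh in s0 gc dg *.
have in0 : 0 <= (0 : K) <= h by rewrite lexx ltW.
have inh : 0 <= h <= h by rewrite lexx ltW.
have hr := gtr0_real h0.
have IHs u v : u \is Num.real -> v \is Num.real -> 0 <= u <= h -> 0 <= v <= h ->
    `|square_int g (p + u + v * 'i) h| <=
    4 * M * (h / 2 ^+ n) * (cover_count (x - u) h * cover_count (y - v) h).
  move=> ur vr uh vh; have sub := @square_sub K p h u v (ltW h0) uh vh.
  apply: IH; rewrite ?realB //; first by move=> z /sub /gc.
  move=> z /sub zs; have -> : p + u + v * 'i + (x - u) + (y - v) * 'i = p + x + y * 'i.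
    by ring.
  exact: dg.
have := IHs 0 0 (real0 K) (real0 K) in0 in0; have := IHs h 0 hr (real0 K) inh in0.
have := IHs 0 h (real0 K) hr in0 inh; have := IHs h h hr hr inh inh.
rewrite !mul0r !subr0 !addr0 => h4 h3 h2 h1.
rewrite square_int_quad //; last first.
  by move=> z /(square_bdry_sub (ltW s0))/gc[].
rewrite !cover_countD.
set A := cover_count x h in h1 h3 *; set A' := cover_count (x - h) h in h2 h4 *.
set B := cover_count y h in h1 h2 *; set B' := cover_count (y - h) h in h3 h4 *.
set C := 4 * M * (h / 2 ^+ n) in h1 h2 h3 h4.
have -> : 4 * M * ((h + h) / 2 ^+ n.+1) * ((A + A') * (B + B')) =
    C * (A * B) + C * (A' * B) + C * (A * B') + C * (A' * B').
  by rewrite /C exprS; field; rewrite expf_neq0 // pnatr_eq0.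
by do 3!rewrite (le_trans (ler_normD _ _)) // lerD //.
Qed.

(** Meant for difference quotients, of which only continuity is known at [a]: [g] is bounded, and
    the small squares containing [a] have a total perimeter that tends to 0. *)
Lemma goursat_exceptional g a p s : 0 < s ->
  (forall z, square p s z -> {for z, continuous g}) ->
  (forall z, square p s z -> z != a -> differentiable g z) ->
  square_int g p s = 0.
Proof.
move=> s0 gc dg; apply/eqP; rewrite -normr_le0; apply/ler_addgt0Pl => e e0; rewrite addr0.
have [M [M0 gM]] := compact_image_bounded (@square_compact K unit_compact p s (ltW s0)) gc.
pose x := 'Re (a - p); pose y := 'Im (a - p).
have aE : a = p + x + y * 'i.
  by rewrite -addrA [y * _]mulrC -Crect addrC subrK.
set C := 4 * M * s * (cover_count x s * cover_count y s).
have [n nP] := div_expr2_null unit_compact C e0.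
have := nP n (leqnn _) => /ltW; apply: le_trans.
apply: le_trans (real_ler_norm _); last first.
  by rewrite ger0_real // !mulr_ge0 ?cover_count_ge0 ?Creal_Re ?Creal_Im ?invr_ge0 ?exprn_ge0 ?(ltW s0).
have -> : C / 2 ^+ n = 4 * M * (s / 2 ^+ n) * (cover_count x s * cover_count y s).
  by rewrite /C; ring.
apply: square_int_exceptional_bound; rewrite ?Creal_Re ?Creal_Im //.
  by move=> z zs; split; [exact: gc|exact: gM].
by rewrite -aE.
Qed.

Definition inside p s a := exists x y, [/\ 0 < x < s, 0 < y < s & a = p + x + y * 'i].

Lemma square_bdryE p s z : 0 < s -> square_bdry p s z ->
  exists x y, [/\ 0 <= x <= s, 0 <= y <= s, z = p + x + y * 'i &
    [\/ x = 0, x = s, y = 0 | y = s]].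
Proof.
move=> s0; have m t : 0 <= t <= 1 -> 0 <= t * s <= s.
  by move=> /andP[t0 t1]; rewrite mulr_ge0 ?(ltW s0) //= ler_piMl ?(ltW s0).
have s00 : 0 <= (0 : K) <= s by rewrite lexx ltW.
have ss : 0 <= s <= s by rewrite lexx ltW.
move=> [[[]|]|] [t /= t01 <-].
- by exists (t * s), 0; rewrite m //; split=> //; [ring|constructor 3].
- by exists s, (t * s); rewrite m //; split=> //; [ring|constructor 2].
- by exists (t * s), s; rewrite m //; split=> //; [ring|constructor 4].
- by exists 0, (t * s); rewrite m //; split=> //; [ring|constructor 1].
Qed.

Lemma inside_real p s a : inside p s a ->
  exists x y, [/\ 0 < x < s, 0 < y < s, a = p + x + y * 'i, x \is Num.real & y \is Num.real].
Proof.
move=> [x [y [/andP[x0 xs] /andP[y0 ys] ->]]]; exists x, y.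
by rewrite x0 y0 xs ys !gtr0_real.
Qed.

Lemma inside_gt0 p s a : inside p s a -> 0 < s.
Proof. by move=> [x [_ [/andP[x0 xs] _ _]]]; exact: lt_trans xs. Qed.

Lemma inside_grow p s a u v : inside p s a -> 0 <= u <= s -> 0 <= v <= s ->
  inside (p - u - v * 'i) (s + s) a.
Proof.
move=> [x [y [/andP[x0 xs] /andP[y0 ys] ->]]] /andP[u0 us] /andP[v0 vs].
exists (x + u), (y + v); split; last by ring.
  by rewrite ltr_wpDr //= ltr_leD.
by rewrite ltr_wpDr //= ltr_leD.
Qed.

(* The quarters of the doubled square other than the original one avoid [a]. *)
Lemma inside_not_square p s a u v : inside p s a -> u \is Num.real -> v \is Num.real ->
  (u <= - s \/ s <= u) \/ (v <= - s \/ s <= v) -> ~ square (p + u + v * 'i) s a.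
Proof.
move=> /inside_real[x [y [/andP[x0 xs] /andP[y0 ys] -> xr yr]]] ur vr uv.
have -> : p + x + y * 'i = p + u + v * 'i + (x - u) + (y - v) * 'i by ring.
move=> /squareE[]; rewrite ?realB // => /andP[]; rewrite subr_ge0 lerBlDr => ux xu.
rewrite subr_ge0 lerBlDr => /andP[vy yv].
case: uv => -[h|h].
- by have := lt_le_trans x0 xu; rewrite -ltrBlDl sub0r => /(le_lt_trans h); rewrite ltxx.
- by have := lt_le_trans xs (le_trans h ux); rewrite ltxx.
- by have := lt_le_trans y0 yv; rewrite -ltrBlDl sub0r => /(le_lt_trans h); rewrite ltxx.
- by have := lt_le_trans ys (le_trans h vy); rewrite ltxx.
Qed.

Lemma bdry_dist p s a z m :
  inside (p + m + m * 'i) (s - m - m) a -> 0 <= m -> square_bdry p s z -> m <= `|z - a|.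
Proof.
move=> /inside_real[x [y [/andP[x0 xs] /andP[y0 ys] -> xr yr]]] m0 zb.
have s0 : 0 < s.
  apply: lt_le_trans (lt_trans x0 xs) _.
  by rewrite -addrA gerDl -opprD oppr_le0 addr_ge0.
have [X [Y [/andP[X0 Xs] /andP[Y0 Ys] -> c]]] := square_bdryE s0 zb.
have mr := ger0_real m0.
have -> : p + X + Y * 'i - (p + m + m * 'i + x + y * 'i) =
    (X - m - x) + (Y - m - y) * 'i by ring.
have [] := @norm_rect_ge K (X - m - x) (Y - m - y).
- by rewrite !realB // ger0_real.
- by rewrite !realB // ger0_real.
move=> h1 h2.
have key u t : 0 < u < s - m - m -> t = 0 \/ t = s -> m <= `|t - m - u|.
  move=> /andP[u0 us] [->|->].
    rewrite sub0r -opprD normrN ger0_norm ?lerDl ?addr_ge0 ?(ltW u0) //.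
  rewrite gtr0_norm; last by rewrite subr_gt0 (lt_le_trans us) // lerBlDr lerDl.
  by rewrite lerBrDr addrC -lerBrDr ltW.
case: c => c; first by apply: le_trans h1; apply: key; rewrite ?x0 ?xs; auto.
- by apply: le_trans h1; apply: key; rewrite ?x0 ?xs; auto.
- by apply: le_trans h2; apply: key; rewrite ?y0 ?ys; auto.
- by apply: le_trans h2; apply: key; rewrite ?y0 ?ys; auto.
Qed.

Lemma inside_not_bdry p s a : inside p s a -> ~ square_bdry p s a.
Proof.
move=> ia ab; have s0 := inside_gt0 ia; move: ia.
move=> /inside_real[x [y [/andP[x0 xs] /andP[y0 ys] aE xr yr]]].
have [X [Y [/andP[X0 Xs] /andP[Y0 Ys] aE' c]]] := square_bdryE s0 ab.
move: aE'; rewrite aE -!addrA => /addrI /rect_inj[]//; rewrite ?(ger0_real X0) ?(ger0_real Y0) //.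
move=> xX yY; move: c; rewrite -xX -yY => -[] c.
- by rewrite c ltxx in x0.
- by rewrite c ltxx in xs.
- by rewrite c ltxx in y0.
- by rewrite c ltxx in ys.
Qed.

Section TwoPoles.
Variables (g : K -> K) (a a' : K).
Hypothesis dg : forall z, z != a -> z != a' -> differentiable g z.

Lemma square_int_off p s u v : inside p s a -> inside p s a' ->
  u \is Num.real -> v \is Num.real ->
  (u <= - s \/ s <= u) \/ (v <= - s \/ s <= v) ->
  square_int g (p + u + v * 'i) s = 0.
Proof.
move=> ia ia' ur vr uv; apply: (goursat unit_compact); first exact: inside_gt0 ia.
move=> z zs; apply: dg; apply/eqP => za; move: zs; rewrite za.
  exact: inside_not_square ia ur vr uv.
exact: inside_not_square ia' ur vr uv.
Qed.

Lemma continuous_bdry p s : inside p s a -> inside p s a' ->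
  forall z, square_bdry p s z -> {for z, continuous g}.
Proof.
move=> ia ia' z zb; apply: (@differentiable_continuous _ K K); apply: dg.
  by apply/eqP => za; apply: (inside_not_bdry ia); rewrite -za.
by apply/eqP => za; apply: (inside_not_bdry ia'); rewrite -za.
Qed.

(** The square is doubled up and to the right, then down and to the left. All added squares miss
    both poles, and afterwards the poles are at distance at least [s] from the boundary. *)
Lemma square_int_expand p s : inside p s a -> inside p s a' ->
  square_int g (p - (s + s) - (s + s) * 'i) (s + s + (s + s)) = square_int g p s.
Proof.
move=> ia ia'; have s0 := inside_gt0 ia.
have r0 := real0 K; have rs := gtr0_real s0.
have in0 : 0 <= (0 : K) <= s by rewrite lexx ltW.
have [ja ja'] : inside p (s + s) a /\ inside p (s + s) a'.
  by have := inside_grow ia in0 in0; have := inside_grow ia' in0 in0; rewrite mul0r !subr0.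
have t0 := inside_gt0 ja; have rt := gtr0_real t0.
have -> : square_int g p s = square_int g p (s + s).
  rewrite square_int_quad //; last exact: continuous_bdry.
  have -> : p + s = p + s + 0 * 'i by ring.
  have -> : p + s * 'i = p + 0 + s * 'i by ring.
  have -> : p + s + 0 * 'i + s * 'i = p + s + s * 'i by ring.
  by rewrite !square_int_off ?addr0 //; auto.
move: (s + s) ja ja' t0 rt => t ja ja' t0 rt.
have int_ : 0 <= t <= t by rewrite lexx ltW.
rewrite square_int_quad //; last first.
  by apply: continuous_bdry; [exact: inside_grow ja _ _|exact: inside_grow ja' _ _].
have -> : p - t - t * 'i + t + t * 'i = p by ring.
have -> : p - t - t * 'i + t = p + 0 + (- t) * 'i by ring.
have -> : p - t - t * 'i + t * 'i = p + (- t) + 0 * 'i by ring.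
have -> : p - t - t * 'i = p + (- t) + (- t) * 'i by ring.
by rewrite !square_int_off ?add0r ?realN //; auto.
Qed.

Hypothesis g_decay : forall z e, 0 < e -> e <= `|z - a| -> e <= `|z - a'| ->
  `|g z| <= (e ^+ 2)^-1.

(** Expansion leaves the integral unchanged. After one expansion the side is [4 * s] and [g] is at
    most [(s ^+ 2)^-1] on the boundary, which gives [16 / s]; each further expansion divides this by
    4. *)
Lemma square_int_two_poles p s : inside p s a -> inside p s a' ->
  square_int g p s = 0.
Proof.
move=> ia ia'; have s0 := inside_gt0 ia.
apply/eqP; rewrite -normr_le0; apply/ler_addgt0Pl => e e0; rewrite addr0.
suff bound n : `|square_int g p s| <= 16 / s / 2 ^+ n.
  have [n nP] := div_expr2_null unit_compact (16 / s) e0.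
  have := nP n (leqnn _) => /ltW; apply: le_trans; apply: le_trans (bound n) _.
  by rewrite real_ler_norm // gtr0_real // !divr_gt0 ?exprn_gt0.
elim: n p s ia ia' s0 => [|n IH] p s ia ia' s0; have s0' := ltW s0;
  rewrite -square_int_expand //; have ins : 0 <= s <= s by rewrite lexx s0'.
  rewrite expr0 divr1; have S0 : 0 < s + s + (s + s) by rewrite !addr_gt0.
  have -> : 16 / s = 4 * (s + s + (s + s)) * (s ^+ 2)^-1 by field; rewrite gt_eqF.
  apply: (square_int_norm unit_compact) (ltW S0) _ => z zb.
  apply: g_decay => //; apply: bdry_dist zb => //.
    have := inside_grow ia ins ins.
    have -> : s + s + (s + s) - s - s = s + s by ring.
    by congr (inside _ _ _); ring.
  have := inside_grow ia' ins ins.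
  have -> : s + s + (s + s) - s - s = s + s by ring.
  by congr (inside _ _ _); ring.
have in0 : 0 <= (0 : K) <= s by rewrite lexx s0'.
have grow b : inside p s b ->
    inside (p - (s + s) - (s + s) * 'i) (s + s + (s + s)) b.
  move=> ib; have ib2 := inside_grow ib in0 in0.
  rewrite mul0r !subr0 in ib2.
  have h : 0 <= s + s <= s + s by rewrite lexx addr_ge0.
  exact: (inside_grow ib2 h h).
have S0 : 0 < s + s + (s + s) by rewrite !addr_gt0.
apply: le_trans (IH _ _ (grow _ ia) (grow _ ia') S0) _.
have -> : 16 / (s + s + (s + s)) / 2 ^+ n = 16 / s / 2 ^+ n.+1 / 2.
  by rewrite exprS; field; rewrite expf_neq0 ?pnatr_eq0 // gt_eqF // gt_eqF.
rewrite ler_pdivrMr // ler_peMr ?ler1n //.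
by rewrite !mulr_ge0 ?invr_ge0 ?exprn_ge0.
Qed.

End TwoPoles.

End Cauchy.

(** * Cauchy's formula as a linear functional *)

Section CauchyFunctional.
Variable K : numClosedFieldType.
Hypothesis unit_compact : compact [set t : K | 0 <= t <= 1].
Implicit Types (p s z w a b c e x y m t v : K) (g h f : K -> K).

Lemma riemann_Im N c g p v m :
  (forall z, seg p v z -> m <= 'Im (c * (v * g z))) -> m <= 'Im (c * riemann N g p v).
Proof.
elim: N p v m => [|N IH] p v m gm /=; first by apply: gm; exact: seg_start.
have half q : (seg q (v / 2) `<=` seg p v) -> forall z, seg q (v / 2) z ->
    m / 2 <= 'Im (c * (v / 2 * g z)).
  move=> sub z /sub /gm mh; have -> : c * (v / 2 * g z) = 2^-1 * (c * (v * g z)) by ring.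
  have r2 : (2^-1 : K) \is Num.real by rewrite realV realn.
  by rewrite (ImMl r2) [leRHS]mulrC ler_pM2r ?invr_gt0.
rewrite mulrDr raddfD /= [m]splitr lerD // IH //.
  exact/half/seg_left.
exact/half/seg_right.
Qed.

(** For real [x] in [[-1, 1]] the imaginary part of [2 / (x - 'i)] is [2 / (x ^+ 2 + 1)], at least
    1. Up to rotation and scaling, this is the contribution of a side of a square to the integral of
    the inverse distance to its centre. *)
Lemma Im_pole_ge1 t : 0 <= t <= 1 -> 1 <= 'Im (2 / (t *+ 2 - 1 - 'i)) /\
  1 <= 'Im (2 / (1 - t *+ 2 - 'i)).
Proof.
move=> /andP[t0 t1].
have key x : x \is Num.real -> `|x| <= 1 -> 1 <= 'Im (2 / (x - 'i)).
  move=> xr x1; have D0 : 0 < x ^+ 2 + 1.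
    by rewrite ltr_wpDl // real_exprn_even_ge0.
  have DE : (x - 'i) * (x + 'i) = x ^+ 2 + 1.
    have -> : (x - 'i) * (x + 'i) = x ^+ 2 - 'i ^+ 2 by ring.
    by rewrite sqrCi opprK.
  have w0 : x - 'i != 0.
    by apply: contraTneq D0 => w0; rewrite -DE w0 mul0r ltxx.
  have w0' : x + 'i != 0.
    by apply: contraTneq D0 => w0'; rewrite -DE w0' mulr0 ltxx.
  have -> : 2 / (x - 'i) = (2 * x / (x ^+ 2 + 1)) + 'i * (2 / (x ^+ 2 + 1)).
    by rewrite -DE; field; rewrite w0 w0'.
  have Dr : (x ^+ 2 + 1)^-1 \is Num.real by rewrite realV gtr0_real.
  rewrite Im_rect; [|by rewrite !realM ?realn|by rewrite realM ?realn].
  rewrite ler_pdivlMr // mul1r mulr2n lerD2r.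
  by rewrite -real_normK // exprn_ile1.
have tr : t \is Num.real by rewrite ger0_real.
have tb : `|t *+ 2 - 1| <= 1.
  have tr2 : t *+ 2 - 1 \is Num.real by rewrite realB ?realrMn ?real1.
  rewrite real_ler_norml // lerBrDr addNr mulrn_wge0 //=.
  by rewrite lerBlDr mulr2n lerD.
split; apply: key; rewrite ?realB ?realrMn ?real1 //.
by rewrite distrC.
Qed.

(** The interface through which all later sections use contour integrals: [S] is a contour around
    [b] and [L] the integral over it, normalised so that Cauchy's formula has no constant. *)
Definition cauchy_functional b s (S : set K) (L : (K -> K) -> K) : Prop :=
  [/\ compact S, forall z, S z -> s <= `|z - b| <= s + s,
      forall a g h, bounded_on S g -> bounded_on S h ->
        L (fun z => a * g z + h z) = a * L g + L h,
      forall g M, (forall z, S z -> `|g z| <= M) -> `|L g| <= 2 * s * M &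
      forall f, (forall z, `|z - b| <= s + s -> differentiable f z) ->
        forall a, `|a - b| < s -> L (fun z => f z / (z - a)) = f a].

Lemma riemann_ext N g h p v : (forall z, seg p v z -> g z = h z) ->
  riemann N g p v = riemann N h p v.
Proof.
elim: N p v => [|N IH] p v gh /=; first by rewrite gh //; exact: seg_start.
by rewrite (IH p) ?(IH (p + v / 2)) // => z zs; apply: gh;
  [exact: seg_right|exact: seg_left].
Qed.

Lemma square_int_ext g h p s : (forall z, square_bdry p s z -> g z = h z) ->
  square_int g p s = square_int h p s.
Proof.
move=> gh; rewrite /square_int /Jint.
congr (_ + _ - _ - _); congr ulim; apply/funext => N; apply: riemann_ext => z zs;
  apply: gh; [left;left;left|left;left;right|left;right|right]; exact: zs.
Qed.

Lemma square_bdry_compact p s : compact (square_bdry p s).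
Proof. by do 3?apply: compactU; exact: seg_compact. Qed.

Lemma cauchy_functional_exists b s : 0 < s ->
  exists S L, cauchy_functional b s S L.
Proof.
move=> s0; have s0' := ltW s0; have sr := gtr0_real s0.
(* The square centred at [b] with half-side [s]: it contains the disc of radius [s] and lies in the
   disc of radius [s + s]. *)
pose p := b - s - s * 'i; have ss0 : 0 < s + s by rewrite addr_gt0.
have bdry z : square_bdry p (s + s) z -> s <= `|z - b| <= s + s.
  move=> zb; apply/andP; split.
    have [X [Y [/andP[X0 Xs] /andP[Y0 Ys] -> c]]] := square_bdryE ss0 zb.
    have -> : p + X + Y * 'i - b = (X - s) + (Y - s) * 'i by rewrite /p; ring.
    have [] := @norm_rect_ge K (X - s) (Y - s); try by rewrite realB // ger0_real.
    move=> h1 h2; have e : s + s - s = s by ring.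
    by case: c => c; rewrite c ?sub0r ?e in h1 h2 *;
      [apply: le_trans h1|apply: le_trans h1|apply: le_trans h2|apply: le_trans h2];
      rewrite ?normrN ger0_norm.
  have [x [y [/andP[x0 x1] /andP[y0 y1] ->]]] := square_bdry_sub (ltW ss0) zb.
  have -> : p + x + y * 'i - b = (x - s) + (y - s) * 'i by rewrite /p; ring.
  apply: (le_trans (norm_rect_le _ _)); rewrite lerD //.
    by rewrite real_ler_norml ?realB ?ger0_real // lerBrDr addrC subrr x0 lerBlDr.
  by rewrite real_ler_norml ?realB ?ger0_real // lerBrDr addrC subrr y0 lerBlDr.
have ins a : `|a - b| < s -> inside p (s + s) a.
  move=> ab; exists ('Re (a - b) + s), ('Im (a - b) + s); split.
  - have := le_lt_trans (norm_Re_le _) ab.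
    by rewrite real_ltr_norml ?Creal_Re // -ltrBlDr sub0r ltrD2r.
  - have := le_lt_trans (norm_Im_le _) ab.
    by rewrite real_ltr_norml ?Creal_Im // -ltrBlDr sub0r ltrD2r.
  rewrite -[LHS](subrK b) {1}[a - b]Crect /p; ring.
have bb : inside p (s + s) b by apply: ins; rewrite subrr normr0.
(* The normalising constant, in place of [2 * pi * 'i]. *)
pose c := square_int (fun z => 1 / (z - b)) p (s + s).
have zb0 z : square_bdry p (s + s) z -> z - b != 0.
  by move=> /bdry/andP[h _]; rewrite -normr_gt0 (lt_le_trans s0).
have cb : bounded_on (square_bdry p (s + s)) (fun z => 1 / (z - b)).
  exists s^-1 => z /[dup] /bdry/andP[h _] /zb0 h0.
  by rewrite mul1r normfV lef_pV2 // posrE // normr_gt0.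
(* Each of the four sides adds at least 1 to the imaginary part of every Riemann sum. The value 4
   turns the length [8 * s] of the contour into the factor [2 * s] of the norm bound. *)
have c4 : 4 <= `|c|.
  have [cE cbd] := square_int_ulim unit_compact cb.
  apply/ler_addgt0Pl => e e0; have [N Nc] := ulim_approx unit_compact cbd e0.
  have h : 4 <= `|square_sum N (fun z => 1 / (z - b)) p (s + s)|.
    apply: le_trans (norm_Im_le _); apply: le_trans (real_ler_norm (Creal_Im _)).
    have -> : square_sum N (fun z => 1 / (z - b)) p (s + s) =
       1 * riemann N (fun z => 1 / (z - b)) p (s + s) +
       1 * riemann N (fun z => 1 / (z - b)) (p + (s + s)) ((s + s) * 'i) +
       -1 * riemann N (fun z => 1 / (z - b)) (p + (s + s) * 'i) (s + s) +
       -1 * riemann N (fun z => 1 / (z - b)) p ((s + s) * 'i).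
      by rewrite /square_sum; ring.
    have -> : 4 = 1 + 1 + 1 + 1 :> K by ring.
    have sn : s != 0 by rewrite gt_eqF.
    have i0 : ('i : K) != 0 by exact: neq0Ci.
    (* Here [k] is [s] times a fourth root of unity; it brings the four sides to the two forms of
       [Im_pole_ge1]. *)
    have step k w c' v z : k != 0 -> c' * v = k * 2 -> z - b = k * w ->
        c' * (v * (1 / (z - b))) = 2 / w.
      move=> k0 cv ->; rewrite mul1r mulrA cv invfM mulrACA divff // mul1r //.
    have ii : 'i * 'i = -1 :> K by rewrite -expr2 sqrCi.
    rewrite 3!raddfD; do 3?apply: lerD; apply: riemann_Im => z [t /= t01 <-];
      have [h1 h2] := Im_pole_ge1 t01.
    - rewrite (step s (t *+ 2 - 1 - 'i)) //; first by ring.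
      by rewrite /p; ring.
    - rewrite (step (s * 'i) (t *+ 2 - 1 - 'i)) ?mulf_neq0 //; first by ring.
      rewrite /p [RHS](_ : _ = s * 'i * (t *+ 2 - 1) - s * ('i * 'i)); last by ring.
      by rewrite ii; ring.
    - rewrite (step (- s) (1 - t *+ 2 - 'i)) ?oppr_eq0 //; first by ring.
      by rewrite /p; ring.
    - rewrite (step (- s * 'i) (1 - t *+ 2 - 'i)) ?mulf_neq0 ?oppr_eq0 //; first by ring.
      rewrite /p [RHS](_ : _ = - s * 'i * (1 - t *+ 2) + s * ('i * 'i)); last by ring.
      by rewrite ii; ring.
  apply: (le_trans h); rewrite /c cE.
  set u := square_sum _ _ _ _ in Nc *; set l := ulim _ in Nc *.
  have -> : u = (u - l) + l by ring.
  by rewrite (le_trans (ler_normD _ _)) // lerD2r ltW.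
have c0 : c != 0 by rewrite -normr_gt0 (lt_le_trans _ c4).
exists (square_bdry p (s + s)), (fun g => square_int g p (s + s) / c); split.
- exact: square_bdry_compact.
- exact: bdry.
- by move=> a g h gb hb; rewrite square_int_lin // mulrDl mulrA.
- move=> g M gM; rewrite normrM normfV ler_pdivrMr ?normr_gt0 //.
  have M0 : 0 <= M.
    by apply: le_trans (gM p _) => //; left; left; left; exact: seg_start.
  apply: le_trans (square_int_norm unit_compact (ltW ss0) gM) _.
  have -> : 4 * (s + s) * M = 2 * s * M * 4 by ring.
  by rewrite ler_wpM2l // !mulr_ge0.
move=> f df a ab; apply: (mulIf c0); rewrite divfK //.
have za0 z : square_bdry p (s + s) z -> z - a != 0.
  move=> zb; apply/eqP => /eqP; rewrite subr_eq0 => /eqP za.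
  by apply: (inside_not_bdry (ins _ ab)); rewrite -za.
have sqb z : square p (s + s) z -> `|z - b| <= s + s.
  move=> [x [y [/andP[x0 x1] /andP[y0 y1] ->]]].
  have -> : p + x + y * 'i - b = (x - s) + (y - s) * 'i by rewrite /p; ring.
  apply: (le_trans (norm_rect_le _ _)); rewrite lerD //.
    by rewrite real_ler_norml ?realB ?ger0_real // lerBrDr addrC subrr x0 lerBlDr.
  by rewrite real_ler_norml ?realB ?ger0_real // lerBrDr addrC subrr y0 lerBlDr.
have bcont q : (forall z, square_bdry p (s + s) z -> differentiable q z) ->
    bounded_on (square_bdry p (s + s)) q.
  move=> dq; have [|M [_ qM]] := @compact_image_bounded K _ q (@square_bdry_compact p (s + s)).
    by move=> z /dq; exact: (@differentiable_continuous K K K).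
  by exists M.
have dsub (a' : K) z : differentiable (fun z : K => z - a') z.
  by apply: differentiable_subE; last exact: differentiable_cst.
have dbdry z : square_bdry p (s + s) z -> differentiable f z.
  by move=> /bdry/andP[_ h]; exact: df.
have dpole (a' : K) z : z - a' != 0 -> differentiable (fun z : K => 1 / (z - a')) z.
  by move=> za; apply: differentiable_divE => //; exact: differentiable_cst.
(* The difference quotient of [f] at [a], completed by the derivative so as to be continuous
   there. *)
pose h z := if z == a then 'd f a 1 else (f z - f a) / (z - a).
have dh z : z != a -> `|z - b| <= s + s -> differentiable h z.
  move=> za zb; apply: (@near_eq_differentiable K K K (fun z => (f z - f a) / (z - a))).
    apply/near_normKP; exists `|z - a|; first by rewrite normr_gt0 subr_eq0.
    move=> y yz; rewrite /h; case: eqP => // ya; move: yz.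
    by rewrite ya distrC ltxx.
  apply: differentiable_divE => //; last by rewrite subr_eq0.
  by apply: differentiable_subE; [exact: df|exact: differentiable_cst].
have hc : {for a, continuous h}.
  apply/continuous_normKP => e e0; have e20 : 0 < e / 2 by rewrite divr_gt0.
  have [|d d0 dP] := @differentiable_remainder K K K f a _ _ e20.
    by apply: df; rewrite (le_trans (ltW ab)) // lerDl.
  exists d => // y yd; rewrite /h eqxx; case: eqP => [_|/eqP ya].
    by rewrite subrr normr0.
  have ya0 : y - a != 0 by rewrite subr_eq0.
  have lin : 'd f a (y - a) = 'd f a 1 * (y - a).
    by rewrite -[X in 'd f a X]mulr1 -[(y - a) * 1]/((y - a) *: (1 : K)) linearZ mulrC.
  have -> : (f y - f a) / (y - a) - 'd f a 1 = (f y - f a - 'd f a (y - a)) / (y - a).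
    by rewrite lin; field.
  rewrite normrM normfV ltr_pdivrMr ?normr_gt0 //.
  by rewrite (le_lt_trans (dP _ yd)) // ltr_pM2r ?normr_gt0 // ltr_pdivrMr // ltr_pMr // ltr1n.
have h0 : square_int h p (s + s) = 0.
  apply: (goursat_exceptional unit_compact (a := a)) => // z /sqb zb.
    have [->//|za] := eqVneq z a.
    by apply: (@differentiable_continuous K K K); exact: dh.
  by move=> za; exact: dh.
(* Moving the pole from [b] to [a] changes the integrand by [(a - b) / ((z - a) * (z - b))], which
   decays quadratically and integrates to 0. *)
have ca : square_int (fun z => 1 / (z - a)) p (s + s) = c.
  apply/eqP; rewrite -subr_eq0 /c; apply/eqP.
  have E := square_int_lin unit_compact (-1) cb (bcont _ (fun z zb => dpole a z (za0 z zb))).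
  have -> : square_int (fun z => 1 / (z - a)) p (s + s) -
      square_int (fun z => 1 / (z - b)) p (s + s) =
      square_int (fun z => -1 * (1 / (z - b)) + 1 / (z - a)) p (s + s).
    by rewrite E; ring.
  transitivity ((a - b) * square_int (fun z => 1 / ((z - a) * (z - b))) p (s + s)).
    have dd z : square_bdry p (s + s) z -> differentiable (fun z : K => 1 / ((z - a) * (z - b))) z.
      move=> zb; apply: differentiable_divE; [exact: differentiable_cst|exact: differentiable_mulE|].
      by rewrite mulf_neq0 // ?za0 ?zb0.
    have z0 : bounded_on (square_bdry p (s + s)) (fun=> 0 : K).
      by exists 0 => z _; rewrite normr0.
    have Z : square_int (fun=> 0 : K) p (s + s) = 0.
      have := square_int_affine unit_compact 0 0 p (s + s).
      by congr (square_int _ _ _ = _); apply/funext => z; rewrite mul0r addr0.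
    rewrite -[RHS]addr0 -[X in _ = _ + X]Z -(square_int_lin unit_compact) //.
      by apply: square_int_ext => z zb; field; rewrite za0 ?zb0.
    exact: bcont.
  rewrite (square_int_two_poles unit_compact (a := a) (a' := b)) ?mulr0 //.
  - move=> z za zb; apply: differentiable_divE; [exact: differentiable_cst|exact: differentiable_mulE|].
    by rewrite mulf_neq0 // subr_eq0.
  - move=> z e e0 za zb; rewrite mul1r normfV normrM lef_pV2 ?posrE.
    + by rewrite expr2 ler_pM // ltW.
    + by rewrite mulr_gt0 // (lt_le_trans e0).
    + by rewrite exprn_gt0.
  - exact: ins.
have := square_int_lin unit_compact (- f a) (bcont _ (fun z zb => dpole a z (za0 z zb)))
   (bcont (fun z => f z / (z - a)) (fun z zb => differentiable_divE (dbdry z zb) (dsub a z) (za0 z zb))).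
rewrite ca => E; apply/eqP; rewrite -subr_eq0 addrC -mulNr -E -{}h0; apply/eqP.
apply: square_int_ext => z zb; rewrite /h.
have /negPf -> : z != a by rewrite -subr_eq0 za0.
by field; rewrite za0.
Qed.
End CauchyFunctional.

(** * Cauchy estimates and integrals depending on a parameter *)

Section ParametricIntegral.
Variable K : numClosedFieldType.
Hypothesis unit_compact : compact [set t : K | 0 <= t <= 1].

(** Integrate [f] against [1 / (z - a) - 1 / z - a / z ^+ 2 = a ^+ 2 / (z ^+ 2 * (z - a))], whose
    denominator has norm at least [s ^+ 2 * (s / 2)] on [S]. *)
Lemma taylor1 (f : K -> K) (s M : K) (S : set K) (L : (K -> K) -> K) : 0 < s ->
  cauchy_functional 0 s S L ->
  (forall z, `|z| <= s + s -> differentiable f z /\ `|f z| <= M) ->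
  `|L (fun z => f z / z ^+ 2)| <= 2 * M / s /\
  forall a, `|a| <= s / 2 ->
    `|f a - f 0 - a * L (fun z => f z / z ^+ 2)| <= 4 * M / s ^+ 2 * `|a| ^+ 2.
Proof.
move=> s0 [_ Sb Llin Ln Lr] fP.
have sn : s != 0 by rewrite gt_eqF.
have M0 : 0 <= M.
  have := fP 0; rewrite normr0 => /(_ (ltW (addr_gt0 s0 s0)))[_].
  exact: le_trans.
have SP z : S z -> s <= `|z| /\ `|z| <= s + s.
  by move=> /Sb; rewrite subr0 => /andP.
have Sn z : S z -> z != 0.
  by move=> /SP[h _]; rewrite -normr_gt0 (lt_le_trans s0).
have bf c z : S z -> 0 < c -> forall w, c <= `|w| -> `|f z / w| <= M / c.
  move=> /SP[_ /fP[_ fM]] c0 w cw; rewrite normrM normfV ler_pM ?invr_ge0 //.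
  by rewrite lef_pV2 ?posrE // (lt_le_trans c0).
have bounded_pole a : `|a| <= s / 2 -> bounded_on S (fun z => f z / (z - a)).
  move=> as2; exists (M / (s / 2)) => z Sz; apply: bf => //; first by rewrite divr_gt0.
  have [h _] := SP z Sz; have -> : s / 2 = s - s / 2 by field.
  by apply: le_trans (lerB_dist _ _); rewrite lerB.
have zz z : S z -> s ^+ 2 <= `|z ^+ 2|.
  by move=> /SP[h _]; rewrite normrX ler_pXn2r // ?nnegrE ?ltW // (lt_le_trans s0).
have b2 : bounded_on S (fun z => f z / z ^+ 2).
  by exists (M / s ^+ 2) => z Sz; apply: bf => //; rewrite ?exprn_gt0 ?zz.
have df z : `|z - 0| <= s + s -> differentiable f z by rewrite subr0 => /fP[].
split.
  have -> : 2 * M / s = 2 * s * (M / s ^+ 2) by field.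
  by apply: Ln => z Sz; apply: bf => //; rewrite ?exprn_gt0 ?zz.
move=> a as2.
have h0 : `|0 : K| <= s / 2 by rewrite normr0 divr_ge0 // ltW.
have s2s : s / 2 < s by rewrite ltr_pdivrMr // ltr_pMr // ltr1n.
have E1 : f a = L (fun z => f z / (z - a)).
  by rewrite (Lr f df) // subr0 (le_lt_trans as2).
have E0 : f 0 = L (fun z => f z / (z - 0)) by rewrite (Lr f df) // subrr normr0.
have bnd := bounded_on_lin (-1) (bounded_pole 0 h0) (bounded_pole a as2).
have E : f a - f 0 - a * L (fun z => f z / z ^+ 2) =
    L (fun z => - a * (f z / z ^+ 2) + (-1 * (f z / (z - 0)) + f z / (z - a))).
  rewrite E1 E0 (Llin (- a) _ _ b2 bnd) (Llin _ _ _ (bounded_pole 0 h0) (bounded_pole a as2)).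
  ring.
rewrite E.
have -> : 4 * M / s ^+ 2 * `|a| ^+ 2 = 2 * s * (M / (s ^+ 2 * (s / 2)) * `|a| ^+ 2).
  by field.
apply: Ln => z Sz; have z0 := Sn z Sz; have [sz _] := SP z Sz.
have sza : s / 2 <= `|z - a|.
  have -> : s / 2 = s - s / 2 by field.
  by apply: le_trans (lerB_dist _ _); rewrite lerB.
have za0 : z - a != 0 by rewrite -normr_gt0 (lt_le_trans _ sza) // divr_gt0.
have -> : - a * (f z / z ^+ 2) + (-1 * (f z / (z - 0)) + f z / (z - a)) =
    f z / (z ^+ 2 * (z - a)) * a ^+ 2.
  by rewrite subr0; field; rewrite za0 z0.
rewrite normrM normrX ler_wpM2r ?exprn_ge0 // bf ?mulr_gt0 ?exprn_gt0 ?invr_gt0 //.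
by rewrite normrM ler_pM ?exprn_ge0 ?zz ?divr_ge0 ?(ltW s0).
Qed.

Lemma derive_quadratic (f : K -> K) (D C s : K) : 0 <= C -> 0 < s ->
  (forall a, `|a| < s -> `|f a - f 0 - a * D| <= C * `|a| ^+ 2) -> 'D_1 f 0 = D.
Proof.
move=> C0 s0 DP.
have Al : linear (fun h : K => h * D).
  by move=> a u v; rewrite mulrDl -[a *: u]/(a * u) -mulrA.
pose AlM := GRing.isLinear.Build _ _ _ _ _ Al.
pose AL : {linear K -> K} := HB.pack (fun h : K => h * D) AlM.
have CP : 0 <= `|D| + C by rewrite addr_ge0.
have AC h : `|AL h| <= (`|D| + C) * `|h| by rewrite /= normrM mulrC ler_wpM2r // lerDl.
have fC y : `|y - 0| < s -> `|f y - f 0 - AL (y - 0)| <= (`|D| + C) * `|y - 0| ^+ 2.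
  rewrite subr0 => /DP /le_trans; apply.
  by rewrite ler_wpM2r ?exprn_ge0 // lerDr.
have [df dE] := differentiable_quadratic CP AC s0 fC.
by rewrite deriveE // dE /= mul1r.
Qed.

Lemma derive_taylor1 (f : K -> K) (s M : K) (S : set K) (L : (K -> K) -> K) : 0 < s ->
  cauchy_functional 0 s S L ->
  (forall z, `|z| <= s + s -> differentiable f z /\ `|f z| <= M) ->
  'D_1 f 0 = L (fun z => f z / z ^+ 2).
Proof.
move=> s0 SL fP; have [_ DP] := taylor1 s0 SL fP.
have f0 := fP 0; rewrite normr0 in f0; have [_ M0] := f0 (ltW (addr_gt0 s0 s0)).
have {}M0 : 0 <= M by exact: le_trans M0.
apply: (@derive_quadratic _ _ (4 * M / s ^+ 2) (s / 2)); last by move=> a /ltW/DP.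
  by rewrite !mulr_ge0 // invr_ge0 exprn_ge0 // ltW.
by rewrite divr_gt0.
Qed.

(** The bounds depend on [f] only through [M] and [r]; this uniformity is what allows
    differentiation under the integral. *)
Lemma differentiable_estimate (V : normedModType K) (f : V -> K) (w0 : V) (r M : K) :
  0 < r -> (forall w, `|w - w0| < r -> differentiable f w /\ `|f w| <= M) ->
  (forall h, `|'d f w0 h| <= 8 * M / r * `|h|) /\
  (forall w, `|w - w0| <= r / 8 ->
    `|f w - f w0 - 'd f w0 (w - w0)| <= 64 * M / r ^+ 2 * `|w - w0| ^+ 2).
Proof.
move=> r0 fP; have dw0 : differentiable f w0.
  by have [] := fP w0; rewrite ?subrr ?normr0.
have main h : h != 0 -> `|'d f w0 h| <= 8 * M / r * `|h| /\
    (`|h| <= r / 8 ->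
     `|f (w0 + h) - f w0 - 'd f w0 h| <= 64 * M / r ^+ 2 * `|h| ^+ 2).
  move=> hn; have h0 : 0 < `|h| by rewrite normr_gt0.
  (* For [z] of norm at most [s + s] the point [w0 + z *: h] is within [r / 2] of [w0]. The
     expansion is used at [z = 1], which requires [1 <= s / 2], that is [|h| <= r / 8]. *)
  pose s := r / (4 * `|h|); have s0 : 0 < s by rewrite divr_gt0 // mulr_gt0.
  pose phi (z : K) := f (w0 + z *: h).
  have phiP z : `|z| <= s + s -> differentiable phi z /\ `|phi z| <= M.
    move=> zs; have near_w0 : `|w0 + z *: h - w0| < r.
      rewrite addrAC subrr add0r normrZ.
      apply: (@le_lt_trans _ _ ((s + s) * `|h|)); first by rewrite ler_wpM2r.
      have -> : (s + s) * `|h| = r / 2 by rewrite /s; field; rewrite gt_eqF.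
      by rewrite ltr_pdivrMr // ltr_pMr // ltr1n.
    have [dfz fM] := fP _ near_w0; split => //.
    apply: (@differentiable_comp _ _ _ _ (fun z : K => w0 + z *: h) f) => //.
  have [S [L SL]] := cauchy_functional_exists unit_compact 0 s0.
  have [Db DP] := taylor1 s0 SL phiP.
  have DE := derive_taylor1 s0 SL phiP.
  move: (L _) Db DP DE => D Db DP DE.
  have phi0 : phi 0 = f w0 by rewrite /phi scale0r addr0.
  have {}DE : D = 'd f w0 h by rewrite -DE /phi -derive_line deriveE.
  split.
    rewrite -DE; apply: (le_trans Db); rewrite le_eqVlt; apply/orP; left; apply/eqP.
    by rewrite /s; field; rewrite gt_eqF // gt_eqF.
  move=> hr; have := DP 1; rewrite normr1 phi0 mul1r DE /phi scale1r.
  have s2 : 1 <= s / 2.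
    rewrite /s ler_pdivlMr // mul1r ler_pdivlMr ?mulr_gt0 //.
    move: hr; rewrite ler_pdivlMr // => hr; apply: le_trans hr.
    by rewrite le_eqVlt; apply/orP; left; apply/eqP; ring.
  move=> /(_ s2) /le_trans; apply; rewrite le_eqVlt; apply/orP; left; apply/eqP.
  by rewrite /s; field; rewrite gt_eqF // gt_eqF.
have M0 : 0 <= M by have [|_] := fP w0; [rewrite subrr normr0|exact: le_trans].
split=> [h|w wr].
  have [->|/main[]//] := eqVneq h 0; rewrite linear0 !normr0 mulr0 //.
have [->|wn] := eqVneq w w0.
  by rewrite !subrr linear0 subr0 !normr0 expr0n mulr0.
have wn' : w - w0 != 0 by rewrite subr_eq0.
by have [_ /(_ wr)] := main _ wn'; rewrite addrCA subrr addr0.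
Qed.

(** Joint continuity over the compact [S] gives one bound for all [t], hence estimates uniform in
    [t]. The differential is [L] applied to the differentials. *)
Lemma differentiable_param (V : normedModType K) (S : set K) (L : (K -> K) -> K)
    (C : K) (F : K -> V -> K) (w0 : V) (r : K) :
  compact S -> 0 <= C ->
  (forall a g h, bounded_on S g -> bounded_on S h ->
    L (fun z => a * g z + h z) = a * L g + L h) ->
  (forall g M, (forall z, S z -> `|g z| <= M) -> `|L g| <= C * M) ->
  0 < r -> (forall t w, S t -> `|w - w0| < r -> differentiable (F t) w) ->
  (forall t, S t -> {for (t, w0), continuous (fun p : K * V => F p.1 p.2)}) ->
  differentiable (fun w => L (fun t => F t w)) w0.
Proof.
move=> cS C0 Llin Ln r0 dF cF.
have [M [r' [M0 r'0 FM]]] := compact_bounded_near cS cF.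
have [q [q0 qr qr']] := pos_lower_bound r0 r'0.
have FP t : S t -> forall w, `|w - w0| < q -> differentiable (F t) w /\ `|F t w| <= M.
  move=> St w wq; split; first by apply: dF => //; exact: lt_le_trans qr.
  by apply: FM => //; exact: lt_le_trans qr'.
have est t (St : S t) := differentiable_estimate q0 (FP t St).
pose A h := L (fun t => 'd (F t) w0 h).
have bA h : bounded_on S (fun t => 'd (F t) w0 h).
  by exists (8 * M / q * `|h|) => t /est[+ _]; exact.
have Al : linear A.
  move=> a u v; rewrite /A -Llin //; congr L; apply/funext => t.
  by rewrite linearP.
pose AlM := GRing.isLinear.Build _ _ _ _ _ Al.
pose AL : {linear V -> K} := HB.pack A AlM.
pose C1 := C * (8 * M / q) + C * (64 * M / q ^+ 2).
have c8 : 0 <= C * (8 * M / q) by rewrite !mulr_ge0 // invr_ge0 ltW.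
have c64 : 0 <= C * (64 * M / q ^+ 2) by rewrite !mulr_ge0 // invr_ge0 exprn_ge0 // ltW.
have bF w : `|w - w0| < q -> bounded_on S (fun t => F t w).
  by move=> wq; exists M => t /FP/(_ w wq)[].
have w0q : `|w0 - w0| < q by rewrite subrr normr0.
set G := (fun w => _); suff [] : differentiable G w0 /\ 'd G w0 = AL :> (V -> K) by [].
apply: (@differentiable_quadratic _ _ _ G w0 AL C1 (q / 8)).
- by rewrite addr_ge0.
- move=> h; rewrite /AL /= /A; apply: le_trans (Ln _ (8 * M / q * `|h|) _) _.
    by move=> t /est[+ _]; exact.
  by rewrite mulrA ler_wpM2r // lerDl.
- by rewrite divr_gt0.
move=> w wq8; have wq : `|w - w0| < q.
  by rewrite (lt_le_trans wq8) // ler_pdivrMr // ler_peMr ?ler1n // ltW.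
rewrite /G /AL /= /A.
have bFA := bounded_on_lin (-1) (bA (w - w0)) (bF w wq).
have -> : L (F^~ w) - L (F^~ w0) - L (fun t => 'd (F t) w0 (w - w0)) =
    L (fun t => -1 * F t w0 + (-1 * 'd (F t) w0 (w - w0) + F t w)).
  rewrite (Llin (-1) _ _ (bF w0 w0q) bFA) (Llin (-1) _ _ (bA (w - w0)) (bF w wq)); ring.
apply: le_trans (Ln _ (64 * M / q ^+ 2 * `|w - w0| ^+ 2) _) _.
  move=> t /est[_ /(_ w (ltW wq8))]; congr (`|_| <= _); ring.
by rewrite mulrA ler_wpM2r ?exprn_ge0 // lerDr.
Qed.

End ParametricIntegral.

(** * Descent along a map with finite fibres *)

Section Rows.
Variables (K : numFieldType) (n : nat).

Lemma differentiable_row (V : normedModType K) (F : V -> 'rV[K]_n) (x : V) :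
  (forall j, differentiable (fun v => F v 0 j) x) -> differentiable F x.
Proof.
move=> dF; have -> : F = \sum_(j < n) (fun v => F v 0 j *: delta_mx 0 j).
  by apply/funext => v; rewrite fct_sumE -row_sum_delta.
by apply: differentiable_sum => j; exact: differentiableZl.
Qed.

Definition upd (z : 'rV[K]_n) (i : 'I_n) (t : K) : 'rV[K]_n :=
  \row_j (if j == i then t else z 0 j).

Lemma updE z i t j : upd z i t 0 j = if j == i then t else z 0 j.
Proof. by rewrite mxE. Qed.

Lemma upd_same z i t : upd z i t 0 i = t.
Proof. by rewrite mxE eqxx. Qed.

Lemma upd_id z i : upd z i (z 0 i) = z.
Proof. by apply/rowP => j; rewrite mxE; case: eqP => [->|]. Qed.

Lemma differentiable_upd (V : normedModType K) (z : V -> 'rV[K]_n) (t : V -> K) i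
    (x : V) : differentiable z x -> differentiable t x ->
  differentiable (fun v => upd (z v) i (t v)) x.
Proof.
move=> dz dt; apply: differentiable_row => j.
have [->|ji] := eqVneq j i.
  by rewrite (_ : (fun v => _) = t) //; apply/funext => v; rewrite updE eqxx.
rewrite (_ : (fun v => _) = (fun v => z v 0 j)).
  exact: (differentiable_comp dz (@differentiable_coord K 1 n (z x) 0 j)).
by apply/funext => v; rewrite updE (negPf ji).
Qed.

Definition polydisc (b : 'rV[K]_n) (r : K) : set 'rV[K]_n :=
  [set z | forall i, `|z 0 i - b 0 i| < r].

Lemma near_polydisc (b z : 'rV[K]_n) (r : K) : polydisc b r z ->
  \forall z' \near z, polydisc b r z'.
Proof.
move=> zr.
have := @filter_forall _ 'I_n (fun i (z' : 'rV[K]_n) => is_true (`|z' 0 i - b 0 i| < r)) (nbhs z) (nbhs_filter z); apply => i.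
have /continuous_normP cz := @differentiable_continuous _ _ _ z _
  (@differentiable_coord K 1 n z 0 i).
have d0 : 0 < r - `|z 0 i - b 0 i| by rewrite subr_gt0.
have [d d_gt0 dP] := cz _ d0; apply/(@near_normP K 'rV[K]_n z); exists d => // y /dP yz.
have -> : y 0 i - b 0 i = (y 0 i - z 0 i) + (z 0 i - b 0 i) by ring.
by rewrite (le_lt_trans (ler_normD _ _)) // -ltrBrDr.
Qed.

Lemma row_normP (z b : 'rV[K]_n) (r : K) : 0 < r ->
  (forall i, `|z 0 i - b 0 i| < r) -> `|z - b| < r.
Proof.
move=> r0 zb; suff : ball b r z by rewrite -ball_normE /ball_ /= distrC.
by split=> // i j; rewrite ord1 -ball_normE /ball_ /= distrC.
Qed.

End Rows.

(* Iterated Cauchy integrals descend a function [F0] that is constant on the fibres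
   of [proj] to a holomorphic function of [proj y], without any local inverse of
   [proj]: integrating the [k]-th variable against the kernel sums [F0] over all
   values of the [k]-th coordinate along the fibre, and the values in [J k] are the
   ones already taken by later coordinates. *)
Section Descent.
Variables (K : numClosedFieldType) (n : nat).
Hypothesis unit_compact : compact [set t : K | 0 <= t <= 1].
Local Notation rV := 'rV[K]_n.
Variables (b : rV) (s rho : K) (S : 'I_n -> set K) (L : 'I_n -> (K -> K) -> K).
Variables (U : set rV) (ker : 'I_n -> K -> rV -> K) (J : 'I_n -> {set 'I_n}).
Variables (F0 : rV -> K) (proj : rV -> rV).
Hypothesis s_gt0 : 0 < s.
Hypothesis s_rho : s + s < rho.
Hypothesis LP : forall i, cauchy_functional (b 0 i) s (S i) (L i).
Hypothesis U_open : forall u, U u -> \forall u' \near u, U u'.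
Hypothesis ker_diff : forall i t u, S i t -> U u ->
  differentiable (fun p : (K * rV)%type => ker i p.1 p.2) (t, u).
Hypothesis J_block : forall i j, j \in J i -> b 0 j = b 0 i.
Hypothesis J_later : forall i j : 'I_n, j \in J i -> (i < j)%N.
Hypothesis F0_diff : forall z, polydisc b rho z ->
  differentiable F0 z.

Local Notation P := (polydisc b rho).
Local Notation close := (polydisc b s).

Hypothesis F0_fibre : forall y y', close y -> close y' -> proj y = proj y' ->
  F0 y = F0 y'.
Hypothesis proj_onto : forall u, U u -> exists2 y, close y & proj y = u.
(** [q] lists values of coordinate [k] along the fibre of [y] with the coordinates after [k] kept
    fixed. It is nonempty because its size will be a divisor. *)
Hypothesis ker_fibre : forall y k, close y -> U (proj y) -> exists q : seq K,
  [/\ q != [::],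
      forall z, z \in q -> exists y', [/\ close y', proj y' = proj y, y' 0 k = z &
         forall i : 'I_n, (k < i)%N -> y' 0 i = y 0 i] &
      forall f : K -> K, (forall z, `|z - b 0 k| <= s + s -> differentiable f z) ->
        L k (fun t => f t * ker k t (proj y)) =
        \sum_(j in J k) f (y 0 j) + \sum_(z <- q) f z].

Local Notation rV2 := (rV * rV)%type.

(** Functions live on pairs [(z, u)] with [u] independent of [z]. The relation [u = proj y] enters
    only when values are compared. *)
Definition ker_int (k : 'I_n) (F : rV2 -> K) (p : rV2) : K :=
  L k (fun t => F (upd p.1 k t, p.2) * ker k t p.2).

(** An average of [F] over the values in [q]: the integral sums over these and over the values held
    by [J k], the latter are subtracted, and the denominator is the same expression for the constant
    1, namely the size of [q]. *)
Definition descent_step (k : 'I_n) (F : rV2 -> K) (p : rV2) : K :=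
  (ker_int k F p - \sum_(j in J k) F (upd p.1 k (p.1 0 j), p.2)) /
  (ker_int k (fun=> 1) p - #|J k|%:R).

Fixpoint descent (k : nat) : rV2 -> K :=
  if k is k'.+1 then
    (if insub k' is Some i then descent_step i (descent k') else descent k')
  else fun p => F0 p.1.

Lemma S_P (z : rV) i t : P z -> S i t -> P (upd z i t).
Proof.
move=> Pz; have [_ /(_ t) St _ _ _] := LP i => /St /andP[_ tb] j.
by rewrite updE; case: eqP => [->|_]; [exact: le_lt_trans tb s_rho|exact: Pz].
Qed.

Lemma near_PU (p : rV2) : P p.1 -> U p.2 ->
  \forall p' \near p, P p'.1 /\ U p'.2.
Proof.
case: p => z u /= Pz Uu.
exists (P, U); first by split; [exact: near_polydisc|exact: U_open].
by move=> [z' u'] [].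
Qed.

Lemma ker_int_diff k (F : rV2 -> K) :
  (forall p, P p.1 -> U p.2 -> differentiable F p) ->
  forall p, P p.1 -> U p.2 -> differentiable (ker_int k F) p.
Proof.
move=> dF p Pp Up; have [cS Sb Llin Ln _] := LP k.
have /near_normP[r r0 rP] := near_PU Pp Up.
have s20 : 0 <= 2 * s by rewrite mulr_ge0 // ltW.
have joint t (q : rV2) : S k t -> P q.1 -> U q.2 ->
    differentiable (fun x : (K * rV2)%type =>
      F (upd x.2.1 k x.1, x.2.2) * ker k x.1 x.2.2) (t, q).
  move=> St Pq Uq; have d1 := @differentiable_fst K K rV2 (t, q).
  have d2 := @differentiable_snd K K rV2 (t, q).
  have d21 : differentiable (fun x : (K * rV2)%type => x.2.1) (t, q).
    exact: (differentiable_comp d2 (@differentiable_fst K rV rV q)).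
  have d22 : differentiable (fun x : (K * rV2)%type => x.2.2) (t, q).
    exact: (differentiable_comp d2 (@differentiable_snd K rV rV q)).
  apply: differentiable_mulE.
    apply: (@differentiable_comp _ _ _ _
      (fun x : (K * rV2)%type => (upd x.2.1 k x.1, x.2.2)) F).
      by apply: differentiable_pair => //; exact: differentiable_upd.
    by apply: dF => //=; exact: S_P.
  apply: (@differentiable_comp _ _ _ _ (fun x : (K * rV2)%type => (x.1, x.2.2))
    (fun x : (K * rV)%type => ker k x.1 x.2)); first exact: differentiable_pair.
  exact: ker_diff.
apply: (@differentiable_param K unit_compact rV2 (S k) (L k) (2 * s)
  (fun t p => F (upd p.1 k t, p.2) * ker k t p.2) p r) => //.
- move=> t q St /rP[Pq Uq].
  apply: (@differentiable_comp _ _ _ _ (fun q : rV2 => (t, q))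
     (fun x : (K * rV2)%type => F (upd x.2.1 k x.1, x.2.2) * ker k x.1 x.2.2)).
    by apply: differentiable_pair => //; exact: differentiable_cst.
  exact: joint.
- by move=> t St; apply: differentiable_continuous; exact: joint.
Qed.

Lemma ker_int_count k y (z : rV) : close y -> U (proj y) -> P z ->
  exists q : seq K, [/\ q != [::],
      forall z, z \in q -> exists y', [/\ close y', proj y' = proj y, y' 0 k = z &
         forall i : 'I_n, (k < i)%N -> y' 0 i = y 0 i],
      ker_int k (fun=> 1) (z, proj y) - #|J k|%:R = (size q)%:R &
      forall F : rV2 -> K, (forall p, P p.1 -> U p.2 -> differentiable F p) ->
        ker_int k F (z, proj y) = \sum_(j in J k) F (upd z k (y 0 j), proj y)
          + \sum_(t <- q) F (upd z k t, proj y)].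
Proof.
move=> cy Uy Pz; have [q [qn qy qf]] := ker_fibre k cy Uy; exists q; split => //.
  rewrite /ker_int (qf (fun=> 1)); last by move=> t _; exact: differentiable_cst.
  by rewrite sumr_const big_const_seq count_predT iter_addr_0 addrAC subrr add0r.
move=> F dF; rewrite /ker_int (qf (fun t => F (upd z k t, proj y))) // => t tb.
apply: (@differentiable_comp _ _ _ _ (fun t : K => (upd z k t, proj y)) F).
  apply: differentiable_pair; last exact: differentiable_cst.
  by apply: differentiable_upd => //; exact: differentiable_cst.
apply: dF => //= j; rewrite updE; case: eqP => [->|_]; last exact: Pz.
exact: le_lt_trans tb s_rho.
Qed.

(** The denominator of a step vanishes nowhere: each [u] in [U] is the image of a close [y], where
    the denominator counts a nonempty list. *)
Lemma descent_diff k p : P p.1 -> U p.2 -> differentiable (descent k) p.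
Proof.
elim: k p => [|k IH] p Pp Up /=.
  apply: (@differentiable_comp _ _ _ _ (fun p : rV2 => p.1) F0).
    exact: differentiable_fst.
  exact: F0_diff.
case: insubP => [i _ _|_]; last exact: IH.
apply: differentiable_divE.
- apply: differentiable_subE; first exact: ker_int_diff.
  apply: differentiable_sumE => j Jj.
  apply: (@differentiable_comp _ _ _ _
    (fun p : rV2 => (upd p.1 i (p.1 0 j), p.2)) (descent k)).
    apply: differentiable_pair; last exact: differentiable_snd.
    apply: differentiable_upd; first exact: differentiable_fst.
    exact: (differentiable_comp (@differentiable_fst K rV rV p)
      (@differentiable_coord K 1 n p.1 0 j)).
  apply: IH => //= l; rewrite updE; case: eqP => [->|_]; last exact: Pp.
  by rewrite -(J_block Jj); exact: Pp.
- apply: differentiable_subE; last exact: differentiable_cst.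
  by apply: ker_int_diff => // q _ _; exact: differentiable_cst.
case: p Pp Up => z u /= Pz Uu; have [y cy yu] := proj_onto Uu.
have Uy : U (proj y) by rewrite yu.
have [q [qn _ qs _]] := ker_int_count i cy Uy Pz.
by rewrite -yu qs pnatr_eq0 size_eq0.
Qed.

(** After [k] steps the first [k] coordinates of [z] no longer matter: the averages run over points
    of the fibre of [y], on which [F0] is constant. *)
Lemma descent_fibre k y (z : rV) : close y -> U (proj y) -> P z ->
  (forall i : 'I_n, (k <= i)%N -> z 0 i = y 0 i) -> descent k (z, proj y) = F0 y.
Proof.
elim: k y z => [|k IH] y z cy Uy Pz zy /=.
  by congr F0; apply/rowP => i; exact: zy.
case: insubP => [i _ ik|]; last first.
  rewrite -leqNgt => nk; apply: IH => // i ki; have := ltn_ord i.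
  by rewrite ltnNge (leq_trans nk ki).
have [q [qn qy qs qF]] := ker_int_count i cy Uy Pz.
rewrite /descent_step qs (qF (descent k)); last by move=> p; exact: descent_diff.
(* The integral produces the values [y 0 j], the step subtracts those at [z 0 j]; they agree because
   [j] comes after [i]. *)
have -> : \sum_(j in J i) descent k (upd z i (y 0 j), proj y) =
    \sum_(j in J i) descent k (upd z i (z 0 j), proj y).
  apply: eq_bigr => j /J_later ij; rewrite zy //.
  by rewrite -ik in ij *.
rewrite addrAC subrr add0r.
have -> : \sum_(t <- q) descent k (upd z i t, proj y) = \sum_(t <- q) F0 y.
  rewrite big_seq [RHS]big_seq; apply: eq_bigr => t /qy[y' [cy' py' y't y'i]].
  rewrite -(F0_fibre cy' cy py') -py'; apply: IH => //; first by rewrite py'.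
    move=> j; rewrite updE; case: eqP => [->|_]; last exact: Pz.
    rewrite -y't; apply: lt_trans (cy' i) _; apply: le_lt_trans s_rho.
    by rewrite lerDl ltW.
  move=> j kj; rewrite updE; case: eqP => [->//|/eqP ji].
  have ij : (i < j)%N by rewrite ltn_neqAle eq_sym ji ik.
  by rewrite (y'i _ ij) zy // -ik.
rewrite big_const_seq count_predT iter_addr_0 -[F0 y *+ _]mulr_natr mulfK //.
by rewrite pnatr_eq0 size_eq0.
Qed.

Lemma descent_exists : exists Psi : rV -> K,
  (forall u, U u -> differentiable Psi u) /\
  forall y, close y -> U (proj y) -> Psi (proj y) = F0 y.
Proof.
have Pb : P b.
  by move=> i; rewrite subrr normr0 (lt_trans _ s_rho) // addr_gt0.
(* After [n] steps no coordinate of the first component matters, so it can be fixed at the centre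
   [b]. *)
exists (fun u => descent n (b, u)); split=> [u Uu|y cy Uy].
  apply: (@differentiable_comp _ _ _ _ (fun u : rV => (b, u)) (descent n)).
    by apply: differentiable_pair => //; exact: differentiable_cst.
  exact: descent_diff.
by apply: descent_fibre => // i; rewrite leqNgt ltn_ord.
Qed.

End Descent.

(** * Sums over roots from logarithmic derivatives *)

Section LogDerivative.
Variable K : numClosedFieldType.
Variables (b s : K) (S : set K) (L : (K -> K) -> K).
Hypothesis s_gt0 : 0 < s.
Hypothesis LP : cauchy_functional b s S L.

Definition holo_disc (f : K -> K) := forall z, `|z - b| <= s + s -> differentiable f z.

Lemma cauchy_ext g h : bounded_on S g -> (forall z, S z -> g z = h z) -> L g = L h.
Proof.
have [_ _ Ll Ln _] := LP => gb gh; have hb : bounded_on S h.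
  by have [M gM] := gb; exists M => z Sz; rewrite -gh //; exact: gM.
apply/eqP; rewrite -subr_eq0 -normr_le0; have := Ll (-1) h g hb gb.
rewrite mulN1r addrC => <-; have := Ln (fun z => -1 * h z + g z) 0.
rewrite mulr0; apply => z Sz.
by rewrite gh // mulN1r addNr normr0.
Qed.

Lemma bounded_pole f z : holo_disc f -> (forall t, S t -> t != z) ->
  bounded_on S (fun t => f t / (t - z)).
Proof.
have [cS Sb _ _ _] := LP => df Sz.
have [t St|M [_ fM]] := @compact_image_bounded K S (fun t => f t / (t - z)) cS.
  apply: (@differentiable_continuous K K K).
  apply: differentiable_divE; last by rewrite subr_eq0 Sz.
    by apply: df; have /andP[] := Sb t St.
  by apply: differentiable_subE; last exact: differentiable_cst.
by exists M.
Qed.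

Definition off_annulus z := `|z - b| < s \/ s + s < `|z - b|.

Lemma off_annulusP z t : off_annulus z -> S t -> t != z.
Proof.
have [_ Sb _ _ _] := LP => zo /Sb/andP[h1 h2]; apply/eqP => tz.
by move: zo; rewrite /off_annulus -tz => -[/(le_lt_trans h1)|/(le_lt_trans h2)];
  rewrite ltxx.
Qed.

(** For [z] outside, [f t / (t - z)] equals [F t / (t - b)] with [F] holomorphic and zero at [b], so
    Cauchy's formula at [b] gives 0. *)
Lemma cauchy_pole f z : holo_disc f -> off_annulus z ->
  L (fun t => f t / (t - z)) = if `|z - b| < s then f z else 0.
Proof.
have [_ _ _ _ Lr] := LP => df zo; case: ifPn => [zb|zb]; first exact: Lr.
case: zo => zo; first by rewrite zo in zb.
have Sz t : S t -> t != z by apply: off_annulusP; right.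
have Sb0 t : S t -> t != b.
  by apply: off_annulusP; left; rewrite subrr normr0.
pose F t := f t * (t - b) / (t - z).
have dF : holo_disc F.
  move=> t tb; apply: differentiable_divE.
  - apply: differentiable_mulE; first exact: df.
    by apply: differentiable_subE; last exact: differentiable_cst.
  - by apply: differentiable_subE; last exact: differentiable_cst.
  - by rewrite subr_eq0; apply/eqP => tz; move: zo; rewrite -tz => /(le_lt_trans tb); rewrite ltxx.
rewrite (@cauchy_ext _ (fun t => F t / (t - b))) //.
- by rewrite (Lr F dF) ?subrr ?normr0 // /F subrr mulr0 mul0r.
- exact: bounded_pole.
move=> t St; rewrite /F; field.
by rewrite !subr_eq0 Sz // Sb0.
Qed.

Lemma cauchy_pole_sum f (rs : seq K) : holo_disc f ->
  (forall z, z \in rs -> off_annulus z) ->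
  bounded_on S (fun t => \sum_(z <- rs) f t / (t - z)) /\
  L (fun t => \sum_(z <- rs) f t / (t - z)) = \sum_(z <- rs | `|z - b| < s) f z.
Proof.
have [_ _ Ll Ln _] := LP => df; elim: rs => [|z rs IH] zrs.
  have -> : (fun t => \sum_(z <- [::]) f t / (t - z)) = fun=> 0.
    by apply/funext => t; rewrite big_nil.
  rewrite big_nil; split; first by exists 0 => t _; rewrite normr0.
  apply/eqP; rewrite -normr_le0; have := Ln (fun=> 0) 0; rewrite mulr0.
  by apply => t _; rewrite normr0.
have zo : off_annulus z by apply: zrs; rewrite mem_head.
have [b1 E1] := IH (fun w wrs => zrs w (mem_behead (s := z :: rs) wrs)).
have b2 : bounded_on S (fun t => f t / (t - z)).
  by apply: bounded_pole => // t; exact: off_annulusP.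
have E : (fun t => \sum_(w <- z :: rs) f t / (t - w)) =
    (fun t => 1 * (f t / (t - z)) + \sum_(w <- rs) f t / (t - w)).
  by apply/funext => t; rewrite big_cons mul1r.
rewrite E; split; first exact: bounded_on_lin.
by rewrite (Ll 1 _ _ b2 b1) E1 cauchy_pole // big_cons mul1r; case: ifP; rewrite ?add0r.
Qed.

Lemma log_deriv_prod (rs : seq K) t : (forall z, z \in rs -> t != z) ->
  (\prod_(z <- rs) ('X - z%:P)).[t] != 0 /\
  (\prod_(z <- rs) ('X - z%:P))^`().[t] / (\prod_(z <- rs) ('X - z%:P)).[t] =
  \sum_(z <- rs) (t - z)^-1.
Proof.
elim: rs => [|z rs IH] zrs.
  by rewrite !big_nil hornerE oner_eq0 derivC horner0 mul0r.
have [q0 qE] := IH (fun w wrs => zrs w (mem_behead (s := z :: rs) wrs)).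
have tz : t - z != 0 by rewrite subr_eq0 zrs // mem_head.
rewrite !big_cons -qE derivM derivXsubC !hornerE mulf_neq0 //; split => //.
by field; rewrite tz q0.
Qed.

(** The argument principle weighted by [f]. The left side depends on the roots only through [p], so
    a sum over roots becomes holomorphic in the coefficients. *)
Lemma cauchy_log_deriv f (rs : seq K) p : p = \prod_(z <- rs) ('X - z%:P) ->
  holo_disc f -> (forall z, z \in rs -> off_annulus z) ->
  L (fun t => f t * (p^`().[t] / p.[t])) = \sum_(z <- rs | `|z - b| < s) f z.
Proof.
move=> -> df zrs; have [bd <-] := cauchy_pole_sum df zrs.
apply/esym/cauchy_ext => // t St.
have [|_ ->] := @log_deriv_prod rs t; last by rewrite mulr_sumr.
by move=> z /zrs zo; exact: off_annulusP.
Qed.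

End LogDerivative.

Section PolyFamily.
Variables (K : numFieldType) (V : normedModType K) (p : V -> {poly K}) (N : nat).
Hypothesis p_size : forall u, (size (p u) <= N)%N.

Lemma differentiable_horner (u : V) (t : K) :
  (forall i, differentiable (fun u => (p u)`_i) u) ->
  differentiable (fun x : (K * V)%type => (p x.2).[x.1]) (t, u) /\
  differentiable (fun x : (K * V)%type => (p x.2)^`().[x.1]) (t, u).
Proof.
move=> dp; have d1 := @differentiable_fst K K V (t, u).
have dc i : differentiable (fun x : (K * V)%type => (p x.2)`_i) (t, u).
  exact: (differentiable_comp (@differentiable_snd K K V (t, u)) (dp i)).
split.
  have -> : (fun x : (K * V)%type => (p x.2).[x.1]) =
      (fun x => \sum_(i < N) (p x.2)`_i * x.1 ^+ i).
    by apply/funext => x; exact: horner_coef_wide.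
  apply: differentiable_sumE => i _; apply: differentiable_mulE => //.
  exact: differentiable_expE.
have -> : (fun x : (K * V)%type => (p x.2)^`().[x.1]) =
    (fun x => \sum_(i < N) ((p x.2)`_i.+1 * i.+1%:R) * x.1 ^+ i).
  apply/funext => x; rewrite (@horner_coef_wide _ N); last first.
    by rewrite (leq_trans (leq_trans (size_poly _ _) (leq_pred _))).
  by apply: eq_bigr => i _; rewrite coef_deriv mulr_natr.
apply: differentiable_sumE => i _; apply: differentiable_mulE.
  by apply: differentiable_mulE => //; exact: differentiable_cst.
exact: differentiable_expE.
Qed.

End PolyFamily.

Section DescentPoly.
Variables (K : numClosedFieldType) (n : nat).
Hypothesis unit_compact : compact [set t : K | 0 <= t <= 1].
Local Notation rV := 'rV[K]_n.
Variables (b : rV) (s rho : K) (U : set rV) (p : 'I_n -> rV -> {poly K}) (N : nat).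
Variables (J : 'I_n -> {set 'I_n}) (F0 : rV -> K) (proj : rV -> rV).

(** Here the kernel is [p' / p]. The roots of [p k (proj y)] near [b 0 k] split, with multiplicity,
    into those held by the coordinates in [J k] and the list [q]; the other roots stay clear of the
    contour. *)
Lemma descent_poly :
  0 < s -> s + s < rho ->
  (forall u, U u -> \forall u' \near u, U u') ->
  (forall i u, size (p i u) <= N)%N ->
  (forall i u l, U u -> differentiable (fun u => (p i u)`_l) u) ->
  (forall i j, j \in J i -> b 0 j = b 0 i) ->
  (forall i j : 'I_n, j \in J i -> (i < j)%N) ->
  (forall z, polydisc b rho z -> differentiable F0 z) ->
  (forall y y', polydisc b s y -> polydisc b s y' -> proj y = proj y' -> F0 y = F0 y') ->
  (forall u, U u -> exists2 y, polydisc b s y & proj y = u) ->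
  (forall y k, polydisc b s y -> U (proj y) -> exists rs q : seq K,
     [/\ p k (proj y) = \prod_(z <- rs) ('X - z%:P),
         forall z, z \in rs -> off_annulus (b 0 k) s z,
         perm_eq [seq z <- rs | `|z - b 0 k| < s] ([seq y 0 j | j <- enum (J k)] ++ q),
         q != [::] &
         forall z, z \in q -> exists y', [/\ polydisc b s y', proj y' = proj y, y' 0 k = z &
           forall i : 'I_n, (k < i)%N -> y' 0 i = y 0 i]]) ->
  exists Psi : rV -> K, (forall u, U u -> differentiable Psi u) /\
    forall y, polydisc b s y -> U (proj y) -> Psi (proj y) = F0 y.
Proof.
move=> s0 srho Uo psz pd Jb Jl F0d F0f onto fib.
have /choice[SL SLP] : forall i, exists SL : set K * ((K -> K) -> K),
    cauchy_functional (b 0 i) s SL.1 SL.2.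
  move=> i; have [S [L H]] := cauchy_functional_exists unit_compact (b 0 i) s0.
  by exists (S, L).
apply: (@descent_exists K n unit_compact b s rho (fun i => (SL i).1) (fun i => (SL i).2)
  U (fun i t u => (p i u)^`().[t] / (p i u).[t]) J F0 proj) => //.
  move=> i t u St Uu; have [y cy yu] := onto u Uu.
  have Uy : U (proj y) by rewrite yu.
  have [rs [q [pE ro _ _ _]]] := fib y i cy Uy.
  have [d1 d2] := @differentiable_horner K _ (p i) N (psz i) u t (fun l => pd i u l Uu).
  apply: differentiable_divE => //=; rewrite -yu pE.
  have [|] := @log_deriv_prod K rs t; last by [].
  by move=> z /ro zo; exact: (off_annulusP (SLP i) zo).
move=> y k cy Uy; have [rs [q [pE ro pq qn qf]]] := fib y k cy Uy.
exists q; split => // f df; rewrite (cauchy_log_deriv s0 (SLP k) pE) // -big_filter.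
by rewrite (perm_big _ pq) /= big_cat big_map big_enum.
Qed.

End DescentPoly.

Lemma finite_pos_lower_bound (K : numDomainType) (I : finType) (Q : I -> K -> Prop) :
  (forall i e e', 0 < e -> e <= e' -> Q i e' -> Q i e) ->
  (forall i, exists2 e, 0 < e & Q i e) -> exists2 e, 0 < e & forall i, Q i e.
Proof.
move=> Qd Qex; suff [e e0 eQ] : exists2 e, 0 < e & forall i, i \in enum I -> Q i e.
  by exists e => // i; apply: eQ; rewrite mem_enum.
elim: (enum I) => [|i l [e e0 eQ]]; first by exists 1.
have [e' e'0 Qe'] := Qex i; have [c [c0 ce ce']] := pos_lower_bound e0 e'0.
exists c => // j; rewrite inE => /orP[/eqP ->|/eQ]; first exact: Qd Qe'.
exact: Qd.
Qed.

(** * Descent along the power map *)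

Section PowerRoots.
Variables (K : numClosedFieldType) (r : nat).
Hypothesis r_gt0 : (0 < r)%N.

Lemma power_factor (y : K) : exists rs : seq K,
  [/\ 'X^r - y%:P = \prod_(z <- rs) ('X - z%:P), size rs = r &
      forall z, (z \in rs) = (z ^+ r == y)].
Proof.
have [rs E] := closed_field_poly_normal ('X^r - y%:P).
have mon : 'X^r - y%:P \is monic by exact: monicXnsubC.
rewrite (monicP mon) scale1r in E; exists rs; split => //.
  by have := congr1 (fun p : {poly K} => size p) E; rewrite size_XnsubC // size_prod_XsubC => -[].
move=> z; rewrite -root_prod_XsubC -E rootE !hornerE subr_eq0 //.
Qed.

Lemma power_separated (b : K) : exists2 e : K, 0 < e &
  forall z, z ^+ r = b ^+ r -> z != b -> e <= `|z - b|.
Proof.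
have [rs [_ _ rsP]] := power_factor (b ^+ r).
suff [e e0 eP] : exists2 e : K, 0 < e & forall z, z \in rs -> z != b -> e <= `|z - b|.
  by exists e => // z zb; apply: eP; rewrite rsP zb.
elim: rs {rsP} => [|z rs [e e0 eP]]; first by exists 1.
have [->|zb] := eqVneq z b.
  by exists e => // w; rewrite inE => /orP[/eqP ->|/eP //]; rewrite eqxx.
have zb0 : 0 < `|z - b| by rewrite normr_gt0 subr_eq0.
have [c [c0 ce cz]] := pos_lower_bound e0 zb0; exists c => // w.
by rewrite inE => /orP[/eqP -> //|/eP h /h]; exact: le_trans.
Qed.

(** Compare products of distances with [s ^+ r]. If [t ^+ r = y], the distances from [t] to the
    roots of [b ^+ r] multiply to [|y - b ^+ r|]; so do the distances from [b] to the roots of [y].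
    In each case some factor is below [s]. The gap [s + s + s] keeps points of the annulus at
    distance [s] from the roots other than [b]. *)
Lemma power_roots (b s y : K) : 0 < s ->
  (forall z, z ^+ r = b ^+ r -> z != b -> s + s + s <= `|z - b|) ->
  `|y - b ^+ r| < s ^+ r ->
  (forall z, z ^+ r = y -> off_annulus b s z) /\
  exists z, `|z - b| < s /\ z ^+ r = y.
Proof.
move=> s0 sep yb.
have prod_ge (rs : seq K) t : (forall z, z \in rs -> s <= `|t - z|) ->
    s ^+ size rs <= `|\prod_(z <- rs) (t - z)|.
  elim: rs => [|z rs IH] zs; first by rewrite big_nil normr1.
  rewrite big_cons normrM exprS ler_pM ?exprn_ge0 ?(ltW s0) // ?zs ?mem_head //.
  by apply: IH => w wrs; apply: zs; rewrite inE wrs orbT.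
have horner_prod (rs : seq K) t : (\prod_(z <- rs) ('X - z%:P)).[t] = \prod_(z <- rs) (t - z).
  by rewrite horner_prod; apply: eq_bigr => z _; rewrite !hornerE.
split=> [t ty|].
  have tr := normr_real (t - b); have sr := gtr0_real s0.
  have [h1|] := real_ltP tr sr; first by left.
  have [h2|h2 h1] := real_ltP (realD sr sr) tr; first by right.
  have [rs [E szrs rsP]] := power_factor (b ^+ r).
  have := prod_ge rs t; rewrite -horner_prod -E !hornerE ty szrs.
  suff h : forall z, z \in rs -> s <= `|t - z| by move=> /(_ h) /(lt_le_trans yb); rewrite ltxx.
  move=> z; rewrite rsP => /eqP zb; have [->//|/(sep z zb) h3] := eqVneq z b.
  have -> : t - z = (t - b) - (z - b) by ring.
  rewrite distrC; apply: le_trans (lerB_dist _ _).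
  have -> : s = (s + s + s) - (s + s) by ring.
  exact: lerB.
have [rs [E szrs rsP]] := power_factor y.
apply: contrapT => /forallNP H.
have := prod_ge rs b; rewrite -horner_prod -E !hornerE szrs distrC.
suff h : forall z, z \in rs -> s <= `|b - z| by move=> /(_ h) /(lt_le_trans yb); rewrite ltxx.
move=> z; rewrite rsP => /eqP zy; have := H z.
rewrite real_leNgt ?normr_real ?gtr0_real // => h; apply/negP => zb; apply: h.
by rewrite distrC.
Qed.

End PowerRoots.

(** * The two group actions and the power map *)

Section Action.
Variables (K : numClosedFieldType) (n : nat).
Local Notation rV := 'rV[K]_n.

Definition perm_pt (s : 'S_n) (y : rV) : rV := \row_i y 0 ((s^-1)%g i).

(** Permutations multiply from left to right, whence [t * s]. *)
Lemma perm_ptM s t y : perm_pt s (perm_pt t y) = perm_pt (t * s)%g y.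
Proof. by apply/rowP => i; rewrite !mxE invMg permM. Qed.

Lemma perm_pt1 y : perm_pt 1 y = y.
Proof. by apply/rowP => i; rewrite mxE invg1 perm1. Qed.

Lemma perm_ptK s y : perm_pt s^-1 (perm_pt s y) = y.
Proof. by rewrite perm_ptM mulgV perm_pt1. Qed.

Lemma perm_ptKV s y : perm_pt s (perm_pt s^-1 y) = y.
Proof. by rewrite perm_ptM mulVg perm_pt1. Qed.

Lemma perm_pt_diff s y : differentiable (perm_pt s) y.
Proof.
apply: differentiable_row => i.
rewrite (_ : (fun v => _) = (fun v : rV => v 0 ((s^-1)%g i))).
  exact: differentiable_coord.
by apply/funext => v; rewrite mxE.
Qed.

Lemma near_comp (V W : normedModType K) (f : V -> W) (x : V) (Q : W -> Prop) :
  differentiable f x -> (\forall y \near f x, Q y) -> \forall x' \near x, Q (f x').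
Proof. by move=> /differentiable_continuous; exact. Qed.

Variable r : nat.
Hypothesis r_gt0 : (0 < r)%N.

Lemma act_grn_diff (z : rV) s x : differentiable (act_grn z s) x.
Proof.
apply: differentiable_row => i.
rewrite (_ : (fun v => _) = (fun v : rV => z 0 i * v 0 ((s^-1)%g i))).
  apply: differentiable_mulE; first exact: differentiable_cst.
  exact: differentiable_coord.
by apply/funext => v; rewrite mxE.
Qed.

Lemma grn_diff g x : @grn K n r g -> differentiable g x.
Proof. by move=> [z [s [_ ->]]]; exact: act_grn_diff. Qed.

Lemma grn_id : @grn K n r id.
Proof.
exists (const_mx 1), 1%g; split; first by move=> i; rewrite mxE expr1n.
by apply/funext => x; apply/rowP => i; rewrite !mxE invg1 perm1 mul1r.
Qed.

Lemma grn_comp g h : @grn K n r g -> @grn K n r h -> @grn K n r (g \o h).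
Proof.
move=> [z [s [z1 ->]]] [w [t [w1 ->]]].
exists (\row_i (z 0 i * w 0 ((s^-1)%g i))), (t * s)%g; split.
  by move=> i; rewrite mxE exprMn z1 w1 mulr1.
by apply/funext => x; apply/rowP => i; rewrite !mxE invMg permM mulrA.
Qed.

Lemma root1_neq0 (z : K) : z ^+ r = 1 -> z != 0.
Proof.
by move=> zr; apply/eqP => z0; move: zr; rewrite z0 expr0n gtn_eqF // => /esym/eqP; rewrite oner_eq0.
Qed.

Lemma grn_inv g : @grn K n r g -> exists h, [/\ @grn K n r h, cancel g h & cancel h g].
Proof.
move=> [z [s [z1 ->]]]; exists (act_grn (\row_i (z 0 (s i))^-1) s^-1); split.
- exists (\row_i (z 0 (s i))^-1), (s^-1)%g; split => // i.
  by rewrite mxE exprVn z1 invr1.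
- by move=> x; apply/rowP => i; rewrite !mxE invgK permK mulKf // root1_neq0.
- by move=> x; apply/rowP => i; rewrite !mxE invgK !permKV mulVKf // root1_neq0.
Qed.

Lemma pow_act (z : rV) s x : (forall i, z 0 i ^+ r = 1) ->
  pow_pt r (act_grn z s x) = perm_pt s (pow_pt r x).
Proof. by move=> z1; apply/rowP => i; rewrite !mxE exprMn z1 mul1r. Qed.

Lemma pow_eq_orbit x x' : pow_pt r x = pow_pt r x' -> exists2 g, @grn K n r g & x' = g x.
Proof.
(* Where [x 0 i] is 0 so is [x' 0 i], and any root of unity would do. *)
move=> E; pose z : rV := \row_i (if x 0 i == 0 then 1 else x' 0 i / x 0 i).
have Ei i : x 0 i ^+ r = x' 0 i ^+ r by have := congr1 (fun u : rV => u 0 i) E; rewrite !mxE.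
exists (act_grn z 1).
  exists z, 1%g; split => // i; rewrite mxE; case: eqP => [_|/eqP x0]; first exact: expr1n.
  by rewrite exprMn exprVn -Ei mulfV // expf_neq0.
apply/rowP => i; rewrite !mxE invg1 perm1; case: eqP => [x0|/eqP x0]; last by rewrite divfK.
have := Ei i; rewrite x0 expr0n gtn_eqF // mulr0 => /esym/eqP.
by rewrite expf_eq0 r_gt0 /= => /eqP.
Qed.

Lemma pow_pt_diff x : differentiable (@pow_pt K n r) x.
Proof.
apply: differentiable_row => i.
rewrite (_ : (fun v => _) = (fun v : rV => v 0 i ^+ r)).
  by apply: differentiable_expE; exact: differentiable_coord.
by apply/funext => v; rewrite mxE.
Qed.

Definition invariant_at (phi : rV -> K) : set rV :=
  [set x | forall g, @grn K n r g -> phi (g x) = phi x].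

Lemma invariant_at_orbit phi x g : invariant_at phi x -> @grn K n r g ->
  invariant_at phi (g x).
Proof.
by move=> Nx Gg h Gh; rewrite -[h (g x)]/((h \o g) x) !Nx //; exact: grn_comp.
Qed.

(** A section of the power map without any continuity; invariance of [phi] makes the choice of roots
    immaterial. *)
Definition root_pt (y : rV) : rV := \row_i r.-root (y 0 i).

Lemma pow_root_pt y : pow_pt r (root_pt y) = y.
Proof. by apply/rowP => i; rewrite !mxE rootCK. Qed.

Lemma invariant_root phi x : invariant_at phi x -> phi (root_pt (pow_pt r x)) = phi x.
Proof.
move=> Nx; have [g Gg ->] : exists2 g, @grn K n r g & root_pt (pow_pt r x) = g x.
  by apply: pow_eq_orbit; rewrite pow_root_pt.
exact: Nx.
Qed.

Lemma perm_grn (s : 'S_n) x : exists2 g, @grn K n r g & pow_pt r (g x) = perm_pt s (pow_pt r x).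
Proof.
exists (act_grn (const_mx 1) s).
  by exists (const_mx 1), s; split => // i; rewrite mxE expr1n.
by rewrite pow_act // => i; rewrite mxE expr1n.
Qed.

Hypothesis unit_compact : compact [set t : K | 0 <= t <= 1].

Lemma near_polydisc_radius (x0 : rV) (Q : rV -> Prop) : (\forall x \near x0, Q x) ->
  exists2 e : K, 0 < e & forall x, polydisc x0 e x -> Q x.
Proof.
move=> /(@near_normP K 'rV[K]_n x0)[e e0 eQ]; exists e => // x xe; apply: eQ.
exact: row_normP.
Qed.

Lemma polydisc_le (x0 : rV) (e e' : K) : e <= e' -> polydisc x0 e `<=` polydisc x0 e'.
Proof. by move=> ee x xe i; exact: lt_le_trans ee. Qed.

(* Radii for which [pow_pt r] maps the polydisc around [x0] onto a neighbourhood. *)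
Definition power_radius (x0 : rV) (s : K) :=
  0 < s /\ forall i z, z ^+ r = x0 0 i ^+ r -> z != x0 0 i -> s + s + s <= `|z - x0 0 i|.

Lemma power_radius_exists (x0 : rV) (e : K) : 0 < e ->
  exists s, power_radius x0 s /\ s + s + s <= e.
Proof.
move=> e0; have [d d0 dP] := @finite_pos_lower_bound K 'I_n
  (fun i d => forall z, z ^+ r = x0 0 i ^+ r -> z != x0 0 i -> d <= `|z - x0 0 i|)
  (fun i d d' _ dd h z h1 h2 => le_trans dd (h z h1 h2))
  (fun i => power_separated r_gt0 (x0 0 i)).
have [c [c0 cd ce]] := pos_lower_bound d0 e0; exists (c / 3).
have -> : c / 3 + c / 3 + c / 3 = c by field.
split=> //; split; first by rewrite divr_gt0.
move=> i z h1 h2; have -> : c / 3 + c / 3 + c / 3 = c by field.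
exact: le_trans (dP i z h1 h2).
Qed.

Lemma pow_pt_onto (x0 y : rV) (s : K) : power_radius x0 s ->
  polydisc (pow_pt r x0) (s ^+ r) y -> exists2 x, polydisc x0 s x & pow_pt r x = y.
Proof.
move=> [s0 sep] yU.
have /choice[f fP] : forall i, exists z, `|z - x0 0 i| < s /\ z ^+ r = y 0 i.
  move=> i; have := yU i; rewrite mxE => yi.
  by have [_] := power_roots r_gt0 s0 (sep i) yi.
exists (\row_i f i); first by move=> i; rewrite mxE; have [] := fP i.
by apply/rowP => i; rewrite !mxE; have [] := fP i.
Qed.

(** The coordinates vary independently along a fibre of the power map, so [J] is empty and [q]
    consists of all the roots near [x0 0 k]. *)
Lemma descend_power_local (x0 : rV) phi : inv_holo (@grn K n r) x0 phi ->
  exists (s : K) (eta : rV -> K), [/\ power_radius x0 s,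
    forall x, polydisc x0 s x -> invariant_at phi x,
    forall y, polydisc (pow_pt r x0) (s ^+ r) y -> differentiable eta y &
    forall x, polydisc x0 s x -> polydisc (pow_pt r x0) (s ^+ r) (pow_pt r x) ->
      eta (pow_pt r x) = phi x].
Proof.
move=> ih; have /near_polydisc_radius[e e0 eP] := ih _ grn_id.
have [s [[s0 sep] se]] := power_radius_exists x0 e0.
have sle : s <= e by apply: le_trans se; rewrite -addrA lerDl addr_ge0 // ltW.
have inv x : polydisc x0 s x -> invariant_at phi x.
  by move=> /(polydisc_le sle)/eP[].
have [eta [etad etaE]] : exists Psi : rV -> K,
    (forall u, polydisc (pow_pt r x0) (s ^+ r) u -> differentiable Psi u) /\
    forall y, polydisc x0 s y -> polydisc (pow_pt r x0) (s ^+ r) (pow_pt r y) ->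
      Psi (pow_pt r y) = phi y; last by exists s, eta.
apply: (@descent_poly K n unit_compact x0 s (s + s + s)
  (polydisc (pow_pt r x0) (s ^+ r)) (fun i y => 'X^r - (y 0 i)%:P) r.+1 (fun=> finset.set0) phi
  (pow_pt r)) => //.
- by rewrite ltrDl.
- by move=> u; exact: near_polydisc.
- by move=> i u; rewrite size_XnsubC.
- move=> i u l _; rewrite (_ : (fun u => _) = (fun u : rV => ('X^r : {poly K})`_l - u 0 i *+ (l == 0%N))).
    apply: differentiable_subE; first exact: differentiable_cst.
    case: (l == 0%N); last exact: differentiable_cst.
    exact: differentiable_coord.
  by apply/funext => v; rewrite coefB coefC; case: eqP.
- by move=> i j; rewrite inE.
- by move=> i j; rewrite inE.
- by move=> z /(polydisc_le se)/eP[].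
- move=> y y' cy _ /pow_eq_orbit[g Gg ->].
  by rewrite (inv _ cy).
- by move=> u; apply: pow_pt_onto.
- move=> y k cy Uy; have [rs [E _ rsP]] := power_factor r_gt0 (pow_pt r y 0 k).
  have yk := Uy k; rewrite [pow_pt r x0 0 k]mxE in yk.
  have [off [z0 [z0s z0y]]] := power_roots r_gt0 s0 (sep k) yk.
  exists rs, [seq z <- rs | `|z - x0 0 k| < s]; split => //.
  + by move=> z; rewrite rsP => /eqP; exact: off.
  + by rewrite enum_set0 /=.
  + apply/eqP => /(congr1 (fun q : seq K => z0 \in q)).
    by rewrite mem_filter z0s rsP z0y eqxx.
  move=> z; rewrite mem_filter rsP => /andP[zs /eqP zy].
  exists (upd y k z); split.
  + by move=> j; rewrite updE; case: eqP => [->|_] //; exact: cy.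
  + apply/rowP => j; rewrite mxE updE [in RHS]mxE; case: eqP => [->|//].
    by rewrite zy mxE.
  + exact: upd_same.
  + by move=> i ki; rewrite updE; case: eqP => // ik; rewrite ik ltnn in ki.
Qed.

(** The local descent [eta1] is controlled near one point of the orbit only. The function
    [phi (root_pt y)] is defined everywhere and is symmetric near the orbit; near each point of the
    orbit it is a permuted copy of [eta1], hence holomorphic. *)
Lemma descend_power (x0 : rV) phi : inv_holo (@grn K n r) x0 phi ->
  exists eta, inv_holo (@symn K n) (pow_pt r x0) eta /\
    near_orbit (@grn K n r) x0 (fun x => phi x = eta (pow_pt r x)).
Proof.
move=> ih; have [s [eta1 [sr inv eta1d eta1E]]] := descend_power_local ih.
have [s0 _] := sr; have sr0 : 0 < s ^+ r by rewrite exprn_gt0.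
exists (fun y => phi (root_pt y)); split; last first.
  by move=> g Gg; apply: filterS (ih g Gg) => x [_ Nx]; rewrite invariant_root.
move=> _ [t ->]; rewrite -/(perm_pt t _); set y0 := pow_pt r x0.
have near_y : \forall y \near perm_pt t y0, polydisc y0 (s ^+ r) (perm_pt t^-1 y).
  apply: near_comp; first exact: perm_pt_diff.
  rewrite perm_ptK; apply: near_polydisc => i.
  by rewrite subrr normr0.
have val y : polydisc y0 (s ^+ r) (perm_pt t^-1 y) ->
    phi (root_pt y) = eta1 (perm_pt t^-1 y) /\
    forall u, phi (root_pt (perm_pt u y)) = phi (root_pt y).
  move=> yU; have [x xs xy] := pow_pt_onto sr yU; have Nx := inv x xs.
  have yE : y = perm_pt t (pow_pt r x) by rewrite xy perm_ptKV.
  have any u : phi (root_pt (perm_pt u (pow_pt r x))) = phi x.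
    have [g Gg <-] := perm_grn u x.
    by rewrite invariant_root ?Nx //; exact: invariant_at_orbit.
  split.
    by rewrite [in LHS]yE any -xy eta1E // xy.
  by move=> u; rewrite yE perm_ptM !any.
have near_near := near_join near_y.
apply: filterS near_near => y /[dup] /nbhs_singleton yU nearU; split.
  apply: (@near_eq_differentiable K _ _ (fun y => eta1 (perm_pt t^-1 y))).
    by apply: filterS nearU => y' /val[-> _].
  apply: (differentiable_comp (f := perm_pt t^-1) (g := eta1)).
    exact: perm_pt_diff.
  exact: eta1d.
by move=> _ [u ->]; have [_] := val y yU; exact.
Qed.

End Action.

(** * Block coordinates *)

Section Ranks.
Variables (n : nat) (H : {set 'I_n}).

Lemma block_rank_lt (i j : 'I_n) : j \in H -> (i < j)%N ->
  (block_rank H i < block_rank H j)%N.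
Proof.
move=> jH ij; apply: proper_card; apply/properP; split.
  by apply/fintype.subsetP => k; rewrite !inE => /andP[-> /leq_trans]; apply; exact: ltnW.
by exists j; rewrite !inE ?jH ?leqnn //= leqNgt ij.
Qed.

Lemma block_rank_inj : {in H &, injective (block_rank H)}.
Proof.
move=> i j iH jH E; apply/val_inj => /=; apply/eqP; rewrite eqn_leq.
apply/andP; split; rewrite leqNgt; apply/negP => h.
  by have := block_rank_lt iH h; rewrite E ltnn.
by have := block_rank_lt jH h; rewrite E ltnn.
Qed.

Lemma block_rank_bounds i : i \in H -> (1 <= block_rank H i < #|H|.+1)%N.
Proof.
move=> iH; apply/andP; split.
  by apply/card_gt0P; exists i; rewrite !inE iH /=.
by rewrite ltnS subset_leq_card //; apply/fintype.subsetP => j; rewrite inE => /andP[].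
Qed.

Lemma perm_block_rank :
  perm_eq [seq block_rank H i | i <- enum H] (index_iota 1 #|H|.+1).
Proof.
have u : uniq [seq block_rank H i | i <- enum H].
  rewrite map_inj_in_uniq ?enum_uniq // => i j; rewrite !mem_enum.
  exact: block_rank_inj.
apply: uniq_perm => //; first exact: iota_uniq.
apply: (uniq_min_size u _ _).2 => [d /mapP[j]|].
  by rewrite mem_enum => iH ->; rewrite mem_index_iota; exact: block_rank_bounds.
by rewrite size_iota size_map -cardE subn1.
Qed.

Lemma big_block_rank (R : Type) (idx : R) (op : Monoid.com_law idx) (G : nat -> R) :
  \big[op/idx]_(i in H) G (block_rank H i) = \big[op/idx]_(1 <= d < #|H|.+1) G d.
Proof. by rewrite -(perm_big _ perm_block_rank) /= big_map big_enum. Qed.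

End Ranks.

(** * Block polynomials and Vieta's formulas *)

Section Vieta.
Variables (K : numClosedFieldType) (n : nat).
Implicit Types (H : {set 'I_n}) (y v : 'rV[K]_n).

Definition block_prod H y : {poly K} := \prod_(j in H) ('X - (y 0 j)%:P).

Lemma block_prodE H y : block_prod H y =
  \sum_(h < #|H|.+1) ((-1) ^+ h * elem_sym H h y) *: 'X^(#|H| - h).
Proof.
rewrite /block_prod big_mkcond /=.
(* Indices outside [H] get the factor [0 + 1]: expanding over all sets of indices then leaves the
   subsets of [H]. *)
rewrite (eq_bigr (fun j => (if j \in H then - (y 0 j)%:P else 0) +
    (if j \in H then 'X else 1))); last first.
  by move=> j _; case: ifP; rewrite ?add0r // addrC.
rewrite bigA_distr (bigID (fun I : {set 'I_n} => I \subset H)) /= addrC big1 ?add0r; last first.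
  move=> I /fintype.subsetPn[j jI jH]; rewrite (bigD1 j) //= jI (negPf jH) mul0r //.
rewrite (partition_big (fun I : {set 'I_n} => inord #|I| : 'I_#|H|.+1) xpredT) //=.
apply: eq_bigr => h _; rewrite /elem_sym mulr_sumr scaler_suml.
apply: eq_big => [I|I /andP[IH /eqP hI]].
  case: (boolP (I \subset H)) => //= IH.
  by rewrite -val_eqE /= inordK // ltnS subset_leq_card.
have hE : h = #|I| :> nat by rewrite -hI inordK // ltnS subset_leq_card.
rewrite (bigID (mem I)) /= (eq_bigr (fun j => - (y 0 j)%:P)); last first.
  by move=> j jI; rewrite jI (fintype.subsetP IH).
rewrite [X in _ * X](_ : _ = 'X^(#|H| - h)).
  rewrite prodrN -rmorph_prod /= hE -mul_polyC polyCM rmorphXn /= rmorphN1.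
  by [].
rewrite (eq_bigr (fun j => if j \in H then 'X else 1)); last by move=> j /negPf ->.
rewrite -big_mkcondr /= (eq_bigl [in H :\: I]%SET) ?prodr_const.
  by rewrite cardsD (finset.setIidPr IH) hE.
by move=> j; rewrite !inE.
Qed.

Lemma coef_block_prod H y h : (h <= #|H|)%N ->
  (block_prod H y)`_(#|H| - h) = (-1) ^+ h * elem_sym H h y.
Proof.
move=> hH; have hlt : (h < #|H|.+1)%N by [].
rewrite block_prodE coef_sum (bigD1 (Ordinal hlt)) //= coefZ coefXn eqxx mulr1.
rewrite big1 ?addr0 // => i ih; rewrite coefZ coefXn.
have -> : (#|H| - h == #|H| - i)%N = false; last by rewrite mulr0.
apply/negbTE; apply: contra ih => /eqP E; apply/eqP/val_inj => /=.
by rewrite -(subKn hH) E subKn // -ltnS.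
Qed.

Lemma elem_symE H y h : (h <= #|H|)%N ->
  elem_sym H h y = (-1) ^+ h * (block_prod H y)`_(#|H| - h).
Proof. by move=> hH; rewrite coef_block_prod // mulrA -exprD addnn -muln2 mulnC exprM sqrrN expr1n expr1n mul1r. Qed.

(** The block polynomial with free coefficients: the entry of [v] at the index of rank [d] takes the
    place of the elementary symmetric function of degree [d]. *)
Definition block_poly H v : {poly K} := 'X^#|H| +
  \sum_(i in H) ((-1) ^+ block_rank H i * v 0 i) *: 'X^(#|H| - block_rank H i).

Lemma coef_block_poly H v l : (block_poly H v)`_l = (l == #|H|)%:R +
  \sum_(i in H) ((-1) ^+ block_rank H i * v 0 i) * (l == #|H| - block_rank H i)%N%:R.
Proof.
rewrite coefD coefXn coef_sum; congr (_ + _).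
by apply: eq_bigr => i _; rewrite coefZ coefXn.
Qed.

Lemma coef_block_poly_rank H v i : i \in H ->
  (block_poly H v)`_(#|H| - block_rank H i) = (-1) ^+ block_rank H i * v 0 i.
Proof.
move=> iH; have /andP[r0 r1] := block_rank_bounds iH; rewrite ltnS in r1.
rewrite coef_block_poly (bigD1 i) //= eqxx mulr1 big1 ?addr0.
  have -> : (#|H| - block_rank H i == #|H|)%N = false; last by rewrite add0r.
  by apply/negbTE; rewrite neq_ltn ltn_subrL r0 (leq_trans r0 r1).
move=> j /andP[jH ji]; have /andP[_ s1] := block_rank_bounds jH; rewrite ltnS in s1.
have -> : (#|H| - block_rank H i == #|H| - block_rank H j)%N = false; last by rewrite mulr0.
apply/negbTE; apply: contra ji => /eqP E; apply/eqP/(block_rank_inj jH iH).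
by rewrite -(subKn r1) E subKn.
Qed.

Lemma size_block_poly_tail H v :
  (size (\sum_(i in H) ((-1) ^+ block_rank H i * v 0 i) *: 'X^(#|H| - block_rank H i)
    : {poly K})%R <= #|H|)%N.
Proof.
apply: (leq_trans (size_sum _ _ _)); apply/bigmax_leqP => i iH.
have /andP[r0 r1] := block_rank_bounds iH; rewrite ltnS in r1.
apply: (leq_trans (size_scale_leq _ _)); rewrite size_polyXn.
by rewrite ltn_subrL r0 (leq_trans r0 r1).
Qed.

Lemma size_block_poly H v : size (block_poly H v) = #|H|.+1.
Proof.
by rewrite size_polyDl size_polyXn // ltnS size_block_poly_tail.
Qed.

Lemma monic_block_poly H v : block_poly H v \is monic.
Proof.
rewrite monicE lead_coefDl ?lead_coefXn //.
by rewrite size_polyXn ltnS size_block_poly_tail.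
Qed.

Lemma block_poly_prod H y v : (forall i, i \in H -> v 0 i = elem_sym H (block_rank H i) y) ->
  block_poly H v = block_prod H y.
Proof.
move=> vE; rewrite block_prodE big_ord_recl /= expr0 mul1r subn0.
have -> : elem_sym H 0 y = 1.
  rewrite /elem_sym (big_pred1 finset.set0) ?big_set0 // => I /=.
  by rewrite cards_eq0 andbC; case: eqP => //= ->; rewrite finset.sub0set.
rewrite scale1r /block_poly; congr (_ + _).
rewrite (eq_bigr (fun i => ((-1) ^+ block_rank H i * elem_sym H (block_rank H i) y)
   *: 'X^(#|H| - block_rank H i))); last by move=> i iH; rewrite vE.
rewrite (big_block_rank H _ (fun d => ((-1) ^+ d * elem_sym H d y) *: 'X^(#|H| - d))).
by rewrite big_add1 /= big_mkord.
Qed.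

Lemma elem_sym_perm H (s : 'S_n) h y : (forall i, (s i \in H) = (i \in H)) ->
  (h <= #|H|)%N -> elem_sym H h (perm_pt s y) = elem_sym H h y.
Proof.
move=> sH hH; rewrite !elem_symE // (_ : block_prod H (perm_pt s y) = block_prod H y) //.
rewrite /block_prod (reindex_inj (@perm_inj _ s)) /=.
by apply: eq_big => [i|i _]; rewrite ?sH // mxE permK.
Qed.

End Vieta.

(** * The triangular change from elementary symmetric functions to [uhat] *)

Section UhatPolynomial.
Variables (K : numClosedFieldType) (H : nat).
Implicit Types (w : nat -> K).

Definition upoly_coef (h : nat) : K := (H - h)`!%:R / H`!%:R.

Lemma upoly_coef_neq0 h : upoly_coef h != 0.
Proof. by rewrite mulf_neq0 ?invr_eq0 // pnatr_eq0 -lt0n fact_gt0. Qed.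

Definition upoly_term d (mu : {ffun 'I_d -> 'I_d.+1}) w : K :=
  (-1) ^+ (partition_length mu).-1
    * (((partition_length mu).-1)`!%:R / (\prod_(h < d) (mu h)`!)%:R)
    * \prod_(h < d) (upoly_coef h.+1 * w h.+1) ^+ mu h.

(** [uhat] as a polynomial in independent variables [w h] that stand for the elementary symmetric
    functions; here [H] is the size of the block. *)
Definition upoly d w : K :=
  \sum_(mu : {ffun 'I_d -> 'I_d.+1} | partition_mult mu) upoly_term mu w.

Definition upoly_low d w : K :=
  \sum_(mu : {ffun 'I_d.+1 -> 'I_d.+2} | partition_mult mu && (mu ord_max == 0 :> nat))
    upoly_term mu w.

Lemma upoly_low_ext d w w' : (forall h, (0 < h < d.+1)%N -> w h = w' h) ->
  upoly_low d w = upoly_low d w'.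
Proof.
move=> ww; apply: eq_bigr => mu /andP[_ /eqP mu0]; congr (_ * _).
apply: eq_bigr => h _; have [->|hm] := eqVneq h ord_max; first by rewrite mu0 !expr0.
rewrite ww //= ltnS ltn_neqAle -ltnS ltn_ord andbT.
by apply: contra hm => /eqP hd; apply/eqP/val_inj.
Qed.

Let top d : {ffun 'I_d.+1 -> 'I_d.+2} := [ffun h => if h == ord_max then inord 1 else ord0].

Lemma topE d (mu : {ffun 'I_d.+1 -> 'I_d.+2}) :
  (partition_mult mu && (mu ord_max != 0 :> nat)) = (mu == top d).
Proof.
apply/idP/eqP => [/andP[/eqP pm m0]|->].
  rewrite (bigD1 ord_max) //= in pm.
  have m1 : mu ord_max = 1 :> nat.
    have : (d.+1 * mu ord_max <= d.+1 * 1)%N.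
      by rewrite muln1 -[X in (_ <= X)%N]pm leq_addr.
    by rewrite leq_pmul2l // => m1; apply/eqP; rewrite eqn_leq m1 lt0n m0.
  rewrite m1 muln1 in pm; have /eqP := pm; rewrite -[X in _ == X]addn0 eqn_add2l.
  rewrite sum_nat_eq0 => /forallP z; apply/ffunP => h; rewrite ffunE.
  case: eqP => [->|/eqP hm]; apply/val_inj => /=; first by rewrite m1 inordK.
  by have := z h; rewrite hm /= muln_eq0 /= => /eqP.
rewrite /partition_mult (bigD1 ord_max) //= !ffunE eqxx inordK //= muln1.
rewrite big1 ?addn0 ?eqxx // => h /negPf hm.
by rewrite ffunE hm muln0.
Qed.

(** The only partition of [d.+1] having a part [d.+1] is that part alone, with weight 1. All other
    partitions involve smaller [h], so the change of variables is triangular. *)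
Lemma upolyE d w : upoly d.+1 w = upoly_coef d.+1 * w d.+1 + upoly_low d w.
Proof.
rewrite /upoly (bigID (fun mu : {ffun 'I_d.+1 -> 'I_d.+2} => mu ord_max == 0 :> nat)) /=.
rewrite addrC; congr (_ + _); rewrite (eq_bigl _ _ (@topE d)) big_pred1_eq /upoly_term.
have t0 (h : 'I_d.+1) : h != ord_max -> top d h = 0 :> nat by rewrite ffunE => /negPf ->.
have t1 : top d ord_max = 1 :> nat by rewrite ffunE eqxx inordK.
have -> : partition_length (top d) = 1%N.
  by rewrite /partition_length (bigD1 ord_max) //= t1 big1 // => h /t0.
rewrite expr0 mul1r fact0 (bigD1 ord_max) //= t1 big1 => [|h /t0 -> //].
rewrite divr1 mul1r (bigD1 ord_max) //= t1 expr1 big1 ?mulr1 // => h /t0 ->.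
exact: expr0.
Qed.

End UhatPolynomial.

Section Blocks.
Variables (K : numClosedFieldType) (n r : nat) (x0 : 'rV[K]_n).
Local Notation rV := 'rV[K]_n.
Local Notation B := (blocks r x0).
Local Notation y0 := (pow_pt r x0).

Definition blk (i : 'I_n) : {set 'I_n} := finset.pblock B i.

Lemma blocks_partition : finset.partition B [set: 'I_n]%SET.
Proof. exact: finset.preim_partitionP. Qed.

Lemma mem_blk i j : (j \in blk i) = (y0 0 j == y0 0 i).
Proof.
rewrite /blk /blocks /finset.preim_partition finset.pblock_equivalence_partition ?inE //.
  by rewrite !mxE eq_sym.
by move=> a b c _ _ _; split => // /eqP ->.
Qed.

Lemma blk_self i : i \in blk i. Proof. by rewrite mem_blk. Qed.

Lemma blk_eq i j : j \in blk i -> blk j = blk i.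
Proof.
rewrite mem_blk => /eqP ji; apply/setP => k.
by rewrite !mem_blk ji.
Qed.

Lemma blk_block i : blk i \in B.
Proof.
apply: finset.pblock_mem.
by have /and3P[/eqP -> _ _] := blocks_partition; rewrite inE.
Qed.

Lemma block_blk H i : H \in B -> i \in H -> blk i = H.
Proof.
move=> HB iH; apply: finset.def_pblock => //.
by have /and3P[_ + _] := blocks_partition.
Qed.

Lemma block_nonempty H : H \in B -> exists i, i \in H.
Proof.
move=> HB; have /and3P[_ _ n0] := blocks_partition.
by apply/set0Pn; apply: contraNneq n0 => <-.
Qed.

Definition rk (i : 'I_n) : nat := block_rank (blk i) i.

Lemma rk_bounds i : (1 <= rk i < #|blk i|.+1)%N.
Proof. exact/block_rank_bounds/blk_self. Qed.

Lemma rk_le_n i : (rk i <= n)%N.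
Proof.
have /andP[_] := rk_bounds i; rewrite ltnS => /leq_trans; apply.
by rewrite -[X in (_ <= X)%N](card_ord n) max_card.
Qed.

Lemma blk_rank i d : (1 <= d < #|blk i|.+1)%N -> exists2 j, j \in blk i & rk j = d.
Proof.
move=> dP; have : d \in [seq block_rank (blk i) j | j <- enum (blk i)].
  by rewrite (perm_mem (perm_block_rank _)) mem_index_iota.
move=> /mapP[j]; rewrite mem_enum => ji ->; exists j => //.
by rewrite /rk (blk_eq ji).
Qed.

Definition elem_map (y : rV) : rV := \row_i elem_sym (blk i) (rk i) y.

Lemma block_poly_elem_map i y : block_poly (blk i) (elem_map y) = block_prod (blk i) y.
Proof.
apply: block_poly_prod => j ji; rewrite mxE /rk (blk_eq ji) //.
Qed.

Lemma elem_map_perm (s : 'S_n) y : (forall i, y0 0 (s i) = y0 0 i) ->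
  elem_map (perm_pt s y) = elem_map y.
Proof.
move=> sy; apply/rowP => i; rewrite !mxE elem_sym_perm //.
  by move=> j; rewrite !mem_blk sy.
by have /andP[_] := rk_bounds i.
Qed.

(** The product of the block polynomials has all the coordinates as roots, so equal block
    polynomials give equal multisets of coordinates. The permutation obtained need not preserve the
    blocks; full symmetry of [eta] takes care of that. *)
Lemma elem_map_fibre y y' : elem_map y = elem_map y' -> exists s, y' = perm_pt s y.
Proof.
move=> E; have prodE (u : rV) : \prod_(i in [set: 'I_n]%SET) ('X - (u 0 i)%:P) =
    \prod_(H in B) block_prod H u.
  exact: (set_partition_big _ blocks_partition).
have : \prod_(z <- [tuple y' 0 i | i < n]) ('X - z%:P) =
       \prod_(z <- [tuple y 0 i | i < n]) ('X - z%:P).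
  rewrite !big_image /=; transitivity (\prod_(i in [set: 'I_n]%SET) ('X - (y' 0 i)%:P)).
    by apply: eq_bigl => i; rewrite finset.in_setT.
  transitivity (\prod_(i in [set: 'I_n]%SET) ('X - (y 0 i)%:P)); last first.
    by apply: eq_bigl => i; rewrite finset.in_setT.
  rewrite !prodE; apply: eq_bigr => H HB; have [i iH] := block_nonempty HB.
  by rewrite -(block_blk HB iH) -!block_poly_elem_map E.
move=> /prod_XsubC_eq/tuple_permP[s sE]; exists (s^-1)%g; apply/rowP => i.
rewrite mxE invgK.
have := congr1 (fun l => nth 0 l i) sE.
by rewrite -!tnth_nth !tnth_mktuple.
Qed.

(** A sum of at most one term, written so as to make sense for every [d] and to be visibly linear in
    [v]. *)
Definition val_at (H : {set 'I_n}) (d : nat) (v : rV) : K :=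
  \sum_(j in H | block_rank H j == d) v 0 j.

Lemma val_at_rank i j v : j \in blk i -> val_at (blk i) (rk j) v = v 0 j.
Proof.
move=> ji; rewrite /val_at (big_pred1 j) // => k.
apply/idP/eqP => [/andP[ki /eqP]|->]; rewrite /rk (blk_eq ji) ?ji ?eqxx //.
exact: block_rank_inj.
Qed.

(** The polynomial automorphism that turns elementary symmetric functions of the blocks into the
    combined coordinates. *)
Definition usym_map (v : rV) : rV :=
  \row_i upoly #|blk i| (rk i) (fun h => val_at (blk i) h v).

Lemma uhat_mapE y : uhat_map r x0 y = usym_map (elem_map y).
Proof.
apply/rowP => i; rewrite !mxE /uhat -/(blk i) -/(rk i); apply: eq_bigr => mu _.
congr (_ * _); apply: eq_bigr => h _; congr ((_ * _) ^+ _).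
have /andP[_ ri] := rk_bounds i; rewrite ltnS in ri.
have hb : (1 <= h.+1 < #|blk i|.+1)%N.
  by apply/andP; split => //; exact: leq_trans (ltn_ord h) ri.
have [j ji rj] := blk_rank hb.
by rewrite -rj val_at_rank // mxE (blk_eq ji).
Qed.

Definition usym_low i (v : rV) : K :=
  upoly_low #|blk i| (rk i).-1 (fun h => val_at (blk i) h v).

Lemma usym_mapE v i :
  usym_map v 0 i = upoly_coef K #|blk i| (rk i) * v 0 i + usym_low i v.
Proof.
have /andP[r1 _] := rk_bounds i.
rewrite mxE -[in LHS](prednK r1) upolyE prednK // val_at_rank //.
exact: blk_self.
Qed.

Lemma usym_low_ext i (v v' : rV) : (forall j, (rk j < rk i)%N -> v 0 j = v' 0 j) ->
  usym_low i v = usym_low i v'.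
Proof.
move=> vv; apply: upoly_low_ext => h; have /andP[r1 r2] := rk_bounds i.
rewrite prednK // => /andP[h0 hi].
have [|j ji rj] := @blk_rank i h; first by rewrite h0 (ltn_trans hi).
by rewrite -rj !val_at_rank // vv // rj.
Qed.

Definition usym_step (u v : rV) : rV :=
  \row_i ((u 0 i - usym_low i v) / upoly_coef K #|blk i| (rk i)).

(* [usym_map] is triangular for the ranks, so each iteration of [usym_step]
   recovers the coordinates of one more rank. *)
Definition usym_inv (u : rV) : rV := iter n (usym_step u) 0.

Lemma usym_mapK : cancel usym_map usym_inv.
Proof.
move=> v; suff claim k i : (rk i <= k)%N -> iter k (usym_step (usym_map v)) 0 0 i = v 0 i.
  by apply/rowP => i; apply: claim; exact: rk_le_n.
elim: k i => [|k IH] i ik; have /andP[r1 _] := rk_bounds i.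
  by move: ik; rewrite leqNgt r1.
rewrite /= mxE usym_mapE (@usym_low_ext i _ v) => [|j ji].
  by rewrite addrK mulrC mulKf // upoly_coef_neq0.
by apply: IH; rewrite -ltnS (leq_trans ji).
Qed.

(** By [n] steps the iteration is stationary in every rank, and a fixed point of [usym_step u] is a
    preimage of [u]. *)
Lemma usym_invK : cancel usym_inv usym_map.
Proof.
move=> u; have claim k i : (rk i <= k)%N ->
    iter k.+1 (usym_step u) 0 0 i = iter k (usym_step u) 0 0 i.
  elim: k i => [|k IH] i ik; have /andP[r1 _] := rk_bounds i.
    by move: ik; rewrite leqNgt r1.
  rewrite [LHS]/= [RHS]/= !mxE; congr ((_ - _) / _); apply: usym_low_ext => j ji.
  by apply: IH; rewrite -ltnS (leq_trans ji).
have fixed : usym_step u (usym_inv u) = usym_inv u.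
  by apply/rowP => i; apply: claim; exact: rk_le_n.
apply/rowP => i; rewrite usym_mapE -[in X in X + _]fixed [usym_step _ _ 0 i]mxE.
by rewrite mulrC divfK ?upoly_coef_neq0 // subrK.
Qed.

Lemma val_at_diff (V : normedModType K) (f : V -> rV) (x : V) H d :
  differentiable f x -> differentiable (fun v => val_at H d (f v)) x.
Proof.
move=> df; apply: differentiable_sumE => j _.
exact: (differentiable_comp df (@differentiable_coord K 1 n (f x) 0 j)).
Qed.

Lemma upoly_term_diff (V : normedModType K) m d (mu : {ffun 'I_d -> 'I_d.+1})
    (w : V -> nat -> K) (x : V) : (forall h, differentiable (fun v => w v h) x) ->
  differentiable (fun v => upoly_term m mu (w v)) x.
Proof.
move=> dw; apply: differentiable_mulE; first exact: differentiable_cst.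
apply: differentiable_prodE => h _; apply: differentiable_expE.
by apply: differentiable_mulE; first exact: differentiable_cst.
Qed.

Lemma usym_map_diff v : differentiable usym_map v.
Proof.
apply: differentiable_row => i; rewrite (_ : (fun v => _) =
   (fun v => upoly #|blk i| (rk i) (fun h => val_at (blk i) h v))).
  apply: differentiable_sumE => mu _; apply: upoly_term_diff => h.
  exact: (@val_at_diff _ id).
by apply/funext => u; rewrite mxE.
Qed.

Lemma usym_inv_diff u : differentiable usym_inv u.
Proof.
suff claim k : differentiable (fun u => iter k (usym_step u) 0) u by exact: claim.
elim: k => [|k IH] /=; first exact: differentiable_cst.
apply: differentiable_row => i; rewrite (_ : (fun v => _) =
   (fun v : rV => (v 0 i - usym_low i (iter k (usym_step v) 0)) / upoly_coef K #|blk i| (rk i))).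
  apply: differentiable_mulE; last exact: differentiable_cst.
  apply: differentiable_subE; first exact: differentiable_coord.
  apply: differentiable_sumE => mu _; apply: upoly_term_diff => h.
  exact: val_at_diff.
by apply/funext => v; rewrite mxE.
Qed.

Lemma elem_map_diff y : differentiable elem_map y.
Proof.
apply: differentiable_row => i; rewrite (_ : (fun v => _) = elem_sym (blk i) (rk i)).
  apply: differentiable_sumE => I _; apply: differentiable_prodE => j _.
  exact: differentiable_coord.
by apply/funext => v; rewrite mxE.
Qed.

End Blocks.

(** * Descent along the symmetric functions of the blocks *)

Section DescendSym.
Variables (K : numClosedFieldType) (n r : nat) (x0 : 'rV[K]_n).
Hypothesis r_gt0 : (0 < r)%N.
Hypothesis unit_compact : compact [set t : K | 0 <= t <= 1].
Local Notation rV := 'rV[K]_n.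
Local Notation y0 := (pow_pt r x0).
Local Notation blk := (blk r x0).
Local Notation rk := (rk r x0).
Local Notation elem_map := (elem_map r x0).
Local Notation v0 := (elem_map y0).

(** Continuity of roots at the [m]-th power of ['X - b]. If [z] is a root of the perturbed
    polynomial, [(z - b) ^+ m] is the difference of the two polynomials at [z]; at distance
    [rho >= s] from [b] this difference is at most [A / (A + 1) * rho ^+ m], a contradiction. *)
Lemma block_roots_near (s : K) : 0 < s ->
  exists2 e : K, 0 < e & forall i v, polydisc v0 e v ->
    forall z, root (block_poly (blk i) v) z -> `|z - y0 0 i| < s.
Proof.
move=> s0; apply: (@finite_pos_lower_bound K 'I_n (fun i e => forall v, polydisc v0 e v ->
    forall z, root (block_poly (blk i) v) z -> `|z - y0 0 i| < s)) => [i e e' _ ee h v ve|i].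
  exact/h/(polydisc_le ee ve).
set H := blk i; set b := y0 0 i; set m := #|H|.
(* Chosen so that [|z| <= rho * C] once [rho >= s]. Then [|z| ^+ (m - d)] is at most
   [rho ^+ m * (C ^+ m / s ^+ d)], and [A] sums these factors over the ranks [d]. *)
pose C := 1 + `|b| / s; have C1 : 1 <= C by rewrite lerDl divr_ge0 // ltW.
have C0 : 0 <= C := le_trans ler01 C1.
pose A := \sum_(j in H) C ^+ m / s ^+ block_rank H j.
have A0 : 0 <= A.
  by apply: sumr_ge0 => j _; rewrite divr_ge0 ?exprn_ge0 // ltW.
have A1 : 0 < A + 1 by rewrite ltr_wpDl.
exists (A + 1)^-1; first by rewrite invr_gt0.
move=> v ve z /rootP zr; rewrite real_ltNge ?normr_real ?gtr0_real //.
apply/negP => sz; set rho := `|z - b| in sz; have rho0 : 0 < rho := lt_le_trans s0 sz.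
have zC : `|z| <= rho * C.
  have -> : z = (z - b) + b by ring.
  rewrite (le_trans (ler_normD _ _)) // mulrDr mulr1 lerD2l mulrCA ler_peMr //.
  by rewrite ler_pdivlMr // mul1r.
have E : (z - b) ^+ m = \sum_(j in H) ((-1) ^+ block_rank H j * (v0 0 j - v 0 j)) * z ^+ (m - block_rank H j).
  have -> : (z - b) ^+ m = (block_poly H v0).[z] - (block_poly H v).[z].
    rewrite zr subr0 block_poly_elem_map /block_prod horner_prod -prodr_const.
    by apply: eq_bigr => j; rewrite mem_blk => /eqP jb; rewrite !hornerE jb.
  rewrite /block_poly !hornerD opprD addrACA subrr add0r !horner_sum -sumrB; apply: eq_bigr => j _.
  by rewrite !hornerZ hornerXn -mulrBl -mulrBr.
have : rho ^+ m <= (A + 1)^-1 * (rho ^+ m * A).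
  rewrite [leLHS](_ : _ = `|(z - b) ^+ m|); last by rewrite normrX.
  rewrite E (le_trans (ler_norm_sum _ _ _)) // mulr_sumr mulr_sumr.
  apply: ler_sum => j jH; have /andP[r1 r2] := block_rank_bounds jH; rewrite ltnS in r2.
  rewrite !normrM normrX normrN1 expr1n mul1r ler_pM //.
    by rewrite distrC ltW.
  rewrite normrX; apply: (@le_trans _ _ ((rho * C) ^+ (m - block_rank H j))).
    by rewrite lerXn2r ?nnegrE // mulr_ge0 // ltW.
  rewrite exprMn mulrC mulrCA ler_pM ?exprn_ge0 ?(ltW rho0) //.
    by rewrite ler_weXn2l // leq_subr.
  rewrite ler_pdivlMr ?exprn_gt0 // -[in leRHS](subnK (r2 : (block_rank H j <= m)%N)) exprD.
  by rewrite ler_wpM2l ?exprn_ge0 ?(ltW rho0) // lerXn2r ?nnegrE ?(ltW rho0) ?(ltW s0).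
rewrite ler_pdivlMl // [leRHS]mulrC ler_pM2r ?exprn_gt0 //.
by apply/negP; rewrite -real_ltNge ?(gtr0_real A1) ?(ger0_real A0) // ltrDl.
Qed.

Lemma elem_map_onto (s : K) (v : rV) :
  (forall i z, root (block_poly (blk i) v) z -> `|z - y0 0 i| < s) ->
  exists2 y, polydisc y0 s y & elem_map y = v.
Proof.
move=> rootP_.
have /choice[f fE] : forall H, exists q : seq K,
    block_poly H v = \prod_(z <- q) ('X - z%:P).
  move=> H; have [q qE] := closed_field_poly_normal (block_poly H v).
  by exists q; rewrite {1}qE (monicP (monic_block_poly H v)) scale1r.
have szf H : size (f H) = #|H|.
  by have := size_block_poly H v; rewrite fE size_prod_XsubC => -[].
(* One factorisation is chosen per block, so the indices of a block read their coordinates off the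
   same list of roots, by rank. *)
pose y : rV := \row_i nth 0 (f (blk i)) (rk i).-1.
have yE i : block_prod (blk i) y = block_poly (blk i) v.
  rewrite fE /block_prod; transitivity
     (\prod_(j in blk i) ('X - (nth 0 (f (blk i)) (block_rank (blk i) j).-1)%:P)).
    by apply: eq_bigr => j ji; rewrite mxE /rk (blk_eq ji).
  rewrite (big_block_rank _ _ (fun d => 'X - (nth 0 (f (blk i)) d.-1)%:P)).
  by rewrite big_add1 /= [RHS](big_nth 0) szf.
exists y => [i|].
  apply: rootP_; rewrite fE root_prod_XsubC mxE mem_nth // szf.
  by have /andP[r1 r2] := rk_bounds r x0 i; rewrite prednK.
apply/rowP => i; have /andP[r1 r2] := rk_bounds r x0 i.
rewrite mxE elem_symE // yE coef_block_poly_rank ?blk_self //.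
by rewrite mulrA -exprMn mulrN1 opprK expr1n mul1r.
Qed.

(** The coordinates of a block use up the roots of its polynomial with multiplicity, so [J k]
    removes the roots held by later indices of the block. Each remaining root [y 0 j], with
    [j <= k], is moved to place [k] by a transposition that leaves later indices alone. *)
Lemma descend_sym (eta : rV -> K) : inv_holo (@symn K n) y0 eta ->
  exists (s e : K) (Psi : rV -> K), [/\ 0 < s, 0 < e,
    forall v, polydisc v0 e v -> differentiable Psi v &
    forall y, polydisc y0 s y -> polydisc v0 e (elem_map y) -> Psi (elem_map y) = eta y].
Proof.
move=> ih; have : \forall y \near y0, differentiable eta y /\
    forall g, symn g -> eta (g y) = eta y.
  by have := ih (perm_pt 1); rewrite perm_pt1; apply; exists 1%g.
move=> /near_polydisc_radius[d d0 dP]; pose s := d / 3.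
have s0 : 0 < s by rewrite divr_gt0.
have sd : s + s + s = d by rewrite /s; field.
have sle : s <= d by rewrite -sd -addrA lerDl addr_ge0 // ltW.
have [e e0 eP] := block_roots_near s0.
have [Psi [Psid PsiE]] : exists Psi : rV -> K,
    (forall u, polydisc v0 e u -> differentiable Psi u) /\
    forall y, polydisc y0 s y -> polydisc v0 e (elem_map y) ->
      Psi (elem_map y) = eta y; last by exists s, e, Psi.
apply: (@descent_poly K n unit_compact y0 s d (polydisc v0 e)
  (fun i v => block_poly (blk i) v) n.+1
  (fun k => [set j in blk k | (k < j)%N]%SET) eta elem_map) => //.
- by rewrite -sd ltrDl.
- by move=> u; exact: near_polydisc.
- by move=> i u; rewrite size_block_poly ltnS -[X in (_ <= X)%N](card_ord n) max_card.
- move=> i u l _; rewrite (_ : (fun u => _) = (fun u : rV => (l == #|blk i|)%:R +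
    \sum_(j in blk i) ((-1) ^+ block_rank (blk i) j * u 0 j) *
      (l == #|blk i| - block_rank (blk i) j)%N%:R)); last first.
    by apply/funext => u'; rewrite coef_block_poly.
  apply: differentiable_addE; first exact: differentiable_cst.
  apply: differentiable_sumE => j _; apply: differentiable_mulE; last exact: differentiable_cst.
  apply: differentiable_mulE; first exact: differentiable_cst.
  exact: differentiable_coord.
- by move=> i j; rewrite finset.inE mem_blk => /andP[/eqP].
- by move=> i j; rewrite finset.inE => /andP[].
- by move=> z /dP[].
- move=> y y' cy _ /elem_map_fibre[t ->].
  have [_ inv] := dP y (polydisc_le sle cy).
  by rewrite inv //; exists t.
- by move=> u ue; apply: elem_map_onto => i; exact: eP.
move=> y k cy Uy.
exists [seq y 0 j | j <- enum (blk k)].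
exists [seq y 0 j | j <- enum [set j in blk k | (j <= k)%N]%SET]; split.
- by rewrite block_poly_elem_map big_map big_enum.
- move=> z /mapP[j]; rewrite mem_enum mem_blk => /eqP jk ->; left.
  by rewrite -jk; exact: cy.
- rewrite (_ : [seq z <- _ | _] = [seq y 0 j | j <- enum (blk k)]); last first.
    apply/all_filterP/allP => z /mapP[j]; rewrite mem_enum mem_blk => /eqP jk ->.
    by rewrite -jk; exact: cy.
  rewrite -map_cat perm_map // uniq_perm ?enum_uniq //.
    rewrite cat_uniq !enum_uniq andbT /=; apply/hasPn => j.
    by rewrite !mem_enum !finset.inE => /andP[_]; rewrite leqNgt => /negPf ->; rewrite andbF.
  move=> j; rewrite mem_cat !mem_enum !finset.inE.
  by case: (j \in blk k) => //=; rewrite ltnNge orNb.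
- rewrite -size_eq0 size_map -cardE cards_eq0; apply/set0Pn; exists k.
  by rewrite finset.inE blk_self /=.
move=> z /mapP[j]; rewrite mem_enum finset.inE mem_blk => /andP[/eqP jk jlek] ->.
have tp i : y0 0 (tperm j k i) = y0 0 i by case: tpermP => [->|->|].
exists (perm_pt (tperm j k) y); split.
- by move=> i; rewrite mxE tpermV -(tp i); exact: cy.
- exact: elem_map_perm.
- by rewrite mxE tpermV tpermR.
move=> i ki; rewrite mxE tpermV tpermD //; last by rewrite neq_ltn ki.
by rewrite neq_ltn (leq_ltn_trans jlek ki).
Qed.

Local Notation u0 := (uhat_map r x0 y0).

Lemma usym_inv_u0 : usym_inv r x0 u0 = v0.
Proof. by rewrite uhat_mapE usym_mapK. Qed.

Lemma near_usym_inv (e : K) : 0 < e ->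
  \forall u \near u0, polydisc v0 e (usym_inv r x0 u).
Proof.
move=> e0; apply: near_comp; first exact: usym_inv_diff.
by rewrite usym_inv_u0; apply: near_polydisc => i; rewrite subrr normr0.
Qed.

Lemma uhat_map_diff y : differentiable (uhat_map r x0) y.
Proof.
rewrite (_ : uhat_map r x0 = usym_map r x0 \o elem_map).
  by apply: differentiable_comp; [exact: elem_map_diff|exact: usym_map_diff].
by apply/funext => z; rewrite uhat_mapE.
Qed.

Lemma uhat_map_open (P : rV -> Prop) :
  (\forall y \near y0, P (uhat_map r x0 y)) -> \forall u \near u0, P u.
Proof.
move=> /near_polydisc_radius[s s0 sP]; have [e e0 eP] := block_roots_near s0.
apply: filterS (near_usym_inv e0) => u ue.
have [|y ys yu] := @elem_map_onto s (usym_inv r x0 u); first by move=> i; exact: eP.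
by rewrite -(usym_invK r x0 u) -yu -uhat_mapE; exact: sP.
Qed.

Lemma pow_pt_open (P : rV -> Prop) :
  (\forall x \near x0, P (pow_pt r x)) -> \forall y \near y0, P y.
Proof.
move=> /near_polydisc_radius[e e0 eP]; have [s [sr se]] := power_radius_exists r_gt0 x0 e0.
have [s0 _] := sr; have sle : s <= e.
  by apply: le_trans se; rewrite -addrA lerDl addr_ge0 // ltW.
have : \forall y \near y0, polydisc y0 (s ^+ r) y.
  by apply: near_polydisc => i; rewrite subrr normr0 exprn_gt0.
apply: filterS => y /(pow_pt_onto r_gt0 sr)[x xs <-]; apply: eP.
exact: (polydisc_le sle).
Qed.

Lemma block_expression_exists phi : inv_holo (@grn K n r) x0 phi ->
  exists Psi, block_expression r x0 phi Psi.
Proof.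
move=> ih; have [eta [etah phiE]] := descend_power r_gt0 unit_compact ih.
have [s [e [Psi [s0 e0 Psid PsiE]]]] := descend_sym etah.
exists (Psi \o usym_inv r x0), eta; split => //.
  apply: filterS (near_usym_inv e0) => u ue; apply: differentiable_comp.
    exact: usym_inv_diff.
  exact: Psid.
have ys : \forall y \near y0, polydisc y0 s y.
  by apply: near_polydisc => i; rewrite subrr normr0.
have ye : \forall y \near y0, polydisc v0 e (elem_map y).
  apply: near_comp; first exact: elem_map_diff.
  by apply: near_polydisc => i; rewrite subrr normr0.
apply: filterS (filterI ys ye) => y [h1 h2].
by rewrite /= uhat_mapE usym_mapK PsiE.
Qed.

End DescendSym.

(** * Derivatives and Hadamard's lemma *)

Section HoloDerivative.
Variable K : numClosedFieldType.
Hypothesis unit_compact : compact [set t : K | 0 <= t <= 1].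

Lemma near_bounded (V : normedModType K) (f : V -> K) (x : V) :
  differentiable f x -> \forall y \near x, `|f y| <= `|f x| + 1.
Proof.
move=> /differentiable_continuous/continuous_normP/(_ _ ltr01)[d d0 dP].
apply/near_normP; exists d => // y /dP/ltW yx.
have -> : f y = f x + (f y - f x) by ring.
by rewrite (le_trans (ler_normD _ _)) // lerD2l.
Qed.

(** Near [y], the derivative at [u] is the integral of [f (u + z *: v) / z ^+ 2] over a contour that
    does not depend on [u]. *)
Lemma derive_differentiable (V : normedModType K) (f : V -> K) (v x : V) :
  (\forall y \near x, differentiable f y) ->
  \forall y \near x, differentiable (fun u => 'D_v f u) y.
Proof.
move=> df; suff main y : (\forall u \near y, differentiable f u) ->
    differentiable (fun u => 'D_v f u) y.
  by apply: filterS (near_join df) => y; exact: main.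
move=> {}df; have /near_bounded fb := nbhs_singleton df.
have dfb : \forall u \near y, differentiable f u /\ `|f u| <= `|f y| + 1.
  exact: (filterI df fb).
have [d d0 dP] := (near_normP _ _).1 dfb.
set M := `|f y| + 1 in dP.
have v1 : 0 < `|v| + 1 by rewrite ltr_wpDl.
(* This makes [(s + s) * (|v| + 1)] equal to [d / 2]; the added 1 covers [v = 0]. *)
pose s := d / 4 / (`|v| + 1); have s0 : 0 < s by rewrite !divr_gt0.
have sv (z : K) : `|z| <= s + s -> `|z *: v| <= d / 2.
  move=> zs; rewrite normrZ; apply: (@le_trans _ _ ((s + s) * (`|v| + 1))).
    by rewrite ler_pM // lerDl.
  by rewrite /s le_eqVlt; apply/orP; left; apply/eqP; field; rewrite gt_eqF.
have [S [L SL]] := cauchy_functional_exists unit_compact 0 s0.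
have [cS Sb Ll Ln _] := SL.
have near_dd u z : `|u - y| < d / 2 -> `|z| <= s + s -> `|u + z *: v - y| < d.
  move=> uy /sv zv; rewrite addrAC (le_lt_trans (ler_normD _ _)) //.
  by rewrite [ltRHS]splitr ltr_leD.
have E u : `|u - y| < d / 2 -> 'D_v f u = L (fun z => f (u + z *: v) / z ^+ 2).
  move=> uy; rewrite derive_line; apply: (derive_taylor1 (M := M) s0 SL) => z zs.
  have [dfu fM] := dP _ (near_dd u z uy zs); split => //.
  exact: (differentiable_comp (differentiable_line u v z) dfu).
apply: (@near_eq_differentiable K V K (fun u => L (fun z => f (u + z *: v) / z ^+ 2))).
  by apply/near_normP; exists (d / 2); [rewrite divr_gt0|move=> u /E].
have Sn z : S z -> z != 0.
  by move=> /Sb; rewrite subr0 -normr_gt0 => /andP[+ _]; exact: lt_le_trans.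
have joint z u : S z -> `|u - y| < d / 2 ->
    differentiable (fun p : (K * V)%type => f (p.2 + p.1 *: v) / p.1 ^+ 2) (z, u).
  move=> Sz uy; have /andP[_] := Sb z Sz; rewrite subr0 => zs.
  have [dfu _] := dP _ (near_dd u z uy zs).
  apply: differentiable_divE; last by rewrite expf_neq0 // Sn.
    apply: (@differentiable_comp _ _ _ _ (fun p : (K * V)%type => p.2 + p.1 *: v) f) => //.
    apply: (@differentiableD _ _ V (fun p : (K * V)%type => p.2) (fun p => p.1 *: v)).
      exact: differentiable_snd.
    by apply: differentiableZl; exact: differentiable_fst.
  by apply: differentiable_expE; exact: differentiable_fst.
apply: (@differentiable_param K unit_compact V S L (2 * s)
  (fun z u => f (u + z *: v) / z ^+ 2) y (d / 2)) => //.
- by rewrite mulr_ge0 // ltW.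
- by rewrite divr_gt0.
- move=> z u Sz uy.
  apply: (@differentiable_comp _ _ _ _ (fun u : V => (z, u))
     (fun p : (K * V)%type => f (p.2 + p.1 *: v) / p.1 ^+ 2)); last exact: joint.
  by apply: differentiable_pair => //; exact: differentiable_cst.
- move=> z Sz; apply: differentiable_continuous; apply: joint => //.
  by rewrite subrr normr0 divr_gt0.
Qed.

Variable n : nat.
Local Notation rV := 'rV[K]_n.

(** The divided difference in coordinate [i] is the integral of [f (upd u i t) / ((t - u 0 i) * (t -
    u0 0 i))]. The integrand has no singularity where [u 0 i = u0 0 i], so the quotient is
    holomorphic there too. *)
Lemma divide_coord (f : rV -> K) (u0 : rV) (i : 'I_n) :
  (\forall u \near u0, differentiable f u) ->
  exists q : rV -> K, (\forall u \near u0, differentiable q u) /\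
    \forall u \near u0, f u = f (upd u i (u0 0 i)) + (u 0 i - u0 0 i) * q u.
Proof.
move=> /near_polydisc_radius[d d0 dP]; pose s := d / 3.
have s0 : 0 < s by rewrite divr_gt0.
have sd : s + s < d.
  have -> : s + s = d * (2 / 3) by rewrite /s; field.
  by rewrite gtr_pMr // ltr_pdivrMr // mul1r ltr_nat.
have [S [L SL]] := cauchy_functional_exists unit_compact (u0 0 i) s0.
have [cS Sb Ll Ln Lr] := SL.
pose q u := L (fun t => f (upd u i t) / ((t - u 0 i) * (t - u0 0 i))).
have nU : \forall u \near u0, polydisc u0 s u.
  by apply: near_polydisc => j; rewrite subrr normr0.
have s_le : s <= d by apply: le_trans (ltW sd); rewrite lerDl ltW.
have upd_in u t : polydisc u0 s u -> `|t - u0 0 i| <= s + s -> polydisc u0 d (upd u i t).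
  move=> us ts j; rewrite updE; case: eqP => [->|_]; first exact: le_lt_trans sd.
  exact: polydisc_le us _.
have off u t : polydisc u0 s u -> S t -> t - u 0 i != 0.
  move=> us /Sb/andP[ts _]; rewrite subr_eq0; apply/eqP => tu.
  by have := us i; rewrite -tu => /(le_lt_trans ts); rewrite ltxx.
have u0s : polydisc u0 s u0 by move=> j; rewrite subrr normr0.
exists q; split; last first.
  apply: filterS nU => u us.
  have [uu0|uu0] := eqVneq (u 0 i) (u0 0 i).
    rewrite uu0 subrr mul0r addr0; congr f; apply/rowP => j; rewrite updE.
    by case: eqP => [->|_].
  pose g t := f (upd u i t).
  have dg : holo_disc (u0 0 i) s g.
    move=> t ts; apply: (@differentiable_comp _ _ _ _ (fun t : K => upd u i t) f).
      by apply: differentiable_upd => //; exact: differentiable_cst.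
    by apply: dP; apply: upd_in.
  have b1 := bounded_pole SL dg (fun t St => negbT (etrans (esym (subr_eq0 t (u 0 i)))
    (negbTE (off u t us St)))).
  have b2 := bounded_pole SL dg (fun t St => negbT (etrans (esym (subr_eq0 t (u0 0 i)))
    (negbTE (off u0 t u0s St)))).
  have b12 := bounded_on_lin (-1) b2 b1.
  have b0 : bounded_on S (fun=> 0 : K) by exists 0 => t _; rewrite normr0.
  have L0 : L (fun=> 0) = 0.
    apply/eqP; rewrite -normr_le0; have := Ln (fun=> 0) 0; rewrite mulr0.
    by apply => t _; rewrite normr0.
  have qE : q u = (u 0 i - u0 0 i)^-1 * (g (u 0 i) - g (u0 0 i)).
    have -> : g (u 0 i) - g (u0 0 i) =
        L (fun t => -1 * (g t / (t - u0 0 i)) + g t / (t - u 0 i)).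
      by rewrite (Ll (-1) _ _ b2 b1) (Lr g dg (u 0 i) (us i)) (Lr g dg (u0 0 i) (u0s i)); ring.
    rewrite -[RHS]addr0 -L0 -(Ll _ _ _ b12 b0).
    apply/esym/(cauchy_ext SL); first exact: bounded_on_lin.
    move=> t St; rewrite /g; field.
    by rewrite off // off // subr_eq0 uu0.
  rewrite qE mulrA mulfV ?subr_eq0 // mul1r /g upd_id addrC subrK //.
have joint t u : S t -> polydisc u0 s u ->
    differentiable (fun p : (K * rV)%type =>
      f (upd p.2 i p.1) / ((p.1 - p.2 0 i) * (p.1 - u0 0 i))) (t, u).
  move=> St us; have d1 := @differentiable_fst K K rV (t, u).
  have d2 := @differentiable_snd K K rV (t, u).
  have d2i := differentiable_comp d2 (@differentiable_coord K 1 n u 0 i).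
  have /andP[_ ts] := Sb t St.
  apply: differentiable_divE.
  - apply: (@differentiable_comp _ _ _ _ (fun p : (K * rV)%type => upd p.2 i p.1) f).
      exact: differentiable_upd.
    by apply: dP; apply: upd_in.
  - exact: (differentiable_mulE (differentiable_subE d1 d2i)
      (differentiable_subE d1 (differentiable_cstE (u0 0 i) _))).
  - by rewrite mulf_neq0 // off.
apply: filterS (near_join nU) => u nUu.
have us := nbhs_singleton nUu; have /near_normP[r r0 rP] := nUu.
apply: (@differentiable_param K unit_compact rV S L (2 * s)
  (fun t u => f (upd u i t) / ((t - u 0 i) * (t - u0 0 i))) u r) => //.
- by rewrite mulr_ge0 // ltW.
- move=> t w St wr.
  apply: (@differentiable_comp _ _ _ _ (fun w : rV => (t, w)) (fun p : (K * rV)%type =>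
      f (upd p.2 i p.1) / ((p.1 - p.2 0 i) * (p.1 - u0 0 i)))).
    by apply: differentiable_pair => //; exact: differentiable_cst.
  by apply: joint => //; exact: rP.
- by move=> t St; apply: differentiable_continuous; exact: joint.
Qed.

End HoloDerivative.

Section Hadamard.
Variables (K : numClosedFieldType) (n : nat).
Hypothesis unit_compact : compact [set t : K | 0 <= t <= 1].
Local Notation rV := 'rV[K]_n.

(** [pk k] freezes the first [k] coordinates at [u0]. Each single freezing is a division by one
    coordinate, and the differences telescope. *)
Lemma hadamard (f : rV -> K) (u0 : rV) : (\forall u \near u0, differentiable f u) ->
  exists q : 'I_n -> rV -> K, (forall i, \forall u \near u0, differentiable (q i) u) /\
    \forall u \near u0, f u = f u0 + \sum_i (u 0 i - u0 0 i) * q i u.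
Proof.
move=> df; pose pk k (u : rV) : rV := \row_j (if (j < k)%N then u0 0 j else u 0 j).
have pk0 k : pk k u0 = u0 by apply/rowP => j; rewrite mxE if_same.
have dpk k u : differentiable (pk k) u.
  apply: differentiable_row => j; rewrite (_ : (fun v => _) =
    if (j < k)%N then fun=> u0 0 j else fun v : rV => v 0 j).
    by case: ifP => _; [exact: differentiable_cst|exact: differentiable_coord].
  by apply/funext => v; rewrite mxE; case: ifP.
have dfk k : \forall u \near u0, differentiable (f \o pk k) u.
  have : \forall u \near u0, differentiable f (pk k u).
    have h : \forall u \near pk k u0, differentiable f u by rewrite pk0.
    exact: (near_comp (dpk k u0) h).
  by apply: filterS => u dfu; exact: differentiable_comp.
have /choice[q qP] : forall i : 'I_n, exists q : rV -> K,
    (\forall u \near u0, differentiable q u) /\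
    \forall u \near u0, f (pk i u) = f (pk i.+1 u) + (u 0 i - u0 0 i) * q u.
  move=> i; have [q [dq qE]] := divide_coord unit_compact i (dfk i).
  exists q; split => //; apply: filterS qE => u /= ->; congr (f _ + _).
  apply/rowP => j; rewrite !mxE ltnS; case: ltngtP => //= ji.
    by rewrite -val_eqE /= gtn_eqF.
  by move/val_inj: ji => ->; rewrite eqxx.
exists q; split => [i|]; first by have [] := qP i.
have qE i : \forall u \near u0, f (pk (i : 'I_n) u) = f (pk i.+1 u) + (u 0 i - u0 0 i) * q i u.
  by have [] := qP i.
have := @filter_forall _ 'I_n (fun i u => f (pk (i : 'I_n) u) =
  f (pk i.+1 u) + (u 0 i - u0 0 i) * q i u) (nbhs u0) (nbhs_filter u0) qE.
apply: filterS => u {}qE.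
rewrite (eq_bigr (fun i : 'I_n => f (pk i u) - f (pk i.+1 u))); last first.
  by move=> i _; rewrite qE addrAC subrr add0r.
rewrite -(big_mkord xpredT (fun i => f (pk i u) - f (pk i.+1 u))).
rewrite (eq_bigr (fun i => (- f (pk i.+1 u)) - (- f (pk i u)))); last first.
  by move=> i _; rewrite opprK addrC.
rewrite telescope_sumr // opprK.
have -> : pk n u = u0 by apply/rowP => j; rewrite mxE ltn_ord.
have -> : pk 0%N u = u by apply/rowP => j; rewrite mxE.
by rewrite addrA subrr add0r.
Qed.

Lemma derive_coord (v u : rV) i c : 'D_v (fun u : rV => u 0 i - c) u = v 0 i.
Proof.
rewrite derive_line; apply: (@derive_quadratic K _ _ 0 1) => // a _.
by rewrite !mxE !mul0r normr_le0 subr_eq0; apply/eqP; ring.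
Qed.

Lemma derive_hadamard (f : rV -> K) (u0 v : rV) (q : 'I_n -> rV -> K) (c : K) :
  (forall i, differentiable (q i) u0) ->
  (\forall u \near u0, f u = c + \sum_i (u 0 i - u0 0 i) * q i u) ->
  'D_v f u0 = \sum_i v 0 i * q i u0.
Proof.
move=> dq fE; rewrite (near_eq_derive v fE).
pose h i (u : rV) := (u 0 i - u0 0 i) * q i u.
have d1 i : differentiable (fun u : rV => u 0 i - u0 0 i) u0.
  by apply: differentiable_subE; [exact: differentiable_coord|exact: differentiable_cst].
have dh i : derivable (h i) u0 v.
  by apply: diff_derivable; exact: differentiable_mulE.
have -> : (fun u : rV => c + \sum_i (u 0 i - u0 0 i) * q i u) = cst c + \sum_i h i.
  by apply/funext => u; rewrite fctE fct_sumE.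
rewrite deriveD; [|exact: derivable_cst|exact: derivable_sum].
rewrite derive_cst add0r derive_sum //; apply: eq_bigr => i _.
rewrite /h deriveM; [|exact: diff_derivable|exact: diff_derivable].
by rewrite derive_coord subrr scale0r add0r -[_ *: _]/(q i u0 * v 0 i) mulrC.
Qed.

End Hadamard.

(** * Tangent vectors *)

Section Expressions.
Variables (K : numClosedFieldType) (n r : nat) (x0 : 'rV[K]_n).
Hypothesis r_gt0 : (0 < r)%N.
Hypothesis unit_compact : compact [set t : K | 0 <= t <= 1].
Local Notation rV := 'rV[K]_n.
Local Notation y0 := (pow_pt r x0).
Local Notation umap := (uhat_map r x0).
Local Notation u0 := (umap y0).
Implicit Types (phi psi Psi : rV -> K).

Lemma near_orbit_id (P : rV -> Prop) : near_orbit (@grn K n r) x0 P -> \forall x \near x0, P x.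
Proof. by move=> /(_ _ (@grn_id K n r)). Qed.

Lemma block_expression_near phi Psi : block_expression r x0 phi Psi ->
  (\forall u \near u0, differentiable Psi u) /\
  \forall x \near x0, phi x = Psi (umap (pow_pt r x)).
Proof.
move=> [eta [_ /near_orbit_id phiE dPsi etaE]]; split => //.
have /(near_comp (@pow_pt_diff K n r x0)) etaE' := etaE.
by apply: filterS (filterI phiE etaE') => x [-> ->].
Qed.

Lemma near_unique Psi Psi' :
  (\forall x \near x0, Psi (umap (pow_pt r x)) = Psi' (umap (pow_pt r x))) ->
  \forall u \near u0, Psi u = Psi' u.
Proof.
move=> E; apply: (@uhat_map_open K n r x0 (fun u => Psi u = Psi' u)).
exact: (@pow_pt_open K n r x0 r_gt0 (fun y => Psi (umap y) = Psi' (umap y))).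
Qed.

(** An expression of [phi] near [x0] alone suffices: [eta] is taken from the expression that is
    known to exist, and the two [Psi] agree as germs. *)
Lemma block_expressionP phi Psi : inv_holo (@grn K n r) x0 phi ->
  (\forall u \near u0, differentiable Psi u) ->
  (\forall x \near x0, phi x = Psi (umap (pow_pt r x))) -> block_expression r x0 phi Psi.
Proof.
move=> ih dPsi phiE; have [Psi0 Psi0E] := block_expression_exists r_gt0 unit_compact ih.
have [_ phiE0] := block_expression_near Psi0E.
have [eta [h1 h2 _ etaE]] := Psi0E; exists eta; split => //.
have PP : \forall u \near u0, Psi0 u = Psi u.
  by apply: near_unique; apply: filterS (filterI phiE phiE0) => x [<- <-].
have /(near_comp (uhat_map_diff r x0 y0)) PP' := PP.
by apply: filterS (filterI etaE PP') => y [-> ->].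
Qed.

(** Near [g x0], both functions are compared through the inverse of [g], which maps to a
    neighbourhood of [x0]. *)
Lemma near_orbit_inv phi psi : inv_holo (@grn K n r) x0 phi -> inv_holo (@grn K n r) x0 psi ->
  (\forall x \near x0, phi x = psi x) ->
  near_orbit (@grn K n r) x0 (fun x => phi x = psi x).
Proof.
move=> ip iq E g Gg; have [h [Gh gK hK]] := grn_inv r_gt0 Gg.
have : \forall x \near g x0, phi (h x) = psi (h x).
  have E' : \forall x \near h (g x0), phi x = psi x by rewrite gK.
  exact: (near_comp (grn_diff _ Gh) E').
move=> {}E; apply: filterS (filterI E (filterI (ip g Gg) (iq g Gg))) => x [hx [[_ ix] [_ iy]]].
by rewrite -(ix h Gh) -(iy h Gh).
Qed.

Lemma inv_holo_lin a phi psi : inv_holo (@grn K n r) x0 phi -> inv_holo (@grn K n r) x0 psi ->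
  inv_holo (@grn K n r) x0 (fun x => a * phi x + psi x).
Proof.
move=> ip iq g Gg; apply: filterS (filterI (ip g Gg) (iq g Gg)) => x [[d1 i1] [d2 i2]].
split; last by move=> h Gh; rewrite i1 // i2.
by apply: differentiable_addE => //; apply: differentiable_mulE => //; exact: differentiable_cst.
Qed.

Lemma inv_holo_mul phi psi : inv_holo (@grn K n r) x0 phi -> inv_holo (@grn K n r) x0 psi ->
  inv_holo (@grn K n r) x0 (fun x => phi x * psi x).
Proof.
move=> ip iq g Gg; apply: filterS (filterI (ip g Gg) (iq g Gg)) => x [[d1 i1] [d2 i2]].
split; last by move=> h Gh; rewrite i1 // i2.
exact: differentiable_mulE.
Qed.

Lemma inv_holo_cst c : inv_holo (@grn K n r) x0 (fun=> c).
Proof.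
move=> g Gg; apply/(@near_normP K 'rV[K]_n (g x0)); exists 1 => // x _.
Qed.

(** Linear combinations and products of invariant functions are expressed by those of their [Psi],
    so the rules for ['D_v] at [u0] carry over to [D]. The spanning derivations and their
    combinations are all treated this way. *)
Lemma tangent_of_expression (D : (rV -> K) -> K) (v : rV) :
  (forall phi Psi, inv_holo (@grn K n r) x0 phi -> block_expression r x0 phi Psi ->
    D phi = 'D_v Psi u0) ->
  tangent_vector r x0 D.
Proof.
move=> DE; have ex phi := block_expression_exists r_gt0 unit_compact (x0 := x0) (phi := phi).
split=> [phi psi ip iq E|a phi psi ip iq|phi psi ip iq].
- have [Psi PE] := ex _ ip; rewrite (DE _ _ ip PE); apply/esym/DE => //.
  have [d1 E1] := block_expression_near PE; apply: block_expressionP => //.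
  by apply: filterS (filterI (near_orbit_id E) E1) => x [-> ->].
- have [Psi PE] := ex _ ip; have [Psi' PE'] := ex _ iq.
  have [d1 E1] := block_expression_near PE; have [d2 E2] := block_expression_near PE'.
  rewrite (DE _ _ ip PE) (DE _ _ iq PE').
  have dP := nbhs_singleton d1; have dP' := nbhs_singleton d2.
  rewrite (DE _ (fun u => a * Psi u + Psi' u)); [|exact: inv_holo_lin|]; last first.
    apply: block_expressionP; first exact: inv_holo_lin.
      apply: filterS (filterI d1 d2) => u [h1 h2]; apply: differentiable_addE => //.
      by apply: differentiable_mulE => //; exact: differentiable_cst.
    by apply: filterS (filterI E1 E2) => x [-> ->].
  rewrite (_ : (fun u => _) = a *: Psi + Psi') //.
  by rewrite deriveD ?deriveZ //; apply: diff_derivable => //; exact: differentiableZ.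
have [Psi PE] := ex _ ip; have [Psi' PE'] := ex _ iq.
have [d1 E1] := block_expression_near PE; have [d2 E2] := block_expression_near PE'.
have dP := nbhs_singleton d1; have dP' := nbhs_singleton d2.
rewrite (DE _ _ ip PE) (DE _ _ iq PE') (nbhs_singleton E1) (nbhs_singleton E2).
rewrite (DE _ (fun u => Psi u * Psi' u)); [|exact: inv_holo_mul|]; last first.
  apply: block_expressionP; first exact: inv_holo_mul.
    by apply: filterS (filterI d1 d2) => u [h1 h2]; exact: differentiable_mulE.
  by apply: filterS (filterI E1 E2) => x [-> ->].
rewrite (_ : (fun u => _) = Psi * Psi') // deriveM; try exact: diff_derivable.
by rewrite addrC -![_ *: _]/(_ * _) [Psi' _ * _]mulrC.
Qed.

Lemma block_expression_unique phi Psi Psi' :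
  block_expression r x0 phi Psi -> block_expression r x0 phi Psi' ->
  \forall u \near u0, Psi u = Psi' u.
Proof.
move=> /block_expression_near[_ E] /block_expression_near[_ E'].
by apply: near_unique; apply: filterS (filterI E E') => x [<- <-].
Qed.

(** Frees [Delta] from the choice made by [xget]. *)
Lemma Delta_expression H d phi Psi : block_expression r x0 phi Psi ->
  Delta r x0 H d phi = 'D_(coord_dir K H d) Psi u0.
Proof.
move=> PE; apply: near_eq_derive; apply: (block_expression_unique (phi := phi)) => //.
by apply: (@xgetPex _ _ [set Psi | block_expression r x0 phi Psi]); exists Psi.
Qed.

End Expressions.

(** * The derivation at a null singleton block *)

Section NullCoordinate.
Variables (K : numClosedFieldType) (n r : nat) (x0 : 'rV[K]_n) (i0 : 'I_n).
Hypothesis r_gt0 : (0 < r)%N.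
Hypothesis unit_compact : compact [set t : K | 0 <= t <= 1].
Local Notation rV := 'rV[K]_n.
Local Notation y0 := (pow_pt r x0).
Local Notation umap := (uhat_map r x0).
Local Notation u0 := (umap y0).
Local Notation dir := (delta_mx 0 i0 : rV).
Hypothesis i0_null : [set i0]%SET \in null_blocks r x0.

Lemma null_blk : blk r x0 i0 = [set i0]%SET.
Proof.
move: i0_null; rewrite finset.inE => /andP[HB _]; apply: block_blk => //.
by rewrite finset.in_set1.
Qed.

Lemma null_coord0 : x0 0 i0 = 0.
Proof.
move: i0_null; rewrite finset.inE => /andP[_ /forallP/(_ i0)].
by rewrite finset.in_set1 eqxx /= expf_eq0 r_gt0 /= => /eqP.
Qed.

Lemma null_rk : rk r x0 i0 = 1%N.
Proof.
have /andP[r1] := rk_bounds r x0 i0; rewrite null_blk cards1 ltnS => r2.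
by apply/eqP; rewrite eqn_leq r1 r2.
Qed.

Lemma not_in_blk i j : i != i0 -> j \in blk r x0 i -> j != i0.
Proof.
move=> ii0 ji; apply: contraNneq ii0 => ji0; rewrite ji0 in ji.
by have := blk_self r x0 i; rewrite -(blk_eq ji) null_blk finset.in_set1.
Qed.

(** The only coordinate of a singleton block is [y 0 i0] itself, and no other block involves it, so
    the block coordinates commute with translations along [dir]. *)
Lemma uhat_map_shift (y : rV) (c : K) : umap (y + c *: dir) = umap y + c *: dir.
Proof.
have yE i : i != i0 -> (y + c *: dir) 0 i = y 0 i.
  by move=> ii0; rewrite !mxE (negPf ii0) andbF mulr0 addr0.
rewrite !uhat_mapE.
have vE i : i != i0 -> elem_map r x0 (y + c *: dir) 0 i = elem_map r x0 y 0 i.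
  move=> ii0; rewrite !mxE; apply: eq_bigr => I /andP[/fintype.subsetP IH _].
  by apply: eq_bigr => j /IH /(not_in_blk ii0); exact: yE.
have e1 (z : rV) : elem_map r x0 z 0 i0 = z 0 i0.
  rewrite mxE null_rk null_blk elem_symE ?cards1 // /block_prod big_set1 subnn.
  by rewrite coefB coefX coefC /= expr1 mulN1r sub0r opprK.
apply/rowP => i; have [->|ii0] := eqVneq i i0.
  rewrite [RHS]mxE !usym_mapE !e1 null_blk null_rk /upoly_coef cards1 subnn divr1 !mul1r.
  rewrite (@usym_low_ext _ _ _ _ _ _ (elem_map r x0 y)) => [|j].
    by rewrite !mxE !eqxx mulr1 addrAC.
  by rewrite null_rk ltnS leqn0 => /eqP j0; have := rk_bounds r x0 j; rewrite j0.
rewrite [RHS]mxE [(c *: dir) 0 i]mxE [dir 0 i]mxE (negPf ii0) andbF mulr0 addr0 !mxE.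
apply: eq_bigr => mu _; congr (_ * _); apply: eq_bigr => h _; congr ((_ * _) ^+ _).
by apply: eq_bigr => j /andP[/(not_in_blk ii0)/vE].
Qed.

Lemma pow_pt_shift (x : rV) (t : K) :
  pow_pt r (x + t *: dir) = pow_pt r x + ((x 0 i0 + t) ^+ r - x 0 i0 ^+ r) *: dir.
Proof.
apply/rowP => i; rewrite !mxE; case: (eqVneq i i0) => [->|_].
  by rewrite eqxx /= !mulr1 addrCA subrr addr0.
by rewrite andbF !mulr0 !addr0.
Qed.

Lemma derive_null (Psi : rV -> K) (x : rV) : differentiable Psi (umap (pow_pt r x)) ->
  'D_dir (fun x => Psi (umap (pow_pt r x))) x =
  r%:R * x 0 i0 ^+ r.-1 * 'D_dir Psi (umap (pow_pt r x)).
Proof.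
move=> dPsi; set u := umap _ in dPsi *; rewrite derive_line.
(* The increment of [x 0 i0 ^+ r] when [x 0 i0] grows by [t]. By the shift formulas, [Psi] is then
   evaluated along a line in direction [dir]. *)
pose c (t : K) := (x 0 i0 + t) ^+ r - x 0 i0 ^+ r.
pose G (s : K) := Psi (u + s *: dir).
have -> : (fun t : K => Psi (umap (pow_pt r (x + t *: dir)))) = G \o c.
  by apply/funext => t; rewrite /G /c /= pow_pt_shift uhat_map_shift.
have c0 : c 0 = 0 by rewrite /c addr0 subrr.
have dG : differentiable G (c 0).
  rewrite c0; apply: (differentiable_comp (differentiable_line u dir 0)).
  by rewrite scale0r addr0.
have dshift : differentiable (fun t : K => x 0 i0 + t) 0.
  by apply: differentiable_addE; first exact: differentiable_cst.
have dc : differentiable c 0.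
  apply: differentiable_subE; last exact: differentiable_cst.
  exact: differentiable_expE.
have Dc : 'D_1 c 0 = r%:R * x 0 i0 ^+ r.-1.
  pose a : K := x 0 i0; have -> : c = (cst a + id) ^+ r - cst (a ^+ r).
    by apply/funext => t; rewrite /c /= -/a !fctE.
  have da : derivable (cst a + id : K -> K) 0 1.
    by apply: derivableD; [exact: derivable_cst|exact: derivable_id].
  rewrite deriveB; [|exact: derivableX|exact: derivable_cst].
  rewrite derive_cst subr0 deriveX // deriveD; [|exact: derivable_cst|exact: derivable_id].
  by rewrite derive_cst derive_id add0r fctE addr0 -[LHS]/(_ * 1) mulr1.
have dcE : 'd c 0 (1 : K) = r%:R * x 0 i0 ^+ r.-1 by rewrite -(deriveE _ dc).
have dGE : 'd G 0 (1 : K) = 'D_dir Psi u.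
  by move: dG; rewrite c0 => dG; rewrite -(deriveE _ dG) [RHS]derive_line.
have lin (k : K) : 'd G 0 k = k * 'd G 0 (1 : K).
  by rewrite -{1}[k]mulr1; exact: (linearZ_LR ('d G 0) k (1 : K)).
rewrite deriveE; last exact: differentiable_comp.
rewrite diff_comp //.
by rewrite -[LHS]/('d G (c 0) ('d c 0 (1 : K))) c0 dcE lin dGE.
Qed.

(** Dividing by [r%:R * x 0 i0 ^+ r.-1] leaves the derivative of [Psi], which is holomorphic also
    where [x 0 i0] vanishes. *)
Lemma null_extension_exists phi Psi : block_expression r x0 phi Psi ->
  null_extension r x0 i0 phi (fun x => 'D_dir Psi (umap (pow_pt r x))).
Proof.
move=> PE; have [dPsi E] := block_expression_near PE.
have pull (Q : rV -> Prop) : (\forall u \near u0, Q u) ->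
    \forall x \near x0, Q (umap (pow_pt r x)).
  move=> nQ; have nQ' := near_comp (uhat_map_diff r x0 y0) nQ.
  exact: (near_comp (@pow_pt_diff K n r x0) nQ').
split.
  have := pull _ (derive_differentiable unit_compact dir dPsi).
  apply: filterS => x dD.
  apply: (@differentiable_comp _ _ _ _ (fun x => umap (pow_pt r x)) (fun u => 'D_dir Psi u)) => //.
  apply: (@differentiable_comp _ _ _ _ (@pow_pt K n r) umap); first exact: pow_pt_diff.
  exact: uhat_map_diff.
(* Derivatives at [x] agree only if the two functions agree in a neighbourhood of [x]. *)
have nE := near_join E; have nd := pull _ dPsi.
apply: filterS (filterI nE nd) => x [Ex dx] xi0.
rewrite (near_eq_derive dir Ex) derive_null // mulKf //.
by rewrite mulf_neq0 ?expf_neq0 // pnatr_eq0 -lt0n.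
Qed.

Lemma null_extension_unique phi (h1 h2 : rV -> K) :
  null_extension r x0 i0 phi h1 -> null_extension r x0 i0 phi h2 -> h1 x0 = h2 x0.
Proof.
move=> [/nbhs_singleton d1 E1] [/nbhs_singleton d2 E2].
have E : \forall x \near x0, (x : rV) 0 i0 != 0 -> h1 x = h2 x.
  by apply: filterS (filterI E1 E2) => x [e1 e2] xi; rewrite e1 // e2.
have /continuous_normP dc : {for x0, continuous (fun x => h1 x - h2 x)}.
  by apply: differentiable_continuous; exact: differentiable_subE.
apply/eqP; rewrite -subr_eq0 -normr_le0; apply/ler_addgt0Pl => e e0; rewrite addr0.
have [d d0 dP] := dc e e0; have [d' d'0 d'P] := near_polydisc_radius E.
have [c [c0 cd cd']] := pos_lower_bound d0 d'0.
(* A point off the hyperplane where coordinate [i0] vanishes, within the radii supplied by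
   continuity and by the local equality. *)
pose x := x0 + (c / 2) *: dir; have c20 : 0 < c / 2 by rewrite divr_gt0.
have xc : polydisc x0 c x.
  move=> i; rewrite !mxE addrAC subrr add0r normrM gtr0_norm //.
  case: (i == i0); rewrite ?eqxx /= ?normr1 ?normr0 ?mulr1 ?mulr0 //.
  by rewrite ltr_pdivrMr // ltr_pMr // ltr1n.
have := d'P x (polydisc_le cd' xc); rewrite {1}/x !mxE !eqxx mulr1 null_coord0 add0r gt_eqF //.
move=> /(_ isT) hx.
have := dP x (row_normP d0 (polydisc_le cd xc)).
by rewrite hx subrr sub0r normrN => /ltW.
Qed.

Lemma Delta0_expression phi Psi : block_expression r x0 phi Psi ->
  Delta0 r x0 i0 phi = 'D_dir Psi u0.
Proof.
move=> /null_extension_exists nE; apply: (null_extension_unique (phi := phi) _ nE).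
apply: (@xgetPex _ _ [set h | null_extension r x0 i0 phi h]).
by exists (fun x => 'D_dir Psi (umap (pow_pt r x))).
Qed.

End NullCoordinate.

(** * Lifting germs in the block coordinates to invariant functions *)

Section Lift.
Variables (K : numClosedFieldType) (n r : nat) (x0 : 'rV[K]_n).
Hypothesis r_gt0 : (0 < r)%N.
Local Notation rV := 'rV[K]_n.
Local Notation y0 := (pow_pt r x0).
Local Notation umap := (uhat_map r x0).
Local Notation u0 := (umap y0).

Lemma coord_separated : exists2 d : K, 0 < d &
  forall i j, y0 0 i != y0 0 j -> d + d <= `|y0 0 i - y0 0 j|.
Proof.
have [|ij|d d0 dP] := @finite_pos_lower_bound K ('I_n * 'I_n)%type
  (fun ij d => y0 0 ij.1 != y0 0 ij.2 -> d + d <= `|y0 0 ij.1 - y0 0 ij.2|).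
- by move=> ij e e' _ ee h /h; apply: le_trans; exact: lerD.
- have [E|E] := eqVneq (y0 0 ij.1) (y0 0 ij.2); first by exists 1.
  exists (`|y0 0 ij.1 - y0 0 ij.2| / 2); first by rewrite divr_gt0 // normr_gt0 subr_eq0.
  by rewrite -splitr.
by exists d => // i j; exact: (dP (i, j)).
Qed.

(** [Psi] composed with the coordinates is symmetric only within blocks. It is spread over the
    [S_n]-orbit of a small polydisc around [y0], by permuting a point back into the polydisc; the
    result is invariant by construction. *)
Lemma block_expression_lift (Psi : rV -> K) : (\forall u \near u0, differentiable Psi u) ->
  exists phi, inv_holo (@grn K n r) x0 phi /\ block_expression r x0 phi Psi.
Proof.
move=> dPsi; have := near_comp (uhat_map_diff r x0 y0) dPsi.
move=> /near_polydisc_radius[d1 d10 d1P]; have [d2 d20 sep] := coord_separated.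
have [d [d0 dd1 dd2]] := pos_lower_bound d10 d20.
pose eta (y : rV) := xget (0 : K)
  [set c | exists s, polydisc y0 d (perm_pt s y) /\ c = Psi (umap (perm_pt s y))].
(* The value is well defined: distinct coordinates of [y0] are at least [d + d] apart, so a
   permutation taking a point of the polydisc into the polydisc preserves the blocks. *)
have same (y : rV) (s : 'S_n) : polydisc y0 d y -> polydisc y0 d (perm_pt s y) ->
    umap (perm_pt s y) = umap y.
  move=> yd syd; rewrite !uhat_mapE elem_map_perm // => i.
  apply/eqP/negPn/negP => /sep; apply/negP.
  have h1 := lt_le_trans (yd i) dd2; have h2 := lt_le_trans (syd (s i)) dd2.
  rewrite mxE permK in h2; rewrite real_leNgt ?normr_real ?realD ?gtr0_real // negbK.
  have -> : y0 0 (s i) - y0 0 i = (y 0 i - y0 0 i) - (y 0 i - y0 0 (s i)) by ring.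
  by rewrite (le_lt_trans (ler_normB _ _)) // ltrD.
have etaE (y : rV) s : polydisc y0 d (perm_pt s y) -> eta y = Psi (umap (perm_pt s y)).
  move=> sd; rewrite /eta; case: xgetP => [c _ [t [td ->]]|/(_ (Psi (umap (perm_pt s y))))].
    congr Psi; have tE : perm_pt t y = perm_pt (s^-1 * t)%g (perm_pt s y).
      by rewrite perm_ptM mulKVg.
    by rewrite tE same // -tE.
  by case; exists s.
have eta_inv (y : rV) t : eta (perm_pt t y) = eta y.
  rewrite /eta; congr xget; apply/seteqP; split=> c [s [sd ->]].
    by exists (t * s)%g; rewrite -perm_ptM.
  exists (t^-1 * s)%g; have -> : perm_pt (t^-1 * s)%g (perm_pt t y) = perm_pt s y.
    by rewrite perm_ptM mulKVg.
  by [].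
have eta_holo : inv_holo (@symn K n) y0 eta.
  move=> _ [t ->]; rewrite -/(perm_pt t _).
  have ty : polydisc y0 d (perm_pt t^-1 (perm_pt t y0)).
    by rewrite perm_ptK => i; rewrite subrr normr0.
  have near_y := near_comp (perm_pt_diff t^-1 (perm_pt t y0)) (near_polydisc ty).
  have nn := near_join near_y; apply: filterS nn => y ny; split; last first.
    by move=> _ [s ->]; exact: eta_inv.
  have yd := nbhs_singleton ny.
  apply: (@near_eq_differentiable K _ _ (fun y => Psi (umap (perm_pt t^-1 y)))).
    by apply: filterS ny => z zd; rewrite (etaE z t^-1%g).
  apply: (@differentiable_comp _ _ _ _ (perm_pt t^-1) (fun y => Psi (umap y))).
    exact: perm_pt_diff.
  apply: (@differentiable_comp _ _ _ _ umap Psi); first exact: uhat_map_diff.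
  exact/d1P/(polydisc_le dd1 yd).
exists (fun x => eta (pow_pt r x)); split.
  move=> g [z [s [z1 gE]]].
  have h : \forall y \near pow_pt r (g x0), differentiable eta y.
    rewrite gE pow_act //; have := eta_holo (perm_pt s).
    by move=> /(_ (ex_intro _ s erefl)); apply: filterS => y [].
  have h' := near_comp (@pow_pt_diff K n r (g x0)) h.
  apply: filterS h' => x dx; split.
    by apply: differentiable_comp => //; exact: pow_pt_diff.
  by move=> _ [w [t [w1 ->]]]; rewrite pow_act // eta_inv.
exists eta; split => //.
  move=> g _; apply/(@near_normP K 'rV[K]_n (g x0)); exists 1 => //.
have : polydisc y0 d y0 by move=> i; rewrite subrr normr0.
move=> /near_polydisc; apply: filterS => y yd.
by rewrite (etaE y 1%g) perm_pt1.
Qed.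

End Lift.

(** * Sums over coordinates regrouped by blocks and ranks *)

Section BlockSums.
Variables (K : numClosedFieldType) (n r : nat) (x0 : 'rV[K]_n).
Hypothesis null_singleton : forall H : {set 'I_n}, H \in null_blocks r x0 ->
  exists i0 : 'I_n, H = [set i0]%SET.

Lemma coord_dir_rank (H : {set 'I_n}) i : i \in H -> coord_dir K H (block_rank H i) = delta_mx 0 i.
Proof.
move=> iH; apply/rowP => j; rewrite !mxE eqxx /=; congr _%:R; congr nat_of_bool.
apply/andP/eqP => [[jH /eqP]|->]; [exact: block_rank_inj|by []].
Qed.

Lemma blk_null i : (blk r x0 i \in null_blocks r x0) = ([set i]%SET \in null_blocks r x0).
Proof.
apply/idP/idP => [Bi|/[dup] /null_blk -> //].
have [j E] := null_singleton Bi; have := blk_self r x0 i.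
by rewrite {1}E finset.in_set1 => /eqP ->; rewrite -E.
Qed.

Lemma blk_nonzero i :
  (blk r x0 i \in nonzero_blocks r x0) = ([set i]%SET \notin null_blocks r x0).
Proof. by rewrite -blk_null !finset.inE blk_block. Qed.

(** Null blocks are singletons, so they are indexed by their only element. *)
Lemma sum_blocks (F : 'I_n -> K) : \sum_i F i =
  \sum_(H in nonzero_blocks r x0) \sum_(i in H) F i
  + \sum_(i | [set i]%SET \in null_blocks r x0) F i.
Proof.
rewrite (bigID (fun i => [set i]%SET \in null_blocks r x0)) /= addrC; congr (_ + _).
rewrite (partition_big (blk r x0) (mem (nonzero_blocks r x0))) => [|i]; last first.
  by rewrite /= blk_nonzero.
apply: eq_bigr => H HN; apply: eq_bigl => i; rewrite -blk_nonzero.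
have HB : H \in blocks r x0 by move: HN; rewrite /= /nonzero_blocks finset.inE => /andP[].
apply/andP/idP => [[_ /eqP <-]|iH]; first exact: blk_self.
by rewrite (block_blk HB iH).
Qed.

(** The inner sum picks out the one index of rank [d]; this converts coefficients indexed by ['I_n]
    into coefficients indexed by pairs [(H, d)]. *)
Lemma sum_ranks (F : 'I_n -> K) (G : {set 'I_n} -> nat -> K) (H : {set 'I_n}) :
  \sum_(1 <= d < #|H|.+1) (\sum_(i in H | block_rank H i == d) F i) * G H d =
  \sum_(i in H) F i * G H (block_rank H i).
Proof.
rewrite -(big_block_rank H (+%R) (fun d => (\sum_(i in H | block_rank H i == d) F i) * G H d)).
apply: eq_bigr => i iH; congr (_ * _); rewrite (big_pred1 i) // => j.
apply/andP/eqP => [[jH /eqP]|->]; [exact: block_rank_inj|by []].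
Qed.

End BlockSums.

(** * The spanning theorem over an abstract field *)

Section TangentSpace.
Variables (K : numClosedFieldType) (n r : nat) (x0 : 'rV[K]_n).
Hypothesis r_gt0 : (0 < r)%N.
Hypothesis unit_compact : compact [set t : K | 0 <= t <= 1].
Hypothesis null_singleton : forall H : {set 'I_n}, H \in null_blocks r x0 ->
  exists i0 : 'I_n, H = [set i0]%SET.
Local Notation rV := 'rV[K]_n.
Local Notation y0 := (pow_pt r x0).
Local Notation umap := (uhat_map r x0).
Local Notation u0 := (umap y0).
Local Notation holo := (inv_holo (@grn K n r) x0).

Lemma inv_holo_sum (I : Type) (s : seq I) (f : I -> rV -> K) : (forall i, holo (f i)) ->
  holo (fun x => \sum_(i <- s) f i x).
Proof.
move=> hf; elim: s => [|i s IH].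
  by under eq_fun do rewrite big_nil; exact: inv_holo_cst.
under eq_fun do rewrite big_cons -[f i _]mul1r.
exact: inv_holo_lin.
Qed.

(** The Leibniz rule for [1 * 1] gives [D 1 = D 1 + D 1]. A constant [c] is then written
    [(c - 1) * 1 + 1] to fit the form in which linearity is stated. *)
Lemma tangent_cst (D : (rV -> K) -> K) c : tangent_vector r x0 D -> D (fun=> c) = 0.
Proof.
move=> [_ lin leib]; have h a : holo (fun=> a) by exact: inv_holo_cst.
have D1 : D (fun=> 1) = 0.
  have := leib _ _ (h 1) (h 1); under eq_fun do rewrite mulr1.
  by rewrite mulr1 mul1r -[LHS]addr0 => /addrI.
have := lin (c - 1) _ _ (h 1) (h 1); rewrite D1 mulr0 addr0 => <-.
by congr D; apply/funext => x; rewrite mulr1 subrK.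
Qed.

Lemma tangent_sum (D : (rV -> K) -> K) (I : Type) (s : seq I) (f : I -> rV -> K) :
  tangent_vector r x0 D -> (forall i, holo (f i)) ->
  D (fun x => \sum_(i <- s) f i x) = \sum_(i <- s) D (f i).
Proof.
move=> tD hf; elim: s => [|i s IH].
  by under eq_fun do rewrite big_nil; rewrite big_nil tangent_cst.
have [_ lin _] := tD.
under eq_fun do rewrite big_cons -[f i _]mul1r.
by rewrite lin ?big_cons ?mul1r ?IH //; exact: inv_holo_sum.
Qed.

Lemma Delta_tangent (H : {set 'I_n}) d : tangent_vector r x0 (Delta r x0 H d).
Proof.
apply: (@tangent_of_expression _ _ _ _ r_gt0 unit_compact _ (coord_dir K H d)).
by move=> phi Psi _; exact: Delta_expression.
Qed.

Lemma Delta0_tangent i0 : [set i0]%SET \in null_blocks r x0 ->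
  tangent_vector r x0 (Delta0 r x0 i0).
Proof.
move=> i0N; apply: (@tangent_of_expression _ _ _ _ r_gt0 unit_compact _ (delta_mx 0 i0)).
by move=> phi Psi _; exact: Delta0_expression.
Qed.

Lemma tangent_span (c : {set 'I_n} -> nat -> K) (c0 : 'I_n -> K) (D : (rV -> K) -> K) :
  (forall phi, holo phi -> D phi =
     \sum_(H in nonzero_blocks r x0) \sum_(1 <= d < #|H|.+1) c H d * Delta r x0 H d phi
     + \sum_(i0 | [set i0]%SET \in null_blocks r x0) c0 i0 * Delta0 r x0 i0 phi) ->
  tangent_vector r x0 D.
Proof.
move=> DE; pose v : rV :=
  \sum_(H in nonzero_blocks r x0) \sum_(1 <= d < #|H|.+1) c H d *: coord_dir K H d
  + \sum_(i0 | [set i0]%SET \in null_blocks r x0) c0 i0 *: delta_mx 0 i0.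
apply: (@tangent_of_expression _ _ _ _ r_gt0 unit_compact _ v) => phi Psi hphi PE.
have [dPsi _] := block_expression_near PE; have {}dPsi := nbhs_singleton dPsi.
rewrite DE // deriveE // /v linearD !linear_sum; congr (_ + _); apply: eq_bigr => H HN.
  rewrite linear_sum; apply: eq_bigr => d _.
  by rewrite linearZ -deriveE // (Delta_expression _ _ _ PE).
by rewrite linearZ -deriveE // (Delta0_expression _ _ _ PE).
Qed.

(** The coefficient [a i] is the value of [D] on an invariant lift [f i] of [u 0 i - u0 0 i]. The
    quotients of Hadamard's lemma are lifted as well, since [D] acts on invariant functions of [x];
    their own derivatives drop out because [f i] vanishes at [x0]. *)
Lemma tangent_expansion (D : (rV -> K) -> K) : tangent_vector r x0 D ->
  exists a : 'I_n -> K, forall phi Psi, holo phi -> block_expression r x0 phi Psi ->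
    D phi = \sum_i a i * 'D_(delta_mx 0 i) Psi u0.
Proof.
move=> tD; have [ext lin leib] := tD.
have lift Psi : (\forall u \near u0, differentiable Psi u) ->
    exists f, holo f /\ block_expression r x0 f Psi by exact: block_expression_lift.
have /choice[f fP] : forall i : 'I_n, exists f, holo f /\
    block_expression r x0 f (fun u : rV => u 0 i - u0 0 i).
  move=> i; apply: lift; apply/(@near_normP K 'rV[K]_n u0); exists 1 => // u _.
  by apply: differentiable_subE; [exact: differentiable_coord|exact: differentiable_cst].
exists (fun i => D (f i)) => phi Psi hphi PE.
have [dPsi phiE] := block_expression_near PE.
have [q [dq qE]] := hadamard unit_compact dPsi.
have /choice[g gP] : forall i : 'I_n, exists g, holo g /\ block_expression r x0 g (q i).
  by move=> i; exact: lift.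
have hf i : holo (f i) by have [] := fP i.
have hg i : holo (g i) by have [] := gP i.
have hfg i : holo (fun x => f i x * g i x) by exact: inv_holo_mul.
have fE i : \forall x \near x0, f i x = umap (pow_pt r x) 0 i - u0 0 i.
  by have [_ /block_expression_near[]] := fP i.
have gE i : \forall x \near x0, g i x = q i (umap (pow_pt r x)).
  by have [_ /block_expression_near[]] := gP i.
have E : \forall x \near x0,
    phi x = 1 * (\sum_i f i x * g i x) + Psi u0.
  have qE' := near_comp (uhat_map_diff r x0 y0) qE.
  have qE2 := near_comp (@pow_pt_diff K n r x0) qE'.
  have fE' := @filter_forall _ 'I_n _ (nbhs x0) (nbhs_filter x0) fE.
  have gE' := @filter_forall _ 'I_n _ (nbhs x0) (nbhs_filter x0) gE.
  apply: filterS (filterI (filterI phiE qE2) (filterI fE' gE')) => x [[-> ->] [fx gx]].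
  by rewrite mul1r addrC; congr (_ + _); apply: eq_bigr => i _; rewrite fx gx.
have hsum : holo (fun x => \sum_i f i x * g i x) by exact: inv_holo_sum.
rewrite (ext _ _ hphi _ (near_orbit_inv r_gt0 hphi _ E)); last 2 first.
- by apply: inv_holo_lin => //; exact: inv_holo_cst.
- by apply: inv_holo_lin => //; exact: inv_holo_cst.
rewrite lin //; last exact: inv_holo_cst.
rewrite tangent_cst // addr0 mul1r tangent_sum //; apply: eq_bigr => i _.
rewrite leib // (nbhs_singleton (fE i)) subrr mul0r addr0 (nbhs_singleton (gE i)).
congr (_ * _).
rewrite (derive_hadamard (q := q) (c := Psi u0) (delta_mx 0 i)) //.
  rewrite (bigD1 i) //= mxE !eqxx mul1r big1 ?addr0 // => j ji.
  by rewrite mxE (negPf ji) andbF mul0r.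
by move=> j; exact: nbhs_singleton (dq j).
Qed.

Lemma tangent_spaceP (D : (rV -> K) -> K) : (#|null_blocks r x0| <= 1)%N ->
  tangent_vector r x0 D <->
  exists (c : {set 'I_n} -> nat -> K) (c0 : K), forall phi, holo phi -> D phi =
     \sum_(H in nonzero_blocks r x0) \sum_(1 <= d < #|H|.+1) c H d * Delta r x0 H d phi
     + \sum_(i0 | [set i0]%SET \in null_blocks r x0) c0 * Delta0 r x0 i0 phi.
Proof.
move=> null_le1; split=> [/tangent_expansion[a aP]|[c [c0 DE]]]; last exact: tangent_span DE.
exists (fun (H : {set 'I_n}) d => \sum_(i in H | block_rank H i == d) a i).
(* At most one term, as there is at most one null block. *)
exists (\sum_(i | [set i]%SET \in null_blocks r x0) a i) => phi hphi.
have [Psi PE] := block_expression_exists r_gt0 unit_compact hphi.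
rewrite (aP _ _ hphi PE) (sum_blocks null_singleton); congr (_ + _).
  apply: eq_bigr => H HN; rewrite (sum_ranks a (fun H d => Delta r x0 H d phi)); apply: eq_bigr => i iH.
  by rewrite (Delta_expression _ _ _ PE) // coord_dir_rank.
apply: eq_bigr => i iN; rewrite (Delta0_expression _ _ _ PE) // (big_pred1 i) // => j.
apply/idP/eqP => [jN|->//].
have /card_le1_eqP/(_ _ _ jN iN)/finset.set1_inj := null_le1.
by [].
Qed.

End TangentSpace.

(** In [R[i]], comparability with 0 forces the imaginary part to vanish, so this set is the
    continuous image of the real segment. *)
Lemma complex_unit_compact (R : realType) :
  compact [set t : (R[i] : numClosedFieldType) | 0 <= t <= 1].
Proof.
have -> : [set t : (R[i] : numClosedFieldType) | 0 <= t <= 1] =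
    (fun t : R => (t%:C)%C : (R[i] : numClosedFieldType)) @` `[0, 1].
  apply/seteqP; split=> [[a b] /andP[t0 t1]|_ [t + <-]]; last first.
    by rewrite /= in_itv /= => /andP[t0 t1]; rewrite ler0c lecR t0.
  move: t0 t1; rewrite !lecE /= => /andP[/eqP -> a0] /andP[_ a1].
  by exists a => //; rewrite /= in_itv /= a0.
apply: continuous_compact; last exact: segment_compact.
apply: continuous_subspaceT => t; apply/cvgrPdist_lt => -[a b].
rewrite ltcE /= => /andP[/eqP -> a0].
have : \forall s \near t, `|t - s| < a.
  have /cvgrPdist_lt : s @[s --> t] --> t by exact: cvg_id.
  exact.
apply: filterS => s ts; rewrite -[X in `|X|]/(((t%:C)%C - (s%:C)%C) : R[i]).
by rewrite -raddfB normc_def /= expr0n addr0 sqrtr_sqr ltcR.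
Qed.

Local Open Scope complex_scope.

Theorem corollary8p8 (R : realType) (n r : nat)
    (n_gt0 : (0 < n)%N) (r_gt0 : (0 < r)%N) (x0 : 'rV[R[i]]_n)
    (null_le1 : (#|null_blocks r x0| <= 1)%N)
    (null_singleton : forall H : {set 'I_n}, H \in null_blocks r x0 ->
       exists i0 : 'I_n, H = [set i0]%SET) :
  [/\ forall D : ('rV[R[i]]_n -> R[i]) -> R[i],
        tangent_vector r x0 D <->
        exists (c : {set 'I_n} -> nat -> R[i]) (c0 : R[i]),
        forall phi : 'rV[R[i]]_n -> R[i],
          inv_holo (grn r) x0 phi ->
          D phi =
            \sum_(H in nonzero_blocks r x0) \sum_(1 <= d < #|H|.+1)
               c H d * Delta r x0 H d phi
            + \sum_(i0 : 'I_n | [set i0]%SET \in null_blocks r x0)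
               c0 * Delta0 r x0 i0 phi,
      forall (H : {set 'I_n}) (d : nat),
        H \in nonzero_blocks r x0 -> (1 <= d <= #|H|)%N ->
        leibniz r x0 (Delta r x0 H d) &
      forall i0 : 'I_n, [set i0]%SET \in null_blocks r x0 ->
        leibniz r x0 (Delta0 r x0 i0)].
Proof.
have unit_compact := @complex_unit_compact R.
split=> [D|H d _ _|i0 i0N].
- exact: (tangent_spaceP r_gt0 unit_compact null_singleton D null_le1).
- by have [_ _] := Delta_tangent x0 r_gt0 unit_compact H d.
by have [_ _] := Delta0_tangent r_gt0 unit_compact i0N.
Qed.
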